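(* Let $\gamma$ be a $\tau$-periodic trajectory of a Lagrangian system on an $m$-dimensional manifold with Poincaré map $P:W\to W$. Suppose that $N=\operatorname{Ker}(P-I)^2$ is symplectic and $V=\operatorname{Ker}(P-I)$, $\dim V=k$, is a Lagrangian subspace in $N$. Suppose that $\gamma$ is nondegenerate $\mathrm{mod}\ V$, that is, $\dim F_t=k$ for all $t$ and $\det A^\perp\ne0$. Then $$\operatorname{ind} h-\operatorname{ind} h^\perp=\operatorname{ind} A-\operatorname{ind} A^\perp .$$
   Context: Summation over repeated Greek indices from $1$ to $k$ is assumed; $\operatorname{ind}$ is the negative index of a symmetric bilinear form or matrix. The Lagrangian $\mathscr{L}(x,\dot x,t)$ is smooth, $\tau$-periodic in $t$, with $\mathscr{L}_{\dot x\dot x}$ positive definite. $E_t=T_{\gamma(t)}M$, $t\in\mathbb{R}/\tau\mathbb{Z}$, with metric $(v,w)=\langle\mathscr{L}_{\dot x\dot x}(\gamma,\dot\gamma,t)v,w\rangle$; $X$ is the space of $\tau$-periodic $W^{1,2}$ fields $\xi(t)\in E_t$. The second variation of the action $\int_0^\tau\mathscr{L}dt$ at $\gamma$ is uniquely written as $h(\xi,\eta)=\int_0^\tau((D\xi,D\eta)+(U\xi,\eta))dt$ on $X$, with $D$ a covariant derivative compatible with the metric and $U(t)$ symmetric. The variational system is $D^2\xi=U\xi$; $P(\xi(0),D\xi(0))=(\xi(\tau),D\xi(\tau))$ on $W=E_0\oplus E_0$; $\omega(w,v)=(\zeta,D\xi)-(\xi,D\zeta)$, for $w,v\in W$ corresponding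 to solutions $\zeta,\xi$, is the invariant symplectic form. Let $w^1,\dots,w^k$ be a basis of $V$ and $\zeta^1,\dots,\zeta^k$ the corresponding $\tau$-periodic solutions; $F_t=\operatorname{span}(\zeta^1(t),\dots,\zeta^k(t))$; $g^{\alpha\beta}(t)=(\zeta^\alpha(t),\zeta^\beta(t))$, $(g_{\alpha\beta})=(g^{\alpha\beta})^{-1}$, $\bar g_{\alpha\beta}=\int_0^\tau g_{\alpha\beta}dt$, $(\kappa^{\alpha\beta})=(\bar g_{\alpha\beta})^{-1}$. $E_t^\perp$ is the orthogonal complement of $F_t$ in $E_t$, $\Pi$ the orthogonal projection onto it, $D^\perp=\Pi D$, $X^\perp=\{\eta\in X:\eta(t)\in E_t^\perp\}$, and on $X^\perp$ $$h^\perp(\eta,\eta)=\int_0^\tau\bigl((D^\perp\eta,D^\perp\eta)+(U\eta,\eta)-3g_{\alpha\beta}(\eta,D^\perp\zeta^\alpha)(\eta,D^\perp\zeta^\beta)\bigr)dt .$$ Let $q_1,\dots,q_k$ be the basis in a Lagrangian complement of $V$ in $N$ with $\omega(w^\alpha,q_\beta)=\delta^\alpha_\beta$, $\omega(q_\alpha,q_\beta)=0$; then $Pq_\alpha=q_\alpha+s_{\alpha\beta}w^\beta$ with $(s_{\alpha\beta})$ symmetric, and $A=(a_{\alpha\beta})$, $A^\perp=(a^\perp_{\alpha\beta})$, $$a_{\alpha\beta}=s_{\alpha\delta}\kappa^{\delta\varepsilon}s_{\varepsilon\beta}-s_{\alpha\beta},\qquad a^\perp_{\alpha\beta}=s_{\alpha\beta}-\bar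 g_{\alpha\beta}.$$ *)

(* Defs.v *)
From HB Require Import structures.
From mathcomp Require Import all_boot all_order all_algebra.
From mathcomp Require Import all_classical all_reals all_analysis.

Set Implicit Arguments.
Unset Strict Implicit.
Unset Printing Implicit Defensive.

Import Order.TTheory GRing.Theory Num.Theory.
Import numFieldNormedType.Exports.

Local Open Scope classical_set_scope.
Local Open Scope ring_scope.

(* Linear algebra in possibly infinite-dimensional spaces; subspaces are
   sets closed under linear combinations. *)

Definition lin_span (R : realType) (E : lmodType R) (n : nat) (e : 'I_n -> E) :
    set E :=
  [set x | exists c : 'I_n -> R, x = \sum_i c i *: e i].

Definition lin_indep (R : realType) (E : lmodType R) (n : nat) (e : 'I_n -> E) :=
  forall c : 'I_n -> R, \sum_i c i *: e i = 0 -> forall i, c i = 0.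

Definition is_basis (R : realType) (E : lmodType R) (n : nat) (e : 'I_n -> E)
    (S : set E) :=
  lin_indep e /\ lin_span e = S.

Definition has_dim (R : realType) (E : lmodType R) (S : set E) (n : nat) :=
  exists e : 'I_n -> E, is_basis e S.

(* Negative index of b on the subspace S: the supremum (possibly +oo) of the
   dimensions of the subspaces of S on which b is negative definite. *)
Definition ind (R : realType) (E : lmodType R) (S : set E) (b : E -> E -> R) :
    \bar R :=
  ereal_sup [set (n%:R)%:E | n in
    [set n : nat | exists T : set E, [/\ T `<=` S, has_dim T n &
      forall x, T x -> x <> 0 -> b x x < 0]]].

Definition ind_mx (R : realType) (k : nat) (A : 'M[R]_k) : \bar R :=
  ind setT (fun x y : 'cV[R]_k => (x^T *m A *m y) 0 0).

(* Elements of the subspace S annihilated by f. *)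
Definition ker_on (R : realType) (E : lmodType R) (S : set E) (f : E -> E) :
    set E :=
  [set x | S x /\ f x = 0].

Definition symplectic_on (R : realType) (E : lmodType R) (om : E -> E -> R)
    (N : set E) :=
  forall x, N x -> (forall y, N y -> om x y = 0) -> x = 0.

(* V coincides with its om-orthogonal complement in N. *)
Definition lagrangian_subspace (R : realType) (E : lmodType R)
    (om : E -> E -> R) (N V : set E) :=
  [/\ V `<=` N,
      forall x y, V x -> V y -> om x y = 0 &
      forall x, N x -> (forall y, V y -> om x y = 0) -> V x].

Definition complement_in (R : realType) (E : lmodType R) (N V Q : set E) :=
  [/\ Q `<=` N, V `&` Q `<=` [set 0] &
      forall x, N x -> exists v y, [/\ V v, Q y & x = v + y]].

(* Orthogonal projection, with respect to b, of the subspace S of E onto the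
   b-orthogonal complement of F in S. *)
Definition orth_compl (R : realType) (E : lmodType R) (b : E -> E -> R)
    (S F : set E) : set E :=
  [set u | S u /\ forall v, F v -> b u v = 0].

Definition orth_proj (R : realType) (E : lmodType R) (b : E -> E -> R)
    (S F : set E) (v : E) : E :=
  xget 0 [set u | orth_compl b S F u /\ F (v - u)].

(* Smoothness on an open set A; in finite dimension a map is C^(n+1) iff it is
   differentiable and all its directional derivatives are C^n. *)
Fixpoint C_n (R : realType) (V W : normedModType R) (n : nat) (A : set V)
    (f : V -> W) : Prop :=
  match n with
  | 0 => forall x, A x -> {for x, continuous f}
  | n'.+1 => (forall x, A x -> differentiable f x) /\
             forall v, C_n n' A (fun x => 'D_v f x)
  end.

Definition smooth (R : realType) (V W : normedModType R) (A : set V)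
    (f : V -> W) :=
  forall n, C_n n A f.

(* Smooth m-dimensional manifolds, given by an atlas. The functions chart i and
   param i are mutually inverse between dom i and its open image; their values
   outside these sets are irrelevant. *)
Record manifold (R : realType) (m : nat) := Manifold {
  point_of :> topologicalType ;
  manifold_hausdorff : hausdorff_space point_of ;
  manifold_countable : @second_countable point_of ;
  idx : Type ;
  dom : idx -> set point_of ;
  chart : idx -> point_of -> 'cV[R]_m ;
  param : idx -> 'cV[R]_m -> point_of ;
  dom_open : forall i, open (dom i) ;
  dom_cover : forall p, exists i, dom i p ;
  chart_open : forall i, open (chart i @` dom i) ;
  chartK : forall i p, dom i p -> param i (chart i p) = p ;
  chart_continuous : forall i p, dom i p -> {for p, continuous (chart i)} ;
  param_continuous : forall i x, (chart i @` dom i) x ->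
    {for x, continuous (param i)} ;
  transition_smooth : forall i j,
    smooth (chart i @` (dom i `&` dom j)) (chart j \o param i) }.

Arguments idx {R m} M : rename.
Arguments dom {R m M} i : rename.
Arguments chart {R m M} i : rename.
Arguments param {R m M} i : rename.

(* A tangent vector is encoded by the family of its coordinate vectors in all
   charts, with the value 0 in the charts that do not contain the base point. *)
Definition tangent (R : realType) (m : nat) (M : manifold R m) (p : M) :
    set (idx M -> 'cV[R]_m) :=
  [set v | (forall i, ~ dom i p -> v i = 0) /\
     forall i j, dom i p -> dom j p ->
       v j = 'D_(v i) (chart j \o param i) (chart i p)].

(* The tangent vector at p with coordinates v in the chart i. *)
Definition coord_vector (R : realType) (m : nat) (M : manifold R m)
    (i : idx M) (p : M) (v : 'cV[R]_m) : idx M -> 'cV[R]_m :=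
  fun j => if `[< dom j p >]
           then 'D_v (chart j \o param i) (chart i p) else 0.

Definition smooth_map (R : realType) (m : nat) (M : manifold R m)
    (V : normedModType R) (f : V -> M) :=
  continuous f /\ forall i, smooth (f @^-1` dom i) (chart i \o f).

Definition velocity (R : realType) (m : nat) (M : manifold R m) (c : R -> M)
    (t : R) : idx M -> 'cV[R]_m :=
  fun i => if `[< dom i (c t) >] then derive1 (chart i \o c) t else 0.

(* A function on TM x R is encoded as a function L of p, v and t whose values
   matter only when v is tangent at p. *)
Definition local_lagrangian (R : realType) (m : nat) (M : manifold R m)
    (L : M -> (idx M -> 'cV[R]_m) -> R -> R) (i : idx M)
    (z : 'cV[R]_m * 'cV[R]_m * R) : R :=
  L (param i z.1.1) (coord_vector i (param i z.1.1) z.1.2) z.2.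

(* Second derivative of L along the fibre T_p M, i.e. <L_vv(p,v,t) a, b>. *)
Definition fiber_hessian (R : realType) (m : nat) (M : manifold R m)
    (L : M -> (idx M -> 'cV[R]_m) -> R -> R) (p : M)
    (v : idx M -> 'cV[R]_m) (t : R) (a b : idx M -> 'cV[R]_m) : R :=
  derive1 (fun x : R => derive1 (fun y : R => L p (v + x *: a + y *: b) t) 0) 0.

Definition lagrangian_function (R : realType) (m : nat) (M : manifold R m) (tau : R)
    (L : M -> (idx M -> 'cV[R]_m) -> R -> R) :=
  [/\ forall i, smooth
        [set z : 'cV[R]_m * 'cV[R]_m * R | (chart i @` dom i) z.1.1]
        (local_lagrangian L i),
      forall p v t, tangent p v -> L p v (t + tau) = L p v t &
      forall p v t a, tangent p v -> tangent p a -> a <> 0 ->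
        0 < fiber_hessian L p v t a a].

Definition euler_lagrange (R : realType) (m : nat) (M : manifold R m)
    (L : M -> (idx M -> 'cV[R]_m) -> R -> R) (gamma : R -> M) :=
  forall (i : idx M) (t : R) (e : 'cV[R]_m), dom i (gamma t) ->
    let z s := (chart i (gamma s), velocity gamma s i, s) in
    is_derive t (1 : R)
      (fun s : R => 'D_(0, e, 0) (local_lagrangian L i) (z s))
      ('D_(e, 0, 0) (local_lagrangian L i) (z t)).

Definition periodic_trajectory (R : realType) (m : nat) (M : manifold R m)
    (tau : R) (L : M -> (idx M -> 'cV[R]_m) -> R -> R) (gamma : R -> M) :=
  [/\ smooth_map gamma, forall t, gamma (t + tau) = gamma t &
      euler_lagrange L gamma].

Definition action (R : realType) (m : nat) (M : manifold R m) (tau : R)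
    (L : M -> (idx M -> 'cV[R]_m) -> R -> R) (c : R -> M) : R :=
  \int[@lebesgue_measure R]_(t in `[0, tau]) L (c t) (velocity c t) t.

(* The scalar product on E_t, the tangent space of M at gamma t. *)
Definition metric (R : realType) (m : nat) (M : manifold R m)
    (L : M -> (idx M -> 'cV[R]_m) -> R -> R) (gamma : R -> M) (t : R)
    (v w : idx M -> 'cV[R]_m) : R :=
  fiber_hessian L (gamma t) (velocity gamma t) t v w.

Definition field_along (R : realType) (m : nat) (M : manifold R m)
    (gamma : R -> M) (xi : R -> idx M -> 'cV[R]_m) :=
  forall t, tangent (gamma t) (xi t).

Definition derivable_field (R : realType) (m : nat) (M : manifold R m)
    (gamma : R -> M) (xi : R -> idx M -> 'cV[R]_m) (t : R) :=
  forall i, dom i (gamma t) -> derivable (fun s : R => xi s i) t 1.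

(* Covariant differentiation of fields along gamma, tau-periodic in t: in each
   chart it is d/dt + Gam with a smooth matrix Gam, and it maps fields along
   gamma to fields along gamma. *)
Definition covariant_derivative (R : realType) (m : nat) (M : manifold R m)
    (tau : R) (gamma : R -> M)
    (D : (R -> idx M -> 'cV[R]_m) -> R -> idx M -> 'cV[R]_m) :=
  (exists Gam : R -> idx M -> 'M[R]_m,
    [/\ forall i, smooth (gamma @^-1` dom i) (fun t : R => Gam t i),
        forall t i, Gam (t + tau) i = Gam t i &
        forall xi t i, D xi t i =
          if `[< dom i (gamma t) >]
          then derive1 (fun s => xi s i) t + Gam t i *m xi t i else 0]) /\
  forall xi t, field_along gamma xi -> derivable_field gamma xi t ->
    tangent (gamma t) (D xi t).

Definition metric_compatible (R : realType) (m : nat) (M : manifold R m)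
    (gamma : R -> M)
    (g : R -> (idx M -> 'cV[R]_m) -> (idx M -> 'cV[R]_m) -> R)
    (D : (R -> idx M -> 'cV[R]_m) -> R -> idx M -> 'cV[R]_m) :=
  forall xi eta t,
    field_along gamma xi -> field_along gamma eta ->
    derivable_field gamma xi t -> derivable_field gamma eta t ->
    is_derive t (1 : R) (fun s : R => g s (xi s) (eta s))
      (g t (D xi t) (eta t) + g t (xi t) (D eta t)).

(* Smooth tau-periodic fields of g-symmetric operators on E_t. *)
Definition symmetric_operator (R : realType) (m : nat) (M : manifold R m)
    (tau : R) (gamma : R -> M)
    (g : R -> (idx M -> 'cV[R]_m) -> (idx M -> 'cV[R]_m) -> R)
    (U : R -> (idx M -> 'cV[R]_m) -> idx M -> 'cV[R]_m) :=
  [/\ exists u : R -> idx M -> 'M[R]_m,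
        [/\ forall i, smooth (gamma @^-1` dom i) (fun t : R => u t i),
            forall t i, u (t + tau) i = u t i &
            forall t v i, U t v i = u t i *m v i],
      forall t v, tangent (gamma t) v -> tangent (gamma t) (U t v) &
      forall t v w, tangent (gamma t) v -> tangent (gamma t) w ->
        g t (U t v) w = g t v (U t w)].

Definition hform (R : realType) (E : Type) (tau : R) (g : R -> E -> E -> R)
    (D : (R -> E) -> R -> E) (U : R -> E -> E) (xi eta : R -> E) : R :=
  \int[@lebesgue_measure R]_(t in `[0, tau])
    (g t (D xi t) (D eta t) + g t (U t (xi t)) (eta t)).

(* The form h represents the second variation of the action at gamma:
   it gives the second derivative of the action along every smooth family
   c(s, .) of tau-periodic curves with c(0, .) = gamma. *)
Definition second_variation (R : realType) (m : nat) (M : manifold R m)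
    (tau : R) (L : M -> (idx M -> 'cV[R]_m) -> R -> R) (gamma : R -> M)
    (h : (R -> idx M -> 'cV[R]_m) -> (R -> idx M -> 'cV[R]_m) -> R) :=
  forall c : R * R -> M,
    smooth_map c ->
    (forall t, c (0, t) = gamma t) ->
    (forall s t, c (s, t + tau) = c (s, t)) ->
    let xi t := velocity (fun s => c (s, t)) 0 in
    h xi xi = derive1n 2 (fun s : R => action tau L (fun t => c (s, t))) 0.

(* W^{1,2} functions on [a, b]: primitives of square-integrable functions. *)
Definition W12 (R : realType) (a b : R) (u : R -> R) :=
  exists f : R -> R,
    [/\ measurable_fun `[a, b] f,
        (@lebesgue_measure R).-integrable `[a, b] (fun t => (f t ^+ 2)%:E) &
        forall t, a <= t <= b ->
          u t = u a + \int[@lebesgue_measure R]_(s in `[a, t]) f s].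

Definition Xspace (R : realType) (m : nat) (M : manifold R m) (tau : R)
    (gamma : R -> M) : set (R -> idx M -> 'cV[R]_m) :=
  [set xi | [/\ field_along gamma xi, forall t, xi (t + tau) = xi t &
     forall (i : idx M) (a b : R), a <= b ->
       (forall t, a <= t <= b -> dom i (gamma t)) ->
       forall r : 'I_m, W12 a b (fun t => xi t i r 0)]].

Definition variational_solution (R : realType) (m : nat) (M : manifold R m)
    (gamma : R -> M) (D : (R -> idx M -> 'cV[R]_m) -> R -> idx M -> 'cV[R]_m)
    (U : R -> (idx M -> 'cV[R]_m) -> idx M -> 'cV[R]_m)
    (xi : R -> idx M -> 'cV[R]_m) :=
  [/\ field_along gamma xi, forall t, derivable_field gamma xi t,
      forall t, derivable_field gamma (D xi) t &
      forall t, D (D xi) t = U t (xi t)].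

Definition Wspace (R : realType) (m : nat) (M : manifold R m) (gamma : R -> M) :
    set ((idx M -> 'cV[R]_m) * (idx M -> 'cV[R]_m)) :=
  [set w | tangent (gamma 0) w.1 /\ tangent (gamma 0) w.2].

(* P is the map of W whose graph is the set of the pairs formed by the data at
   0 and at tau of a solution; E_tau = E_0 since gamma is tau-periodic. *)
Definition poincare_map (R : realType) (m : nat) (M : manifold R m) (tau : R)
    (gamma : R -> M) (D : (R -> idx M -> 'cV[R]_m) -> R -> idx M -> 'cV[R]_m)
    (U : R -> (idx M -> 'cV[R]_m) -> idx M -> 'cV[R]_m)
    (P : (idx M -> 'cV[R]_m) * (idx M -> 'cV[R]_m) ->
         (idx M -> 'cV[R]_m) * (idx M -> 'cV[R]_m)) :=
  forall w w', Wspace gamma w ->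
    P w = w' <->
    exists xi, [/\ variational_solution gamma D U xi,
                   (xi 0, D xi 0) = w & (xi tau, D xi tau) = w'].

(* V = Ker (P - I) and N = Ker (P - I)^2. *)
Definition Vspace (R : realType) (m : nat) (M : manifold R m) (gamma : R -> M)
    (P : (idx M -> 'cV[R]_m) * (idx M -> 'cV[R]_m) ->
         (idx M -> 'cV[R]_m) * (idx M -> 'cV[R]_m)) :=
  ker_on (Wspace gamma) (fun w => P w - w).

Definition Nspace (R : realType) (m : nat) (M : manifold R m) (gamma : R -> M)
    (P : (idx M -> 'cV[R]_m) * (idx M -> 'cV[R]_m) ->
         (idx M -> 'cV[R]_m) * (idx M -> 'cV[R]_m)) :=
  ker_on (Wspace gamma) ((fun w => P w - w) \o (fun w => P w - w)).

(* omega(w, v) = (zeta, D xi) - (xi, D zeta) for the solutions zeta, xi with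
   data w, v at t = 0; the right-hand side does not depend on t. *)
Definition omega (R : realType) (E : Type) (g : R -> E -> E -> R)
    (w v : E * E) : R :=
  g 0 w.1 v.2 - g 0 v.1 w.2.

Definition gram (R : realType) (E : Type) (k : nat) (g : R -> E -> E -> R)
    (zeta : 'I_k -> R -> E) (t : R) : 'M[R]_k :=
  \matrix_(a, b) g t (zeta a t) (zeta b t).

Definition gbar (R : realType) (E : Type) (k : nat) (tau : R)
    (g : R -> E -> E -> R) (zeta : 'I_k -> R -> E) : 'M[R]_k :=
  \matrix_(a, b)
    \int[@lebesgue_measure R]_(t in `[0, tau]) invmx (gram g zeta t) a b.

Definition Fspace (R : realType) (E : lmodType R) (k : nat)
    (zeta : 'I_k -> R -> E) (t : R) : set E :=
  lin_span (fun a => zeta a t).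

Definition Xperp (R : realType) (m k : nat) (M : manifold R m) (tau : R)
    (gamma : R -> M)
    (g : R -> (idx M -> 'cV[R]_m) -> (idx M -> 'cV[R]_m) -> R)
    (zeta : 'I_k -> R -> idx M -> 'cV[R]_m) : set (R -> idx M -> 'cV[R]_m) :=
  [set eta | Xspace tau gamma eta /\
     forall t, orth_compl (g t) (tangent (gamma t)) (Fspace zeta t) (eta t)].

Definition Dperp (R : realType) (m k : nat) (M : manifold R m)
    (gamma : R -> M)
    (g : R -> (idx M -> 'cV[R]_m) -> (idx M -> 'cV[R]_m) -> R)
    (D : (R -> idx M -> 'cV[R]_m) -> R -> idx M -> 'cV[R]_m)
    (zeta : 'I_k -> R -> idx M -> 'cV[R]_m)
    (xi : R -> idx M -> 'cV[R]_m) : R -> idx M -> 'cV[R]_m :=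
  fun t => orth_proj (g t) (tangent (gamma t)) (Fspace zeta t) (D xi t).

Definition hperp (R : realType) (m k : nat) (M : manifold R m) (tau : R)
    (gamma : R -> M)
    (g : R -> (idx M -> 'cV[R]_m) -> (idx M -> 'cV[R]_m) -> R)
    (D : (R -> idx M -> 'cV[R]_m) -> R -> idx M -> 'cV[R]_m)
    (U : R -> (idx M -> 'cV[R]_m) -> idx M -> 'cV[R]_m)
    (zeta : 'I_k -> R -> idx M -> 'cV[R]_m)
    (eta theta : R -> idx M -> 'cV[R]_m) : R :=
  let Dp := Dperp gamma g D zeta in
  \int[@lebesgue_measure R]_(t in `[0, tau])
    (g t (Dp eta t) (Dp theta t) + g t (U t (eta t)) (theta t)
     - 3 * \sum_a \sum_b invmx (gram g zeta t) a b *
         g t (eta t) (Dp (zeta a) t) * g t (theta t) (Dp (zeta b) t)).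

Definition Amx (R : realType) (k : nat) (s gb : 'M[R]_k) : 'M[R]_k :=
  s *m invmx gb *m s - s.

Definition Aperp (R : realType) (k : nat) (s gb : 'M[R]_k) : 'M[R]_k :=
  s - gb.

(* Main.v *)
(**
Let X' be the space of the W^{1,2} fields xi such that xi(t + tau) - xi(t) is a
constant combination of the zeta^a, and let h' be h minus boundary terms, which
vanish on X. If eta is the component of xi orthogonal to F_t and f_a are the
coordinates of xi - eta, then completing the square gives
  h'(xi, xi) = h^perp(eta, eta) + int |sum_a (f_a' + 2 e_a) zeta^a|^2,
where e_a are the coordinates of the F_t-component of D eta and depend only on
eta. Choosing f_a' = - 2 e_a, which makes f_a periodic up to a constant, lifts
X^perp to X' isometrically, so that ind h^perp = ind h'. The solutions with data
q_a have jumps s_ab zeta^b; they span an h'-orthogonal complement of X in X', on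
which h' has the matrix s. Hence s is symmetric and ind h^perp = ind h + ind s,
where ind h is finite by the Poincare inequality. Finally s is invertible since
Ker (P - I) meets the span of the q_a trivially, and s + A is congruent to
A^perp + gbar^-1, so that ind A^perp = ind s + ind A.
*)

Require Import Defs.
From HB Require Import structures.
From mathcomp Require Import all_boot all_order all_algebra.
From mathcomp Require Import all_classical all_reals all_analysis.
From mathcomp Require Import measurable_realfun ring lra.

Set Implicit Arguments.
Unset Strict Implicit.
Unset Printing Implicit Defensive.

Import Order.TTheory GRing.Theory Num.Theory.
Import numFieldNormedType.Exports.

Local Open Scope classical_set_scope.
Local Open Scope ring_scope.

(** * Negative index of symmetric bilinear forms *)

(** The coefficient 3 of [hperp] turns into 4 once D^perp is replaced by D, because |D eta|^2 =
    |D^perp eta|^2 + |e|^2, where e is the component of D eta along F_t. The 4 is what the square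
    leaves over: with z' = sum f_a' zeta^a, the terms |z'|^2 + 4 (z', e) equal |z' + 2 e|^2 - 4
    |e|^2. The remaining mixed terms are the derivative of (Z, xi + eta), where Z = sum f_a D
    zeta^a. This rests on V being isotropic: vanishing Wronskians make (D zeta^a, zeta^b) symmetric
    in a and b. The increment of (Z, xi + eta) over a period is zero on X but not on X', whence the
    boundary terms. The obstacle is regularity. Fields are only W^{1,2}, while [D] is a pointwise
    derivative with a meaning almost everywhere, so integrands are compared up to null sets and
    without measurability. Facts known in a chart are glued over [0, tau] by an induction on
    intervals. Indices are extended reals; each is first certified to be a natural number by a
    maximal negative family, so that the final subtraction is one of real numbers. *)

Definition subspace (R : realType) (E : lmodType R) (S : set E) :=
  S 0 /\ forall a x y, S x -> S y -> S (a *: x + y).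

(** The maps concerned (the metric in one argument, [D] at a time t, the coordinates along the
    periodic solutions) are total functions that behave linearly only on tangent vectors or on
    sufficiently regular fields. Hence linearity is relative to a subspace. *)
Definition linear_on (R : realType) (E F : lmodType R) (S : set E)
    (f : E -> F) :=
  forall a x y, S x -> S y -> f (a *: x + y) = a *: f x + f y.

Definition symbilinear_on (R : realType) (E : lmodType R) (S : set E)
    (b : E -> E -> R) :=
  (forall a x y z, S x -> S y -> S z -> b (a *: x + y) z = a * b x z + b y z) /\
  (forall x y, S x -> S y -> b x y = b y x).

Definition neg_family (R : realType) (E : lmodType R) (b : E -> E -> R) n
    (e : 'I_n -> E) :=
  forall c : 'I_n -> R, (exists i, c i != 0) ->
    b (\sum_i c i *: e i) (\sum_i c i *: e i) < 0.

(** A certificate for a finite index: the span of [e] gives the lower bound, and nonnegativity on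
    its [b]-orthogonal complement gives the upper bound. It makes sense for degenerate forms and in
    infinite dimension, and it adds up over orthogonal sums, which suprema do not show directly. *)
Definition maxneg (R : realType) (E : lmodType R) (S : set E)
    (b : E -> E -> R) n :=
  exists e : 'I_n -> E, [/\ forall i, S (e i), neg_family b e &
    forall x, S x -> (forall i, b x (e i) = 0) -> 0 <= b x x].

Section subspaces.
Context (R : realType) (E : lmodType R) (S : set E).
Hypothesis SS : subspace S.

Lemma subspace0 : S 0. Proof. by case: SS. Qed.

Lemma subspaceZ a x : S x -> S (a *: x).
Proof. by case: SS => S0 SD Sx; rewrite -[_ *: _]addr0; exact: SD. Qed.

Lemma subspaceD x y : S x -> S y -> S (x + y).
Proof. by case: SS => S0 SD Sx Sy; rewrite -[x]scale1r; exact: SD. Qed.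

Lemma subspaceN x : S x -> S (- x).
Proof. by move=> Sx; rewrite -scaleN1r; exact: subspaceZ. Qed.

Lemma subspaceB x y : S x -> S y -> S (x - y).
Proof. by move=> Sx Sy; apply: subspaceD => //; exact: subspaceN. Qed.

Lemma subspace_sum (I : finType) (e : I -> E) :
  (forall i, S (e i)) -> S (\sum_i e i).
Proof.
by move=> Se; elim/big_ind: _ => // [|x y]; [exact: subspace0|exact: subspaceD].
Qed.

Lemma subspace_comb (I : finType) (c : I -> R) (e : I -> E) :
  (forall i, S (e i)) -> S (\sum_i c i *: e i).
Proof. by move=> Se; apply: subspace_sum => i; exact: subspaceZ. Qed.

Section linear_on.
Context (F : lmodType R) (f : E -> F).
Hypothesis fL : linear_on S f.

Lemma linear_on0 : f 0 = 0.
Proof.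
have := fL 1 subspace0 subspace0.
by rewrite !scale1r addr0 => /eqP; rewrite addrC -subr_eq subrr => /eqP <-.
Qed.

Lemma linear_onD x y : S x -> S y -> f (x + y) = f x + f y.
Proof. by move=> Sx Sy; have := fL 1 Sx Sy; rewrite !scale1r. Qed.

Lemma linear_onZ a x : S x -> f (a *: x) = a *: f x.
Proof.
by move=> Sx; have := fL a Sx subspace0; rewrite linear_on0 !addr0.
Qed.

Lemma linear_on_sum (I : finType) (e : I -> E) :
  (forall i, S (e i)) -> f (\sum_i e i) = \sum_i f (e i).
Proof.
move=> Se; suff [] : S (\sum_i e i) /\ f (\sum_i e i) = \sum_i f (e i) by [].
elim/big_ind2: _ => [|x1 x2 y1 y2 [Sx <-] [Sy <-]|i _].
- by rewrite linear_on0; split=> //; exact: subspace0.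
- by rewrite linear_onD//; split=> //; exact: subspaceD.
- by split=> //; exact: Se.
Qed.

Lemma linear_on_comb (I : finType) (c : I -> R) (e : I -> E) :
  (forall i, S (e i)) -> f (\sum_i c i *: e i) = \sum_i c i *: f (e i).
Proof.
move=> Se; rewrite linear_on_sum => [|i]; last exact: subspaceZ.
by apply: eq_bigr => i _; rewrite linear_onZ.
Qed.

End linear_on.

Section bilinear.
Context (b : E -> E -> R).
Hypothesis bb : symbilinear_on S b.

Lemma symbilC x y : S x -> S y -> b x y = b y x.
Proof. by case: bb => _; apply. Qed.

Lemma symbil_linear z : S z -> linear_on S (b ^~ z : E -> R^o).
Proof. by case: bb => bl _ Sz a x y Sx Sy; exact: bl. Qed.

Lemma symbilDl x y z : S x -> S y -> S z -> b (x + y) z = b x z + b y z.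
Proof. by move=> Sx Sy Sz; exact: (linear_onD (symbil_linear Sz)). Qed.

Lemma symbilDr x y z : S x -> S y -> S z -> b z (x + y) = b z x + b z y.
Proof.
move=> Sx Sy Sz; rewrite (symbilC Sz (subspaceD Sx Sy)) symbilDl//.
by rewrite (symbilC Sx) ?(symbilC Sy).
Qed.

Lemma symbilZl a x z : S x -> S z -> b (a *: x) z = a * b x z.
Proof. by move=> Sx Sz; exact: (linear_onZ (symbil_linear Sz)). Qed.

Lemma symbilZr a x z : S x -> S z -> b z (a *: x) = a * b z x.
Proof.
move=> Sx Sz; rewrite (symbilC Sz (subspaceZ a Sx)) symbilZl//.
by rewrite (symbilC Sx).
Qed.

Lemma symbil0l z : S z -> b 0 z = 0.
Proof. by move=> Sz; exact: (linear_on0 (symbil_linear Sz)). Qed.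

Lemma symbil_suml (I : finType) (c : I -> R) (e : I -> E) z :
  (forall i, S (e i)) -> S z ->
  b (\sum_i c i *: e i) z = \sum_i c i * b (e i) z.
Proof. by move=> Se Sz; exact: (linear_on_comb (symbil_linear Sz)). Qed.

Lemma symbil_sumr (I : finType) (c : I -> R) (e : I -> E) z :
  (forall i, S (e i)) -> S z ->
  b z (\sum_i c i *: e i) = \sum_i c i * b z (e i).
Proof.
move=> Se Sz; rewrite (symbilC Sz (subspace_comb c Se)) symbil_suml//.
by apply: eq_bigr => i _; rewrite (symbilC Sz).
Qed.

Lemma symbil_quadD x y : S x -> S y ->
  b (x + y) (x + y) = b x x + 2 * b x y + b y y.
Proof.
move=> Sx Sy; have Sxy := subspaceD Sx Sy.
rewrite symbilDl// !symbilDr// (symbilC Sy Sx).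
by rewrite mulr_natl mulr2n !addrA.
Qed.

End bilinear.
End subspaces.

Lemma kernel_exists (F : fieldType) n n' (A : 'I_n' -> 'I_n -> F) :
  (n < n')%N -> exists c : 'I_n' -> F, (exists i, c i != 0) /\
    forall j, \sum_i c i * A i j = 0.
Proof.
move=> nn'; pose B : 'M[F]_(n', n) := \matrix_(i, j) A i j.
have /rowV0Pn[v /sub_kermxP vB v0] : kermx B != 0.
  by rewrite -mxrank_eq0 mxrank_ker -lt0n subn_gt0 (leq_ltn_trans (rank_leq_col _)).
exists (v 0); split.
  by have [i] := rV0Pn _ v0; exists i.
move=> j; have : (v *m B) 0 j = 0 by rewrite vB mxE.
by rewrite mxE => vBj; rewrite -[RHS]vBj; apply: eq_bigr => i _; rewrite mxE.
Qed.

Section index.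
Context (R : realType) (E : lmodType R) (S : set E) (b : E -> E -> R).
Hypothesis SS : subspace S.

Lemma neg_family_in_ind n (e : 'I_n -> E) : b 0 0 = 0 ->
  (forall i, S (e i)) -> neg_family b e -> ((n%:R)%:E <= ind S b)%E.
Proof.
move=> b0 Se ne; apply: ereal_sup_ubound; exists n => //.
exists (lin_span e); split=> [x [c ->]||x [c ->] cn0].
- exact: subspace_comb.
- exists e; split=> // c ce0 i; apply: contrapT => /eqP ci.
  by have := ne c; rewrite ce0 b0 ltxx => /(_ (ex_intro _ i ci)).
- apply: ne; apply: contrapT => /forallNP c0; apply: cn0.
  by apply: big1 => i _; have /negP := c0 i; rewrite negbK => /eqP ->; rewrite scale0r.
Qed.

Lemma ind_le (x : \bar R) :
  (forall n (e : 'I_n -> E), (forall i, S (e i)) -> neg_family b e ->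
    lin_indep e -> ((n%:R)%:E <= x)%E) -> (ind S b <= x)%E.
Proof.
move=> H; apply: ge_ereal_sup => _ [n [T [TS [e [ie spe]] neg]] <-].
have Te i : T (e i).
  rewrite -spe; exists (fun j => (j == i)%:R).
  rewrite (bigD1 i)//= eqxx scale1r big1 ?addr0// => j /negbTE ->.
  by rewrite scale0r.
apply: (H n e) => // [i|c [i ci]]; first exact/TS.
apply: neg; first by rewrite -spe; exists c.
by move=> /ie/(_ i) c0; rewrite c0 eqxx in ci.
Qed.

Hypothesis bb : symbilinear_on S b.

(** With more vectors than functionals, some nontrivial combination is killed by every [l ^~ j];
    there [b] would be both negative and nonnegative. *)
Lemma neg_family_card n n' (e : 'I_n' -> E) (l : E -> 'I_n -> R) :
  (forall j, linear_on S (l ^~ j : E -> R^o)) ->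
  (forall x, S x -> (forall j, l x j = 0) -> 0 <= b x x) ->
  (forall i, S (e i)) -> neg_family b e -> (n' <= n)%N.
Proof.
move=> ll lge0 Se ne; rewrite leqNgt; apply/negP => nn'.
have [c [c0 cl]] := kernel_exists (fun i j => l (e i) j) nn'.
have Sx := subspace_comb SS c Se.
have := ne c c0; apply/negP; rewrite -leNgt; apply: lge0 => // j.
by rewrite (linear_on_comb SS (ll j) c Se); exact: cl.
Qed.

(** The upper bound is [neg_family_card] with the functionals [b x (e i)]. *)
Lemma maxneg_ind n : maxneg S b n -> ind S b = (n%:R)%:E.
Proof.
case=> e [Se ne ge0]; apply/eqP; rewrite eq_le; apply/andP; split; last first.
  by apply: (neg_family_in_ind (e := e)) => //; apply: (symbil0l SS bb); exact: subspace0.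
apply: ind_le => n' e' Se' ne' _; rewrite lee_fin ler_nat.
apply: (neg_family_card (l := fun x i => b x (e i))) Se' ne' => // j.
exact: (symbil_linear bb).
Qed.

(** Nonnegativity on a subspace of finite codimension bounds the size of negative families. A family
    of largest size is maximal in the sense of [maxneg], since a negative vector orthogonal to it
    would enlarge it. *)
Lemma exists_maxneg N (l : E -> 'I_N -> R) :
  (forall j, linear_on S (l ^~ j : E -> R^o)) ->
  (forall x, S x -> (forall j, l x j = 0) -> 0 <= b x x) ->
  exists n, maxneg S b n.
Proof.
move=> ll lge0.
pose Q n := exists e : 'I_n -> E, (forall i, S (e i)) /\ neg_family b e.
have exQ : exists n, `[< Q n >].
  exists 0%N; apply/asboolP; exists (fun=> 0); split=> [[]//|c [[]]//].
have bndQ n : `[< Q n >] -> (n <= N)%N.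
  by move=> /asboolP[e [Se ne]]; exact: (neg_family_card ll lge0 Se ne).
case: (ex_maxnP exQ bndQ) => n /asboolP[e [Se ne]] maxn; exists n, e; split=> //.
move=> x Sx bx0; rewrite leNgt; apply/negP => xneg.
have : `[< Q n.+1 >]; last by move=> /maxn; rewrite ltnn.
(* The vector [x] is put in front of the family; being orthogonal to it, it contributes the separate
   term [c ord0 ^+ 2 * b x x]. *)
apply/asboolP; exists (fun i => oapp e x (unlift ord0 i)); split.
  by move=> i; case: unliftP => [j _|_] /=; [exact: Se|].
move=> c [i0 ci0]; rewrite big_ord_recl/= unlift_none/=.
under eq_bigr do rewrite liftK/=.
set y := \sum_(i < n) _.
have Sy : S y by exact: subspace_comb.
have Scx : S (c ord0 *: x) by exact: subspaceZ.
have -> : b (c ord0 *: x + y) (c ord0 *: x + y) = c ord0 ^+ 2 * b x x + b y y.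
  rewrite (symbil_quadD SS bb)// (symbilZl SS bb) ?(symbilZr SS bb)//.
  rewrite (symbilZl SS bb)// (symbil_sumr SS bb)// big1 => [|i _].
    by rewrite !mulr0 addr0 expr2 mulrA.
  by rewrite bx0 mulr0.
have [c0|c0] := eqVneq (c ord0) 0.
  rewrite c0 expr0n mul0r add0r; apply: ne.
  case: (unliftP ord0 i0) => [j ij|i00]; first by exists j; rewrite -ij.
  by rewrite i00 c0 eqxx in ci0.
have xx : c ord0 ^+ 2 * b x x < 0 by rewrite pmulr_rlt0// exprn_even_gt0.
apply: ltr_wnDr => //.
have [[i ci]|/forallNP cn] := pselect (exists i, c (lift ord0 i) != 0).
  by apply/ltW/ne; exists i.
have S0 := subspace0 SS.
rewrite /y big1 ?(symbil0l SS bb)// => i _.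
by have /negP := cn i; rewrite negbK => /eqP ->; rewrite scale0r.
Qed.

End index.

Lemma neg_family_le0 (R : realType) (E : lmodType R) (b : E -> E -> R) n
  (e : 'I_n -> E) c : b 0 0 = 0 -> neg_family b e ->
  b (\sum_i c i *: e i) (\sum_i c i *: e i) <= 0.
Proof.
move=> b0 ne; have [/ne/ltW//|/forallNP cn] := pselect (exists i, c i != 0).
by rewrite big1 ?b0// => i _; have /negP := cn i; rewrite negbK => /eqP ->; rewrite scale0r.
Qed.

(** The two families are concatenated. By orthogonality, [b] on a sum is the sum of its values on
    the two parts, and pairing with a vector of one family sees only the corresponding part. *)
Lemma maxneg_add (R : realType) (E : lmodType R) (S S1 S2 : set E)
  (b : E -> E -> R) n1 n2 :
  subspace S -> symbilinear_on S b ->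
  subspace S1 -> subspace S2 -> S1 `<=` S -> S2 `<=` S ->
  (forall x, S x -> exists x1 x2, [/\ S1 x1, S2 x2 & x = x1 + x2]) ->
  (forall x1 x2, S1 x1 -> S2 x2 -> b x1 x2 = 0) ->
  maxneg S1 b n1 -> maxneg S2 b n2 -> maxneg S b (n1 + n2).
Proof.
move=> SS bb SS1 SS2 S1S S2S dec orth [e1 [Se1 ne1 ge1]] [e2 [Se2 ne2 ge2]].
pose e (i : 'I_(n1 + n2)) := match fintype.split i with inl j => e1 j | inr j => e2 j end.
have el j : e (lshift n2 j) = e1 j by rewrite /e -[lshift _ _]/(unsplit (inl j)) unsplitK.
have er j : e (rshift n1 j) = e2 j by rewrite /e -[rshift _ _]/(unsplit (inr j)) unsplitK.
have b0 : b 0 0 = 0 by apply: (symbil0l SS bb); exact: subspace0.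
exists e; split.
- by move=> i; rewrite /e; case: (fintype.split i) => j; [exact/S1S|exact/S2S].
- move=> c [i ci]; rewrite big_split_ord/=.
  under eq_bigr do rewrite el.
  under [X in _ + X]eq_bigr do rewrite er.
  set y1 := \sum_(i < n1) _; set y2 := \sum_(i < n2) _.
  have Sy1 : S1 y1 by exact: (subspace_comb SS1).
  have Sy2 : S2 y2 by exact: (subspace_comb SS2).
  rewrite (symbil_quadD SS bb) ?(orth _ _ Sy1 Sy2)//; [|exact/S1S|exact/S2S].
  rewrite mulr0 addr0.
  have le1 : b y1 y1 <= 0 by exact: neg_family_le0.
  have le2 : b y2 y2 <= 0 by exact: neg_family_le0.
  case: (splitP i) => j ij.
  + have ii : i = lshift n2 j by exact/val_inj.
    by apply: ltr_wnDr => //; apply: ne1; exists j; rewrite -ii.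
  + have ii : i = rshift n1 j by exact/val_inj.
    by apply: ltr_wnDl => //; apply: ne2; exists j; rewrite -ii.
- move=> x /dec[x1 [x2 [Sx1 Sx2 ->]]] bx.
  have SX1 := S1S _ Sx1; have SX2 := S2S _ Sx2.
  rewrite (symbil_quadD SS bb)// (orth x1 x2)// mulr0 addr0 addr_ge0//.
  + apply: ge1 => // i; have := bx (lshift n2 i); rewrite el.
    have Si := S1S _ (Se1 i).
    by rewrite (symbilDl bb)// [b x2 _](symbilC bb)// (orth (e1 i) x2)// addr0.
  + apply: ge2 => // i; have := bx (rshift n1 i); rewrite er.
    have Si := S2S _ (Se2 i).
    by rewrite (symbilDl bb)// (orth x1)// add0r.
Qed.

(** A vector on which [b] is negative cannot be sent to 0, because [b' 0 0 = 0]. So [f] keeps the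
    size of negative families even when it has a kernel, as do the projections to which this is
    applied. *)
Lemma ind_mono (R : realType) (E F : lmodType R) (S : set E) (S' : set F)
  (b : E -> E -> R) (b' : F -> F -> R) (f : E -> F) :
  subspace S -> subspace S' -> linear_on S f -> (forall x, S x -> S' (f x)) ->
  b' 0 0 = 0 -> (forall x, S x -> b x x < 0 -> b' (f x) (f x) < 0) ->
  (ind S b <= ind S' b')%E.
Proof.
move=> SS SS' fL fS b0 bb'; apply: ind_le => // n e Se ne _.
apply: (@neg_family_in_ind _ _ _ _ SS' n (f \o e)) => // [i|c c0]; first exact/fS.
rewrite -(linear_on_comb SS fL)//; apply: bb'; first exact: (subspace_comb SS).
exact: ne.
Qed.

Lemma maxneg_image (R : realType) (E F : lmodType R) (S : set E) (S' : set F)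
  (b : E -> E -> R) (b' : F -> F -> R) (f : E -> F) n :
  subspace S -> linear_on S f -> (forall x, S x -> S' (f x)) ->
  (forall y, S' y -> exists2 x, S x & y = f x) ->
  (forall x y, S x -> S y -> b' (f x) (f y) = b x y) ->
  maxneg S b n -> maxneg S' b' n.
Proof.
move=> SS fL fS fsur fb [e [Se ne ge0]]; exists (f \o e); split.
- by move=> i; exact/fS.
- move=> c c0; rewrite -(linear_on_comb SS fL)// fb; [exact: ne| |];
    exact: (subspace_comb SS).
- move=> _ /fsur[x Sx ->] bx; rewrite fb//; apply: ge0 => // i.
  by rewrite -(bx i) fb.
Qed.

(** * Matrix forms and the relation between s, A and A^perp *)

Section mxform.
Context (R : realType) (k : nat).
Implicit Types (A B : 'M[R]_k) (x y : 'cV[R]_k).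

Definition mxform A x y : R := (x^T *m A *m y) 0 0.

Lemma mxformDl A x y z : mxform A (x + y) z = mxform A x z + mxform A y z.
Proof. by rewrite /mxform linearD/= !mulmxDl mxE. Qed.

Lemma mxformDr A x y z : mxform A z (x + y) = mxform A z x + mxform A z y.
Proof. by rewrite /mxform mulmxDr mxE. Qed.

Lemma mxformZl A a x y : mxform A (a *: x) y = a * mxform A x y.
Proof. by rewrite /mxform linearZ/= -!scalemxAl mxE. Qed.

Lemma mxformBm A B x y : mxform (A - B) x y = mxform A x y - mxform B x y.
Proof. by rewrite /mxform mulmxBr mulmxBl !mxE. Qed.

Lemma mxform0r A x : mxform A x 0 = 0.
Proof. by rewrite /mxform mulmx0 mxE. Qed.

Lemma mxform_delta A x y :
  mxform A x y = \sum_i \sum_j x i 0 * A i j * y j 0.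
Proof.
rewrite /mxform mxE exchange_big/=; apply: eq_bigr => j _.
by rewrite mxE mulr_suml; apply: eq_bigr => i _; rewrite mxE.
Qed.

Lemma mxformC A x y : A^T = A -> mxform A x y = mxform A y x.
Proof.
move=> sA; rewrite !mxform_delta exchange_big; apply: eq_bigr => i _ /=.
apply: eq_bigr => j _; rewrite -{1}sA mxE.
by rewrite mulrC mulrA mulrAC.
Qed.

Lemma mxform_symbilinear A : A^T = A -> symbilinear_on setT (mxform A).
Proof.
move=> sA; split=> [a x y z _ _ _|x y _ _]; last exact: mxformC.
by rewrite mxformDl mxformZl.
Qed.

Lemma subspaceT (E : lmodType R) : subspace [set: E].
Proof. by split. Qed.

Lemma mxform_maxneg A : A^T = A -> exists n, maxneg setT (mxform A) n.
Proof.
move=> sA; apply: (@exists_maxneg _ _ _ _ (@subspaceT _)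
    (mxform_symbilinear sA) k (fun x i => x i 0)).
  by move=> j a x y _ _; rewrite !mxE.
move=> x _ x0; rewrite (_ : x = 0) ?mxform0r//.
by apply/matrixP => i j; rewrite ord1 x0 mxE.
Qed.

(** One form on pairs of vectors is read in two ways. In the first it is the orthogonal sum of s and
    A, of index n + a. In the second it is A^perp in one variable plus a positive definite square,
    whose argument can be made zero through the other variable because s is invertible; its index is
    then that of A^perp. *)
Lemma ind_mx_Aperp (s g : 'M[R]_k) : s^T = s -> s \in unitmx -> g^T = g ->
  (forall x, x != 0 -> 0 < mxform g x x) ->
  exists n a, [/\ maxneg setT (mxform s) n, ind_mx (Amx s g) = a%:R%:E &
    ind_mx (Aperp s g) = ((n + a)%N)%:R%:E].
Proof.
move=> sT su gT gpos.
have gu : g \in unitmx.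
  rewrite -row_free_unit -kermx_eq0; apply/rowV0P => v /sub_kermxP vg.
  apply: contrapT => /eqP v0; have := gpos v^T.
  by rewrite trmx_eq0 v0 /mxform trmxK vg mul0mx mxE ltxx => /(_ isT).
have kT : (invmx g)^T = invmx g by rewrite trmx_inv gT.
have kge0 x : 0 <= mxform (invmx g) x x.
  have [->|x0] := eqVneq x 0; first by rewrite mxform0r.
  have := gpos (invmx g *m x).
  rewrite /mxform trmx_mul kT mulmxKV//.
  move=> H; rewrite -!mulmxA in H *; apply/ltW/H.
  apply: contra_neq x0 => gx; by rewrite -[x](mulKVmx gu) gx mulmx0.
have AT : (Amx s g)^T = Amx s g.
  by rewrite /Amx linearB/= !trmx_mul sT kT mulmxA.
have [n sn] := mxform_maxneg sT; have [a An] := mxform_maxneg AT.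
exists n, a; split=> //.
  exact: (maxneg_ind (@subspaceT _) (mxform_symbilinear AT)).
pose V : lmodType R := ('cV[R]_k * 'cV[R]_k)%type.
(* This is s + A in the coordinates [u.1 + u.2] and [u.2]. The shear is chosen so that the term - s
   in A cancels the square of [u.2] and only the mixed term of s remains, which [ME] absorbs into a
   square. *)
pose M (u v : V) := mxform s (u.1 + u.2) (v.1 + v.2) + mxform (Amx s g) u.2 v.2.
have Mb : symbilinear_on setT M.
  split=> [c u v w _ _ _|u v _ _]; last first.
    by rewrite /M mxformC// [X in _ + X]mxformC.
  rewrite /M /= addrACA -scalerDr !(mxformDl, mxformZl).
  ring.
(* The coordinate axes of the first reading: on [u.2 = 0] the form is s, on [u.1 = - u.2] it is
   A. *)
have Mna : maxneg setT M (n + a).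
  apply: (@maxneg_add _ _ setT [set u | u.2 = 0] [set u | u.1 = - u.2]) => //.
  - by split=> // c u v /= -> ->; rewrite scaler0 addr0.
  - by split=> [|c u v /= -> ->]; rewrite /= ?oppr0// opprD scalerN.
  - move=> u _; exists (u.1 + u.2, 0), (- u.2, u.2); split=> //.
    by rewrite [LHS]surjective_pairing; congr (_, _) => /=; rewrite ?addrK ?add0r.
  - move=> u v /= u0 v0; rewrite /M u0 v0 addNr mxform0r add0r.
    by rewrite mxformC// mxform0r.
  - apply: (@maxneg_image _ _ _ setT _ (mxform s) _ (fun x => (x, 0) : V)) sn => //.
    + by move=> c x y _ _; congr (_, _); rewrite /= scaler0 addr0.
    + by move=> [x y] /= ->; exists x.
    + by move=> x y _ _; rewrite /M /= !addr0 mxform0r addr0.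
  - apply: (@maxneg_image _ _ _ setT _ (mxform (Amx s g)) _ (fun x => (- x, x) : V)) An => //.
    + by move=> c x y _ _; congr (_, _); rewrite /= opprD scalerN.
    + by move=> [x y] /= ->; exists y.
    + by move=> x y _ _; rewrite /M /= !addNr mxform0r add0r.
have ME u : M u u = mxform (Aperp s g) u.1 u.1 +
    mxform (invmx g) (s *m u.2 + g *m u.1) (s *m u.2 + g *m u.1).
  have kg x y : mxform (invmx g) (g *m x) y = (x^T *m y) 0 0.
    by rewrite /mxform trmx_mul gT mulmxK.
  have kss x y : mxform (s *m invmx g *m s) x y = mxform (invmx g) (s *m x) (s *m y).
    by rewrite /mxform trmx_mul sT !mulmxA.
  rewrite /M /Amx /Aperp !mxformBm kss !(mxformDl, mxformDr).
  rewrite [mxform _ _ (g *m _)]mxformC// !kg !mulmxA -!/(mxform _ _ _).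
  rewrite [mxform s u.2 u.1]mxformC//.
  ring.
rewrite -(maxneg_ind (@subspaceT _) Mb Mna); apply/eqP; rewrite eq_le.
apply/andP; split.
(* The second component is the solution of s u2 + g u1 = 0, so that the square in [ME] vanishes. For
   the converse inequality the square is simply dropped. *)
- apply: (@ind_mono _ _ _ _ _ _ _ (fun x => (x, - (invmx s *m (g *m x))) : V)) => //.
  + move=> c x y _ _; congr (_, _) => /=.
    by rewrite !mulmxDr -!scalemxAr opprD scalerN.
  + by rewrite /M/= addr0 !mxform0r addr0.
  + move=> x _ xneg; rewrite ME/= mulmxN mulKVmx// addNr mxform0r addr0.
    exact: xneg.
- apply: (@ind_mono _ _ _ _ _ _ _ (fun u : V => u.1)) => //.
  + exact: mxform0r.
  + move=> u _; rewrite ME => Mu; apply: le_lt_trans Mu.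
    by rewrite lerDl.
Qed.

End mxform.

(** * Integrals and Sobolev functions on an interval *)

Section nonmeasurable_integral.
Context d (T : measurableType d) (R : realType).
Variable mu : {measure set T -> \bar R}.
Import HBNNSimple.

(* The integral of a nonnegative function is the supremum of the integrals of
   the simple functions below it: cutting these off on a null set shows that
   measurability is not needed. *)
Lemma ge0_ae_le_integral_nonmeas (D : set T) (f g : T -> \bar R) :
  (forall x, D x -> 0 <= f x)%E -> (forall x, D x -> 0 <= g x)%E ->
  {ae mu, forall x, D x -> (f x <= g x)%E} ->
  (\int[mu]_(x in D) f x <= \int[mu]_(x in D) g x)%E.
Proof.
move=> f0 g0 [N [mN N0 fgN]].
rewrite !ge0_integralE //= ge_ereal_sup// => _ [h/= hf] <-.
have mCN := measurableC mN.
apply: (@le_trans _ _ (sintegral mu (proj_nnsfun h mCN))); last first.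
  apply: ereal_sup_ubound; exists (proj_nnsfun h mCN) => //= x.
  rewrite /= mindicE; have [/[!inE] xN|xN] := boolP (x \in ~` N); last first.
    rewrite mulr0 patchE; case: ifPn => // xD; apply: g0; exact: set_mem.
  rewrite mulr1; apply: le_trans (hf x) _; rewrite !patchE; case: ifPn => // /set_mem xD.
  by apply: contrapT => fg; apply: xN; apply: fgN => /=; tauto.
rewrite -!integralT_nnsfun (ge0_negligible_integral mN)//; last first.
- by move=> x _; rewrite lee_fin.
- exact/measurable_EFinP.
rewrite [leRHS](ge0_negligible_integral mN)//; last first.
- by move=> x _; rewrite lee_fin.
- exact/measurable_EFinP.
rewrite le_eqVlt; apply/orP; left; apply/eqP; apply: eq_integral => x.
rewrite in_setD in_setT/= => xN; rewrite /= mindicE.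
by rewrite in_setC xN mulr1.
Qed.

(** Needed because [hform] and [hperp] integrate expressions in [D xi], a pointwise [derive1] that
    is under control only almost everywhere for a W^{1,2} field. *)
Lemma ae_eq_integral_nonmeas (D : set T) (f g : T -> \bar R) :
  {ae mu, forall x, D x -> f x = g x} ->
  (\int[mu]_(x in D) f x = \int[mu]_(x in D) g x)%E.
Proof.
move=> fg; rewrite integralE [RHS]integralE; congr (_ - _)%E;
  apply/eqP; rewrite eq_le; apply/andP; split;
  (apply: ge0_ae_le_integral_nonmeas => //;
   apply: filterS fg => x fg /fg; rewrite ?(funeposE,funenegE) => ->//).
Qed.

Lemma ae_eq_Rintegral_nonmeas (D : set T) (f g : T -> R) :
  {ae mu, forall x, D x -> f x = g x} ->
  \int[mu]_(x in D) f x = \int[mu]_(x in D) g x.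
Proof.
move=> fg; congr fine; apply: ae_eq_integral_nonmeas.
by apply: filterS fg => x fg /fg ->.
Qed.

End nonmeasurable_integral.

#[global] Instance lebesgue_ae_filter (R : realType) :
    Filter (nbhs (almost_everywhere (@lebesgue_measure R))) :=
  ae_filter_ringOfSetsType _.

Section interval_integral.
Context (R : realType).
Notation mu := (@lebesgue_measure R).
Implicit Types (a b c t : R) (u v w F : R -> R).

Definition aeon a b (P : R -> Prop) := {ae mu, forall t, a <= t <= b -> P t}.

Definition Int a b u : R := \int[mu]_(t in `[a, b]) u t.

Lemma IntE a b u : Int a b u = \int[mu]_(t in `[a, b]) u t. Proof. by []. Qed.

(** Integrability of a representative: the function itself need not be measurable, which suits
    integrands built from [derive1]. The same holds for [L2]. *)
Definition L1 a b u := exists F,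
  mu.-integrable `[a, b] (EFin \o F) /\ aeon a b (fun t => u t = F t).

Definition L2 a b u := exists F, [/\ measurable_fun `[a, b] F,
  mu.-integrable `[a, b] (fun t => (F t ^+ 2)%:E) &
  aeon a b (fun t => u t = F t)].

Definition cont_on a b u := {within `[a, b], continuous u}.

Lemma itvE a b t : (`[a, b]%classic t : Prop) = (a <= t <= b).
Proof. by rewrite /= in_itv. Qed.

Lemma aeonT a b (P : R -> Prop) : (forall t, a <= t <= b -> P t) -> aeon a b P.
Proof. by move=> H; apply: aeW. Qed.

Lemma aeonS a b (P Q : R -> Prop) : (forall t, a <= t <= b -> P t -> Q t) ->
  aeon a b P -> aeon a b Q.
Proof. by move=> PQ; rewrite /aeon; apply: filterS => t Pt abt; exact/PQ/Pt. Qed.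

Lemma aeonS2 a b (P Q S : R -> Prop) :
  (forall t, a <= t <= b -> P t -> Q t -> S t) ->
  aeon a b P -> aeon a b Q -> aeon a b S.
Proof.
by move=> PQ; rewrite /aeon; apply: filterS2 => t Pt Qt abt; apply: PQ => //; [exact: Pt|exact: Qt].
Qed.

Lemma aeon_forall a b (I : finType) (P : I -> R -> Prop) :
  (forall i, aeon a b (P i)) -> aeon a b (fun t => forall i, P i t).
Proof.
move=> H.
have : aeon a b (fun t => forall i, i \in enum I -> P i t).
  elim: (enum I) => [|i s IH]; first exact: aeonT.
  apply: aeonS2 (H i) IH => t _ Pi Ps j; rewrite inE => /orP[/eqP -> //|]; exact: Ps.
by apply: aeonS => t _ Pt i; apply: Pt; rewrite mem_enum.
Qed.

Lemma aeon_sub a b a' b' (P : R -> Prop) : a <= a' -> b' <= b ->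
  aeon a b P -> aeon a' b' P.
Proof.
move=> aa bb; rewrite /aeon; apply: filterS => t Pt /andP[at_ tb]; apply: Pt.
by rewrite (le_trans aa at_) (le_trans tb bb).
Qed.

Lemma aeon_cat a b c (P : R -> Prop) : aeon a b P -> aeon b c P -> aeon a c P.
Proof.
rewrite /aeon; apply: filterS2 => t P1 P2 /andP[at_ tc].
by have [tb|/ltW bt] := leP t b; [apply: P1; rewrite at_|apply: P2; rewrite bt].
Qed.

Lemma aeon_oo a b (P : R -> Prop) : aeon a b (fun t => a < t < b -> P t) -> aeon a b P.
Proof.
have nul x : {ae mu, forall t, t <> x}.
  exists [set x]; split=> //; first exact: lebesgue_measure_set1.
  by move=> t /= /contrapT.
rewrite /aeon => H; have := @filterI _ _ (ae_filter_ringOfSetsType mu) _ _ (nul a) (nul b).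
apply: filterS2 H => t Pt [/eqP ta /eqP tb] /andP[at_ tbt].
apply: Pt; first by rewrite at_.
by rewrite !lt_neqAle eq_sym ta tb at_ tbt.
Qed.

Lemma Int_ae a b u v : aeon a b (fun t => u t = v t) -> Int a b u = Int a b v.
Proof.
rewrite /aeon => uv; apply: ae_eq_Rintegral_nonmeas.
by apply: filterS uv => t uv; rewrite itvE.
Qed.

Lemma Int_eq a b u v : (forall t, a <= t <= b -> u t = v t) -> Int a b u = Int a b v.
Proof. by move=> uv; apply: Int_ae; exact: aeonT. Qed.

Lemma L1_ae a b u v : aeon a b (fun t => u t = v t) -> L1 a b u -> L1 a b v.
Proof.
move=> uv [F [iF uF]]; exists F; split=> //.
by apply: aeonS2 uv uF => t _ -> .
Qed.

Lemma L2_ae a b u v : aeon a b (fun t => u t = v t) -> L2 a b u -> L2 a b v.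
Proof.
move=> uv [F [mF iF uF]]; exists F; split=> //.
by apply: aeonS2 uv uF => t _ -> .
Qed.

Lemma L1D a b u v : L1 a b u -> L1 a b v -> L1 a b (fun t => u t + v t).
Proof.
move=> [F [iF uF]] [G [iG uG]]; exists (F \+ G); split.
  exact: (@integrableD _ _ _ mu _ _ _ _ iF iG).
by apply: aeonS2 uF uG => t _ -> ->.
Qed.

Lemma L1Z a b u k : L1 a b u -> L1 a b (fun t => k * u t).
Proof.
move=> [F [iF uF]]; exists (fun t => k * F t); split.
  exact: (@integrableZl _ _ _ mu _ _ k _ iF).
by apply: aeonS uF => t _ ->.
Qed.

Lemma L1N a b u : L1 a b u -> L1 a b (fun t => - u t).
Proof. by move=> /(L1Z (-1)); apply: L1_ae; apply: aeonT => t _; rewrite mulN1r. Qed.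

Lemma L1B a b u v : L1 a b u -> L1 a b v -> L1 a b (fun t => u t - v t).
Proof. by move=> uL vL; apply: L1D => //; exact: L1N. Qed.

Lemma L10 a b : L1 a b (fun=> 0).
Proof. by exists (fun=> 0); split; [exact: integrable0|exact: aeonT]. Qed.

Lemma L1_sum a b (I : Type) (r : seq I) (u : I -> R -> R) :
  (forall i, L1 a b (u i)) -> L1 a b (fun t => \sum_(i <- r) u i t).
Proof.
move=> H; elim: r => [|i r IH].
  by apply: L1_ae (L10 a b); apply: aeonT => t _; rewrite big_nil.
by apply: L1_ae (L1D (H i) IH); apply: aeonT => t _; rewrite big_cons.
Qed.

Lemma IntD a b u v : L1 a b u -> L1 a b v ->
  Int a b (fun t => u t + v t) = Int a b u + Int a b v.
Proof.
move=> [F [iF uF]] [G [iG vG]].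
rewrite (Int_ae uF) (Int_ae vG) -[RHS]RintegralD//; apply: Int_ae.
by apply: aeonS2 uF vG => t _ -> ->.
Qed.

Lemma IntZ a b u k : L1 a b u -> Int a b (fun t => k * u t) = k * Int a b u.
Proof.
move=> [F [iF uF]]; rewrite (Int_ae uF) -[RHS]RintegralZl//; apply: Int_ae.
by apply: aeonS uF => t _ ->.
Qed.

Lemma IntN a b u : L1 a b u -> Int a b (fun t => - u t) = - Int a b u.
Proof.
by move=> uL; rewrite -mulN1r -IntZ//; apply: Int_eq => t _; rewrite mulN1r.
Qed.

Lemma IntB a b u v : L1 a b u -> L1 a b v ->
  Int a b (fun t => u t - v t) = Int a b u - Int a b v.
Proof. by move=> uL vL; rewrite IntD ?IntN//; exact: L1N. Qed.

Lemma Int_ge0 a b u : aeon a b (fun t => 0 <= u t) -> 0 <= Int a b u.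
Proof.
move=> u0; rewrite (@Int_ae _ _ _ (fun t => Num.max 0 (u t))).
  by apply: Rintegral_ge0 => t _; rewrite le_max lexx.
by apply: aeonS u0 => t _ ut; rewrite (max_idPr ut).
Qed.

Lemma Int_le a b u v : L1 a b u -> L1 a b v ->
  aeon a b (fun t => u t <= v t) -> Int a b u <= Int a b v.
Proof.
move=> uL vL uv; rewrite -subr_ge0 -IntB//; apply: Int_ge0.
by apply: aeonS uv => t _; rewrite subr_ge0.
Qed.

Lemma subitv a b a' b' : a <= a' -> b' <= b -> `[a', b'] `<=` `[a, b].
Proof.
move=> aa bb t; rewrite !itvE => /andP[at_ tb].
by rewrite (le_trans aa at_) (le_trans tb bb).
Qed.

Lemma L1_sub a b a' b' u : a <= a' -> b' <= b -> L1 a b u -> L1 a' b' u.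
Proof.
move=> aa bb [F [iF uF]]; exists F; split; last exact: aeon_sub uF.
by apply: integrableS iF => //; exact: subitv.
Qed.

Lemma L2_sub a b a' b' u : a <= a' -> b' <= b -> L2 a b u -> L2 a' b' u.
Proof.
move=> aa bb [F [mF iF uF]]; exists F; split; last exact: aeon_sub uF.
- by apply: measurable_funS mF => //; exact: subitv.
- by apply: integrableS iF => //; exact: subitv.
Qed.

Lemma itv_catE a b c : a <= b -> b <= c ->
  `[a, c]%classic = `[a, b] `|` `]b, c]%classic :> set R.
Proof.
move=> ab bc; apply/seteqP; split=> t; rewrite /= !in_itv/=.
- by move=> /andP[at_ tc]; have [tb|bt] := leP t b; [left; rewrite at_|right; rewrite tc].
- move=> [/andP[at_ tb]|/andP[bt tc]]; first by rewrite at_ (le_trans tb).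
  by rewrite tc (le_trans ab)// ltW.
Qed.

Lemma Int_cat a b c u : a <= b -> b <= c -> L1 a c u ->
  Int a c u = Int a b u + Int b c u.
Proof.
move=> ab bc [F [iF uF]].
rewrite (Int_ae uF) (Int_ae (aeon_sub (lexx a) bc uF)).
rewrite (Int_ae (aeon_sub ab (lexx c) uF)).
have iFb : mu.-integrable `]b, c] (EFin \o F).
  apply: integrableS iF => // t /=; rewrite !in_itv/= => /andP[bt ->].
  by rewrite (le_trans ab (ltW bt)).
rewrite /Int (itv_catE ab bc) Rintegral_setU//=.
- by rewrite Rintegral_itv_obnd_cbnd.
- by rewrite -(itv_catE ab bc).
- apply/disj_setPS => t [/=]; rewrite !in_itv/= => /andP[_ tb] /andP[bt _].
  by have := le_lt_trans tb bt; rewrite ltxx.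
Qed.

Lemma integrable_setU A B F : measurable A -> measurable B -> A `&` B = set0 ->
  mu.-integrable A (EFin \o F) -> mu.-integrable B (EFin \o F) ->
  mu.-integrable (A `|` B) (EFin \o F).
Proof.
move=> mA mB AB iA iB.
apply/(integrable_mkcond _ (measurableU _ _ mA mB)).
have iA' := (integrable_mkcond _ mA).1 iA.
have iB' := (integrable_mkcond _ mB).1 iB.
apply: eq_integrable (integrableD measurableT iA' iB') => // t _.
rewrite /= !patchE in_setU; have [/set_mem tA|tA] := boolP (t \in A); last first.
  by rewrite add0e.
rewrite ifF ?adde0//; apply/negP => /set_mem tB.
by have : (A `&` B) t by []; rewrite AB.
Qed.

Lemma itv_disj a b c : `[a, b]%classic `&` `]b, c]%classic = set0 :> set R.
Proof.
apply/seteqP; split=> t //= [/=]; rewrite !in_itv/= => /andP[_ tb] /andP[bt _].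
by have := le_lt_trans tb bt; rewrite ltxx.
Qed.

Lemma L1_cat a b c u : a <= b -> b <= c -> L1 a b u -> L1 b c u -> L1 a c u.
Proof.
move=> ab bc [F [iF uF]] [G [iG uG]].
exists (fun t => if t <= b then F t else G t); split.
  rewrite (itv_catE ab bc); apply: integrable_setU => //; first exact: itv_disj.
  - apply: eq_integrable iF => // t; rewrite inE itvE => /andP[_ tb].
    by rewrite /= tb.
  - have iG' : mu.-integrable `]b, c] (EFin \o G).
      by apply: integrableS iG => // t; rewrite /= !in_itv/= => /andP[/ltW -> ->].
    apply: eq_integrable iG' => // t.
    by rewrite inE/= in_itv/= => /andP[bt _]; rewrite leNgt bt.
apply: (@aeon_cat _ b).
  by apply: aeonS uF => t /andP[_ tb]; rewrite tb.
apply: aeon_oo; apply: aeonS uG => t _ -> /andP[bt _].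
by rewrite leNgt bt.
Qed.

End interval_integral.

Section sobolev_interval.
Context (R : realType).
Notation mu := (@lebesgue_measure R).
Implicit Types (a b c t : R) (u v w F G : R -> R).

Lemma cont_on_cst a b k : cont_on a b (fun=> k).
Proof. by move=> x; exact: cvg_cst. Qed.

Lemma cont_onD a b u v : cont_on a b u -> cont_on a b v ->
  cont_on a b (fun t => u t + v t).
Proof. by move=> cu cv x; apply: cvgD; [exact: cu|exact: cv]. Qed.

Lemma cont_onM a b u v : cont_on a b u -> cont_on a b v ->
  cont_on a b (fun t => u t * v t).
Proof. by move=> cu cv x; apply: cvgM; [exact: cu|exact: cv]. Qed.

Lemma cont_on_sum a b (I : Type) (r : seq I) (u : I -> R -> R) :
  (forall i, cont_on a b (u i)) -> cont_on a b (fun t => \sum_(i <- r) u i t).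
Proof.
move=> H; elim: r => [|i r IH].
  by under eq_fun do rewrite big_nil; exact: cont_on_cst.
by under eq_fun do rewrite big_cons; exact: cont_onD.
Qed.

Lemma cont_on_sub a b a' b' u : a <= a' -> b' <= b ->
  cont_on a b u -> cont_on a' b' u.
Proof. by move=> aa bb; apply: continuous_subspaceW; exact: subitv. Qed.

Lemma cont_on_at a b u : (forall t, a <= t <= b -> {for t, continuous u}) ->
  cont_on a b u.
Proof.
move=> cu; apply: continuous_in_subspaceT => t.
by rewrite inE itvE => /cu.
Qed.

Lemma cont_on_eq a b u v : (forall t, a <= t <= b -> u t = v t) ->
  cont_on a b u -> cont_on a b v.
Proof.
move=> uv cu; apply: subspace_eq_continuous cu => t.
by rewrite inE itvE => /uv.
Qed.

Lemma cont_on_bounded a b u : a <= b -> cont_on a b u ->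
  exists2 K, 0 <= K & forall t, a <= t <= b -> `|u t| <= K.
Proof.
move=> ab cu.
have [c _ cmax] := EVT_max ab cu; have [d _ dmin] := EVT_min ab cu.
exists (`|u c| + `|u d|) => [|t tab]; first exact: addr_ge0.
have tI : t \in `[a, b]%R by rewrite in_itv.
have utc := cmax t tI; have utd := dmin t tI.
rewrite ler_norml; apply/andP; split.
  rewrite lerNl; apply: (@le_trans _ _ `|u d|); last by rewrite lerDr.
  by apply: (@le_trans _ _ (- u d)); rewrite ?lerN2// -normrN ler_norm.
by apply: (le_trans utc); apply: le_trans (ler_norm _) _; rewrite lerDl.
Qed.

Lemma cont_on_L1 a b u : cont_on a b u -> L1 a b u.
Proof.
move=> cu; exists u; split; last exact: aeonT.
by apply: continuous_compact_integrable => //; exact: segment_compact.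
Qed.

Lemma cont_on_L2 a b u : cont_on a b u -> L2 a b u.
Proof.
move=> cu; exists u; split; last exact: aeonT.
- exact: subspace_continuous_measurable_fun.
- apply: (@continuous_compact_integrable _ (fun t => u t ^+ 2)).
    exact: segment_compact.
  by have := cont_onM cu cu.
Qed.

Lemma L2M_L1 a b u v : L2 a b u -> L2 a b v -> L1 a b (fun t => u t * v t).
Proof.
move=> [F [mF iF uF]] [G [mG iG vG]]; exists (fun t => F t * G t); split; last first.
  by apply: aeonS2 uF vG => t _ -> ->.
have iFG : mu.-integrable `[a, b] (fun t => (F t ^+ 2)%:E + (G t ^+ 2)%:E)%E.
  exact: integrableD.
apply: (le_integrable _ _ _ iFG) => //.
  by apply/measurable_EFinP; exact: measurable_funM.
move=> t _ /=; rewrite lee_fin normrM [leRHS]ger0_norm; last first.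
  by rewrite addr_ge0 ?sqr_ge0.
rewrite -(real_normK (num_real (F t))) -(real_normK (num_real (G t))).
have := sqr_ge0 (`|F t| - `|G t|); have := normr_ge0 (F t); have := normr_ge0 (G t).
nra.
Qed.

Lemma L2_L1 a b u : L2 a b u -> L1 a b u.
Proof.
move=> uL; apply: L1_ae (L2M_L1 uL (cont_on_L2 (@cont_on_cst a b 1))).
by apply: aeonT => t _; rewrite mulr1.
Qed.

Lemma L2D a b u v : L2 a b u -> L2 a b v -> L2 a b (fun t => u t + v t).
Proof.
move=> uL vL; have [F [mF iF uF]] := uL; have [G [mG iG vG]] := vL.
exists (fun t => F t + G t); split; last first.
- by apply: aeonS2 uF vG => t _ -> ->.
- have iFG : mu.-integrable `[a, b] (fun t => 2%:E * ((F t ^+ 2)%:E + (G t ^+ 2)%:E))%E.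
    by apply: integrableZl => //; exact: integrableD.
  apply: (le_integrable _ _ _ iFG) => //.
    by apply/measurable_EFinP; apply: measurable_funX; exact: measurable_funD.
  move=> t _ /=; rewrite lee_fin ger0_norm ?sqr_ge0// [leRHS]ger0_norm; last first.
    by rewrite mulr_ge0 ?addr_ge0 ?sqr_ge0.
  by have := sqr_ge0 (F t - G t); nra.
- exact: measurable_funD.
Qed.

Lemma L2_contM a b u v : a <= b -> cont_on a b u -> L2 a b v ->
  L2 a b (fun t => u t * v t).
Proof.
move=> ab cu [G [mG iG vG]]; have [K K0 uK] := cont_on_bounded ab cu.
have mu' : measurable_fun `[a, b] u by exact: subspace_continuous_measurable_fun.
exists (fun t => u t * G t); split; last first.
- by apply: aeonS vG => t _ ->.
- have iKG : mu.-integrable `[a, b] (fun t => (K ^+ 2)%:E * (G t ^+ 2)%:E)%E.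
    exact: integrableZl.
  apply: (le_integrable _ _ _ iKG) => //.
    by apply/measurable_EFinP; apply: measurable_funX; exact: measurable_funM.
  move=> t /=; rewrite in_itv/= => /uK uKt.
  rewrite lee_fin (ger0_norm (sqr_ge0 _)) (ger0_norm (mulr_ge0 (sqr_ge0 _) (sqr_ge0 _))) exprMn ler_wpM2r ?sqr_ge0//.
  by rewrite -(real_normK (num_real (u t))) lerXn2r ?nnegrE.
- exact: measurable_funM.
Qed.

Lemma L2_cst0 a b : L2 a b (fun=> 0).
Proof. exact: (cont_on_L2 (@cont_on_cst a b 0)). Qed.

Lemma L2Z a b k u : a <= b -> L2 a b u -> L2 a b (fun t => k * u t).
Proof. by move=> ab; apply: L2_contM => //; exact: cont_on_cst. Qed.

Lemma L2_sum a b (I : Type) (r : seq I) (u : I -> R -> R) :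
  (forall i, L2 a b (u i)) -> L2 a b (fun t => \sum_(i <- r) u i t).
Proof.
move=> H; elim: r => [|i r IH].
  by apply: L2_ae (L2_cst0 a b); apply: aeonT => t _; rewrite big_nil.
by apply: L2_ae (L2D (H i) IH); apply: aeonT => t _; rewrite big_cons.
Qed.

Lemma L1_contM a b u v : a <= b -> cont_on a b u -> L1 a b v ->
  L1 a b (fun t => u t * v t).
Proof.
move=> ab cu [G [iG vG]]; have [K K0 uK] := cont_on_bounded ab cu.
have mu' : measurable_fun `[a, b] u by exact: subspace_continuous_measurable_fun.
have mG : measurable_fun `[a, b] G.
  by apply/measurable_EFinP; exact: (measurable_int mu iG).
exists (fun t => u t * G t); split; last by apply: aeonS vG => t _ ->.
have iKG : mu.-integrable `[a, b] (fun t => K%:E * (G t)%:E)%E.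
  exact: integrableZl.
apply: (le_integrable _ _ _ iKG) => //.
  by apply/measurable_EFinP; exact: measurable_funM.
move=> t /=; rewrite in_itv/= => /uK uKt.
by rewrite lee_fin !normrM ler_wpM2r// [leRHS]ger0_norm.
Qed.

(** [W12] with its weak derivative made explicit, and allowed to be any representative; the Leibniz
    rule and integration by parts need to name it. *)
Definition H1 a b u v :=
  L2 a b v /\ forall t, a <= t <= b -> u t = u a + Int a t v.

Lemma W12_H1 a b u : W12 a b u -> exists v, H1 a b u v.
Proof.
move=> [f [mf f2 uf]]; exists f; split=> //.
by exists f; split=> //; exact: aeonT.
Qed.

Lemma H1_W12 a b u v : H1 a b u v -> W12 a b u.
Proof.
move=> [[F [mF iF uF]] uv]; exists F; split=> // t tab.
rewrite (uv _ tab) (@Int_ae _ _ _ v F)//.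
by move: tab => /andP[_ tb]; exact: aeon_sub uF.
Qed.

Lemma H1_eq a b u u' v v' : a <= b -> (forall t, a <= t <= b -> u t = u' t) ->
  aeon a b (fun t => v t = v' t) -> H1 a b u v -> H1 a b u' v'.
Proof.
move=> ab uu vv [vL uv]; split; first exact: L2_ae vv vL.
move=> t tab; have /andP[at_ tb] := tab.
by rewrite -!uu ?lexx// (uv t)// (@Int_ae _ _ _ v v')//; exact: aeon_sub vv.
Qed.

Lemma Int_aa a u : Int a a u = 0.
Proof. by rewrite /Int set_itv1 Rintegral_set1. Qed.

Lemma H1_Int a b u v : H1 a b u v -> a <= b -> u b - u a = Int a b v.
Proof. by move=> [_ uv] ab; rewrite (uv b) ?ab ?lexx// addrC addKr. Qed.

Lemma H1_sub a b a' b' u v : a <= a' -> a' <= b' -> b' <= b ->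
  H1 a b u v -> H1 a' b' u v.
Proof.
move=> aa ab bb [vL uv]; split; first exact: L2_sub vL.
move=> t /andP[at_ tb].
rewrite (uv t) ?(le_trans aa) ?(le_trans tb)// (uv a') ?aa ?(le_trans ab)//.
rewrite -addrA -Int_cat//.
by apply: L1_sub (L2_L1 vL) => //; exact: le_trans tb bb.
Qed.

Lemma L2_cat a b c u : a <= b -> b <= c -> L2 a b u -> L2 b c u -> L2 a c u.
Proof.
move=> ab bc [F [mF iF uF]] [G [mG iG uG]].
pose H t := if t <= b then F t else G t.
have HF t : t <= b -> H t = F t by rewrite /H => ->.
have HG t : b < t -> H t = G t by rewrite /H leNgt => ->.
exists H; split.
- rewrite (itv_catE ab bc); apply/measurable_funU => //; split.
  + apply: eq_measurable_fun mF => t; rewrite inE itvE => /andP[_ tb].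
    by rewrite HF.
  + have mG' : measurable_fun `]b, c] G.
      by apply: measurable_funS mG => // t; rewrite /= !in_itv/= => /andP[/ltW -> ->].
    apply: eq_measurable_fun mG' => t.
    by rewrite inE/= in_itv/= => /andP[bt _]; rewrite HG.
- rewrite (itv_catE ab bc).
  apply: (@integrable_setU _ _ _ (fun t => H t ^+ 2)) => //; first exact: itv_disj.
  + apply: eq_integrable iF => // t; rewrite inE itvE => /andP[_ tb].
    by rewrite /= HF.
  + have iG' : mu.-integrable `]b, c] (fun t => (G t ^+ 2)%:E).
      by apply: integrableS iG => // t; rewrite /= !in_itv/= => /andP[/ltW -> ->].
    apply: eq_integrable iG' => // t.
    by rewrite inE/= in_itv/= => /andP[bt _]; rewrite HG.
- apply: (@aeon_cat _ _ b).
    by apply: aeonS uF => t /andP[_ tb]; rewrite HF.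
  by apply: aeon_oo; apply: aeonS uG => t _ -> /andP[bt _]; rewrite HG.
Qed.

Lemma H1_cat a b c u v : a <= b -> b <= c ->
  H1 a b u v -> H1 b c u v -> H1 a c u v.
Proof.
move=> ab bc [vL uv] [vL' uv']; have vac := L2_cat ab bc vL vL'; split=> //.
move=> t /andP[at_ tc]; have [tb|/ltW bt] := leP t b; first by rewrite uv ?at_.
rewrite uv' ?bt// (uv b) ?ab ?lexx// (@Int_cat _ a b t)// ?addrA//.
by apply: L1_sub (L2_L1 vac).
Qed.

Lemma H1D a b u v u' v' : H1 a b u v -> H1 a b u' v' ->
  H1 a b (fun t => u t + u' t) (fun t => v t + v' t).
Proof.
move=> [vL uv] [vL' uv']; split; first exact: L2D.
move=> t tab; have /andP[at_ tb] := tab.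
rewrite (uv t)// (uv' t)// IntD; first by rewrite addrACA.
- by apply: L1_sub (L2_L1 vL).
- by apply: L1_sub (L2_L1 vL').
Qed.

Lemma H1_cst a b k : H1 a b (fun=> k) (fun=> 0).
Proof.
split; first exact: L2_cst0.
move=> t _; rewrite (_ : Int a t _ = 0) ?addr0//.
by rewrite /Int /Rintegral integral0.
Qed.

Lemma H1Z a b k u v : a <= b -> H1 a b u v ->
  H1 a b (fun t => k * u t) (fun t => k * v t).
Proof.
move=> ab [vL uv]; split; first exact: L2Z.
move=> t tab; have /andP[at_ tb] := tab.
rewrite (uv t)// IntZ ?mulrDr//.
by apply: L1_sub (L2_L1 vL).
Qed.

Lemma H1_sum a b (I : Type) (r : seq I) (u v : I -> R -> R) : a <= b ->
  (forall i, H1 a b (u i) (v i)) ->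
  H1 a b (fun t => \sum_(i <- r) u i t) (fun t => \sum_(i <- r) v i t).
Proof.
move=> ab H; elim: r => [|i r IH].
  apply: H1_eq (H1_cst a b 0) => //; first by move=> t _; rewrite big_nil.
  by apply: aeonT => t _; rewrite big_nil.
apply: H1_eq (H1D (H i) IH) => //; first by move=> t _; rewrite big_cons.
by apply: aeonT => t _; rewrite big_cons.
Qed.

Lemma H1_cont a b u v : a <= b -> H1 a b u v -> cont_on a b u.
Proof.
move=> ab [/L2_L1[F [iF vF]] uv].
apply: (@cont_on_eq _ _ (fun t => u a + parameterized_integral mu a t F)).
  move=> t tab; rewrite (uv t)//; congr (_ + _); symmetry; apply: Int_ae.
  by have /andP[at_ tb] := tab; exact: aeon_sub vF.
apply: cont_onD; first exact: cont_on_cst.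
exact: parameterized_integral_continuous.
Qed.

(** Lebesgue's differentiation theorem. It is the bridge between the weak derivative and the
    [derive1] that occurs in [D]. *)
Lemma H1_derive a b u v : H1 a b u v ->
  aeon a b (fun t => derivable u t 1 /\ derive1 u t = v t).
Proof.
move=> [/L2_L1[F [iF vF]] uv].
(* Extension by 0, since the theorem is used for a function locally integrable on the whole line. *)
pose f := F \_ `[a, b].
have iT : mu.-integrable setT (EFin \o f).
  by rewrite /f -restrict_EFin; apply/(integrable_mkcond _ _).1.
have := @FTC1 R f (BLeft a).
have iy y : mu.-integrable `[a, y] (EFin \o f) by apply: integrableS iT.
have lf : locally_integrable setT f by exact: integrable_locally_restrict.
move=> /(_ iy lf) ftc.
apply: aeon_oo.
suff : aeon a b (fun t => a < t < b ->
    [/\ v t = F t, derivable (fun x => \int[mu]_(s in `[a, x]) f s) t 1 &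
     derive1 (fun x => \int[mu]_(s in `[a, x]) f s) t = f t]).
  apply: aeonS => t tab H atb; have [vt dG dGE] := H atb.
  have /andP[at_ tb] := atb.
  have fE : f t = F t.
    by rewrite /f patchE ifT// inE itvE tab.
  pose W := fun x => u a + \int[mu]_(s in `[a, x]) f s.
  have isW : is_derive t (1 : R) W (F t).
    rewrite -[F t]add0r -fE -dGE derive1E; apply: is_deriveD.
    exact: (DeriveDef dG).
  have dW : derivable W t 1 by case: isW.
  have W' : derive1 W t = F t by rewrite derive1E; case: isW.
  have near_uW : \forall x \near t, W x = u x.
    have : t \in `]a, b[%R by rewrite in_itv/= at_ tb.
    move=> /near_in_itvoo; apply: filterS => x; rewrite in_itv/= => /andP[ax xb].
    rewrite /W (uv x); last by rewrite (ltW ax) (ltW xb).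
    congr (_ + _); rewrite (@Int_ae _ _ _ v F); last first.
      by apply: aeon_sub vF => //; exact: ltW.
    apply: eq_Rintegral => s; rewrite inE itvE => /andP[as_ sx].
    by rewrite /f patchE ifT// inE itvE as_ (le_trans sx)// ltW.
  split; first exact: near_eq_derivable near_uW dW.
  by rewrite vt -W' !derive1E; symmetry; exact: near_eq_derive near_uW.
rewrite /aeon in vF *; apply: filterS2 vF ftc => t vF ftc tab atb.
have /andP[at_ tb] := atb.
have [|dG dGE] := ftc; first by rewrite lte_fin.
by split=> //; exact: vF.
Qed.

(** Induction on intervals: a property that adds up over adjacent intervals and holds on small ones
    around each point holds on [a, b]. It replaces the choice of a finite subdivision subordinate to
    the charts. *)
Lemma cousin (a b : R) (P : R -> R -> Prop) : a <= b ->
  (forall x y z, x <= y -> y <= z -> P x y -> P y z -> P x z) ->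
  (forall t, a <= t <= b -> exists2 e, 0 < e &
    forall x y, a <= x -> y <= b -> t - e < x -> x <= y -> y < t + e -> P x y) ->
  P a b.
Proof.
move=> ab Pcat Ploc.
pose S := [set c | a <= c <= b /\ P a c].
have Sa : S a.
  split; first by rewrite lexx.
  have [|e e0] := Ploc a; first by rewrite lexx.
  by apply=> //; rewrite ?ltrBlDr ?ltrDl.
have hS : has_sup S.
  by split; [exists a|exists b => c [/andP[]]].
set s := sup S.
have sab : a <= s <= b.
  rewrite (ub_le_sup hS.2 Sa)/=; apply: ge_sup; first by exists a.
  by move=> c [/andP[]].
have [e e0 He] := Ploc s sab.
have [c [/andP[ac cb] Pac] sc] := sup_adherent e0 hS.
have cs : c <= s by apply: (ub_le_sup hS.2); split=> //; rewrite ac.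
(* A point beyond the supremum [s] but still in the good neighbourhood of [s]. Joining [a, c] and
   [c, d] puts [d] in [S], so d <= s, which is possible only if d = b. *)
pose d := Num.min b (s + e / 2).
have /andP[as_ sb] := sab.
have sd : s <= d by rewrite le_min sb lerDl ltW// divr_gt0.
have cd : c <= d by exact: le_trans cs sd.
have db : d <= b by rewrite ge_min lexx.
have Pcd : P c d.
  apply: He => //; rewrite gt_min; apply/orP; right.
  by rewrite ltrD2l ltr_pdivrMr// ltr_pMr// ltrDl.
have Sd : S d.
  split; first by rewrite (le_trans ac cd) db.
  exact: Pcat ac cd Pac Pcd.
have ds : d <= s by exact: (ub_le_sup hS.2).
have : d = b.
  have : d = s by apply/eqP; rewrite eq_le ds sd.
  rewrite /d /Num.min; case: ifPn => // _ /eqP.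
  by rewrite -subr_eq0 addrAC subrr add0r mulf_eq0 invr_eq0 pnatr_eq0 orbF gt_eqF.
by move=> <-; case: Sd.
Qed.

End sobolev_interval.

(** * Product rule for absolutely continuous functions *)

Section product_rule.
Context (R : realType).
Notation mu := (@lebesgue_measure R).
Implicit Types (a b c t : R) (u v w F G : R -> R).

Lemma Int_fin a b F : mu.-integrable `[a, b] (EFin \o F) ->
  (\int[mu]_(x in `[a, b]) (F x)%:E)%E = (Int a b F)%:E.
Proof. by move=> iF; rewrite /Int /Rintegral fineK//; exact: integrable_fin_num. Qed.

Lemma Int_primitive_cont a b F : a <= b -> mu.-integrable `[a, b] (EFin \o F) ->
  cont_on a b (fun t => Int a t F).
Proof. by move=> ab iF; exact: parameterized_integral_continuous. Qed.

Lemma integrable_contM a b u F : a <= b -> cont_on a b u ->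
  mu.-integrable `[a, b] (EFin \o F) ->
  mu.-integrable `[a, b] (EFin \o (fun t => u t * F t)).
Proof.
move=> ab cu iF; have [K K0 uK] := cont_on_bounded ab cu.
have mu' : measurable_fun `[a, b] u by exact: subspace_continuous_measurable_fun.
have mF : measurable_fun `[a, b] F.
  by apply/measurable_EFinP; exact: (measurable_int mu iF).
have iKF : mu.-integrable `[a, b] (fun t => K%:E * (F t)%:E)%E.
  exact: integrableZl.
apply: (le_integrable _ _ _ iKF) => //.
  by apply/measurable_EFinP; exact: measurable_funM.
move=> t /=; rewrite in_itv/= => /uK uKt.
by rewrite lee_fin !normrM ler_wpM2r// [leRHS]ger0_norm.
Qed.

Section triangle.
Context (a b : R) (F G : R -> R).
Hypotheses (ab : a <= b) (iF : mu.-integrable `[a, b] (EFin \o F))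
  (iG : mu.-integrable `[a, b] (EFin \o G)).
Let f := F \_ `[a, b].
Let g := G \_ `[a, b].
Let T := g_sigma_algebraType (R.-ocitv.-measurable).
Let h (z : T * T) : R := if (z.2 : R) <= z.1 then f z.1 * g z.2 else 0.

Let iTf : mu.-integrable setT (EFin \o f).
Proof. by rewrite /f -restrict_EFin; apply/(integrable_mkcond _ _).1. Qed.

Let iTg : mu.-integrable setT (EFin \o g).
Proof. by rewrite /g -restrict_EFin; apply/(integrable_mkcond _ _).1. Qed.

Let mf : measurable_fun [set: T] (f : T -> R).
Proof. by apply/measurable_EFinP; exact: (measurable_int mu iTf). Qed.

Let mg : measurable_fun [set: T] (g : T -> R).
Proof. by apply/measurable_EFinP; exact: (measurable_int mu iTg). Qed.

Let mfg : measurable_fun [set: T * T] (fun z : T * T => f z.1 * g z.2).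
Proof.
apply: measurable_funM.
- exact: (measurableT_comp mf measurable_fst).
- exact: (measurableT_comp mg measurable_snd).
Qed.

Let mh : measurable_fun [set: T * T] h.
Proof.
apply: measurable_fun_ifT => //.
apply: measurable_fun_ler; first exact: measurable_snd.
exact: measurable_fst.
Qed.

Let ih : (mu \x mu)%E.-integrable [set: T * T] (EFin \o h).
Proof.
apply/integrable12ltyP; first exact/measurable_EFinP.
apply: (@le_lt_trans _ _ (\int[mu]_x (`|(f x)%:E| * \int[mu]_y `|(g y)%:E|))%E).
  apply: ge0_le_integral => //.
  - by move=> x _; exact: integral_ge0.
  - have mah : measurable_fun [set: T * T] (abse \o (EFin \o h)).
      by apply: measurableT_comp => //; exact/measurable_EFinP.
    exact: (@measurable_fun_fubini_tonelli_F _ _ T T R mu _ mah (fun=> abse_ge0 _)).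
  - apply: emeasurable_funM => //.
    by apply: measurableT_comp => //; exact/measurable_EFinP.
  - move=> x _; rewrite -ge0_integralZl//; last first.
      by apply: measurableT_comp => //; exact/measurable_EFinP.
    apply: ge0_le_integral => //.
    + apply: measurableT_comp => //; apply/measurable_EFinP.
      exact: (measurableT_comp mh (measurable_pair1 x)).
    + apply: emeasurable_funM => //.
      by apply: measurableT_comp => //; exact/measurable_EFinP.
    + move=> y _; rewrite /h/=; case: ifPn => _; first by rewrite normrM.
      by rewrite normr0 lee_fin mulr_ge0.
rewrite ge0_integralZr//; last 2 first.
- by apply: measurableT_comp => //; exact/measurable_EFinP.
- exact: integral_ge0.
apply: lte_mul_pinfty; first exact: integral_ge0.
  rewrite ge0_fin_numE; last exact: integral_ge0.
  by case/integrableP: iTf.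
by case/integrableP: iTg.
Qed.

(** Fubini for F(x) G(y) on the triangle y <= x of the square: integrating first in y gives the
    first summand, integrating first in x gives the integral of (Int a b F - Int a t F) G(t). *)
Lemma Int_triangle :
  Int a b (fun t => F t * Int a t G) + Int a b (fun t => Int a t F * G t) =
  Int a b F * Int a b G.
Proof.
have cF := Int_primitive_cont ab iF; have cG := Int_primitive_cont ab iG.
have fE t : a <= t <= b -> f t = F t.
  by move=> tab; rewrite /f patchE ifT// inE itvE.
have gE t : a <= t <= b -> g t = G t.
  by move=> tab; rewrite /g patchE ifT// inE itvE.
have f0 t : ~ (a <= t <= b) -> f t = 0.
  by move=> tab; rewrite /f patchE ifF//; apply/negP => /set_mem; rewrite itvE.
have g0 t : ~ (a <= t <= b) -> g t = 0.
  by move=> tab; rewrite /g patchE ifF//; apply/negP => /set_mem; rewrite itvE.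
have iFs x y : a <= x -> y <= b -> mu.-integrable `[x, y] (EFin \o F).
  by move=> ax yb; apply: integrableS iF => //; exact: subitv.
have iGs x y : a <= x -> y <= b -> mu.-integrable `[x, y] (EFin \o G).
  by move=> ax yb; apply: integrableS iG => //; exact: subitv.
have inner1 x : (\int[mu]_y (EFin \o h) (x, y))%E =
    ((EFin \o (fun t => F t * Int a t G)) \_ `[a, b]) x.
  rewrite patchE; case: ifPn => [/set_mem|/negP xab]; last first.
    apply: integral0_eq => y _; rewrite /h /=; case: ifPn => // _.
    by rewrite f0 ?mul0r// => tab; apply: xab; rewrite inE itvE.
  rewrite itvE => xab; have /andP[ax xb] := xab.
  rewrite /= EFinM -Int_fin ?iGs// -integralZl ?iGs//= [RHS]integral_mkcond.
  apply: eq_integral => y _; rewrite patchE /h /= fE//.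
  have [yab|yab] := pselect (a <= y <= b).
    rewrite gE//; case: ifPn => yx.
      by rewrite ifT// inE itvE yx andbT; case/andP: yab.
    by rewrite ifF//; apply/negP => /set_mem; rewrite itvE (negbTE yx) andbF.
  rewrite g0// mulr0 if_same ifF//; apply/negP => /set_mem.
  by rewrite itvE => /andP[ay yx]; apply: yab; rewrite ay (le_trans yx).
have inner2 y : (\int[mu]_x (EFin \o h) (x, y))%E =
    ((EFin \o (fun t => (Int a b F - Int a t F) * G t)) \_ `[a, b]) y.
  rewrite patchE; case: ifPn => [/set_mem|/negP yab]; last first.
    apply: integral0_eq => x _; rewrite /h /=; case: ifPn => // _.
    by rewrite g0 ?mulr0// => tab; apply: yab; rewrite inE itvE.
  rewrite itvE => yab; have /andP[ay yb] := yab.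
  have yF : Int a b F - Int a y F = Int y b F.
    rewrite (@Int_cat _ a y b)//; first by rewrite addrC addKr.
    by exists F; split=> //; exact: aeonT.
  rewrite /= yF [_ * G y]mulrC EFinM -Int_fin ?iFs// -integralZl ?iFs//= [RHS]integral_mkcond.
  apply: eq_integral => x _; rewrite patchE /h /= gE// [in RHS]muleC.
  have [xab|xab] := pselect (a <= x <= b).
    rewrite fE//; case: ifPn => yx.
      by rewrite ifT// inE itvE yx; case/andP: xab.
    by rewrite ifF//; apply/negP => /set_mem; rewrite itvE (negbTE yx).
  rewrite f0// mul0r if_same ifF//; apply/negP => /set_mem.
  by rewrite itvE => /andP[yx xb]; apply: xab; rewrite xb (le_trans ay).
have := Fubini ih.
under eq_integral do rewrite inner1.
under [in RHS]eq_integral do rewrite inner2.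
have iFG : mu.-integrable `[a, b] (EFin \o (fun t => F t * Int a t G)).
  rewrite (_ : (fun t => _) = (fun t => Int a t G * F t)).
    exact: integrable_contM.
  by apply/funext => t; rewrite mulrC.
have iGF : mu.-integrable `[a, b] (EFin \o (fun t => Int a t F * G t)).
  exact: integrable_contM.
have iGF' : mu.-integrable `[a, b] (EFin \o (fun t => (Int a b F - Int a t F) * G t)).
  apply: integrable_contM => //; apply: cont_onD; first exact: cont_on_cst.
  rewrite (_ : (fun t => _) = (fun t => -1 * Int a t F)).
    by apply: cont_onM => //; exact: cont_on_cst.
  by apply/funext => t; rewrite mulN1r.
rewrite -!integral_mkcond !Int_fin// => -[->].
rewrite -IntD; first last.
- by exists (fun t => Int a t F * G t); split=> //; exact: aeonT.
- by exists (fun t => (Int a b F - Int a t F) * G t); split=> //; exact: aeonT.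
rewrite -IntZ; last by exists G; split=> //; exact: aeonT.
by apply: Int_eq => t _; rewrite mulrBl subrK.
Qed.

End triangle.

(** Each factor is its initial value plus a primitive. The terms with an initial value are linear,
    and the product of the two primitives is [Int_triangle]. *)
Lemma H1M a b u v u' v' : a <= b -> H1 a b u v -> H1 a b u' v' ->
  H1 a b (fun t => u t * u' t) (fun t => v t * u' t + u t * v' t).
Proof.
move=> ab uv uv'; have cu := H1_cont ab uv; have cu' := H1_cont ab uv'.
have L2l : L2 a b (fun t => v t * u' t).
  rewrite (_ : (fun t => _) = (fun t => u' t * v t)).
    by apply: L2_contM => //; case: uv.
  by apply/funext => t; rewrite mulrC.
have L2r : L2 a b (fun t => u t * v' t).
  by apply: L2_contM => //; case: uv'.
split; first exact: L2D.
move=> x xab; have /andP[ax xb] := xab.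
have L2lx := L2_sub (lexx a) xb L2l; have L2rx := L2_sub (lexx a) xb L2r.
have [vL uE] := H1_sub (lexx a) ax xb uv; have [v'L u'E] := H1_sub (lexx a) ax xb uv'.
have [F [iF vF]] := L2_L1 vL; have [G [iG vG]] := L2_L1 v'L.
have uF t : a <= t <= x -> u t = u a + Int a t F.
  move=> /[dup] tax /andP[_ tx]; rewrite uE//; congr (_ + _); apply: Int_ae.
  exact: aeon_sub vF.
have u'G t : a <= t <= x -> u' t = u' a + Int a t G.
  move=> /[dup] tax /andP[_ tx]; rewrite u'E//; congr (_ + _); apply: Int_ae.
  exact: aeon_sub vG.
rewrite (uF x) ?ax ?lexx// (u'G x) ?ax ?lexx//.
have L1F : L1 a x F by exists F; split=> //; exact: aeonT.
have L1G : L1 a x G by exists G; split=> //; exact: aeonT.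
have cF := Int_primitive_cont ax iF; have cG := Int_primitive_cont ax iG.
have L1FG : L1 a x (fun t => F t * Int a t G).
  rewrite (_ : (fun t => _) = (fun t => Int a t G * F t)).
    exact: L1_contM.
  by apply/funext => t; rewrite mulrC.
have L1GF : L1 a x (fun t => Int a t F * G t) by exact: L1_contM.
rewrite (@Int_ae _ a x (fun t => v t * u' t + u t * v' t) (fun t => (u' a * F t + u a * G t) +
    (F t * Int a t G + Int a t F * G t))); last first.
  apply: aeonS2 vF vG => t tax vt v't /=.
  rewrite vt v't (uF t)// (u'G t)//; ring.
rewrite IntD; [|by apply: L1D; exact: L1Z|exact: L1D].
rewrite IntD ?IntZ//; [|exact: L1Z|exact: L1Z].
rewrite [Int a x (fun t => F t * _ + _)]IntD// Int_triangle//; ring.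
Qed.

Lemma is_derive_cont u (x du : R) : is_derive x (1 : R) u du -> {for x, continuous u}.
Proof.
by move=> uD; apply/differentiable_continuous/derivable1_diffP; case: uD.
Qed.

Lemma C1_H1 a b u du : (forall t, a <= t <= b -> is_derive t (1 : R) u (du t)) ->
  cont_on a b du -> H1 a b u du.
Proof.
move=> uD cdu; split; first exact: cont_on_L2.
move=> t /andP[]; rewrite le_eqVlt => /orP[/eqP <- _|at_ tb].
  by rewrite Int_aa addr0.
have cdut := cont_on_sub (lexx a) tb cdu.
have := @continuous_FTC2 R du u a t at_ cdut.
rewrite Int_fin; last first.
  by apply: continuous_compact_integrable => //; exact: segment_compact.
move=> H; suff : (Int a t du)%:E = ((u t)%:E - (u a)%:E)%E.
  by rewrite -EFinB => -[->]; rewrite addrC subrK.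
apply: H.
- split.
  + move=> s; rewrite in_itv/= => /andP[as_ st].
    have : a <= s <= b by rewrite (ltW as_) (le_trans (ltW st)).
    by move=> /uD[].
  + apply: cvg_at_right_filter; apply: is_derive_cont (uD a _).
    by rewrite lexx (le_trans (ltW at_)).
  + apply: cvg_at_left_filter; apply: is_derive_cont (uD t _).
    by rewrite (ltW at_).
- move=> s; rewrite in_itv/= => /andP[as_ st].
  have : a <= s <= b by rewrite (ltW as_) (le_trans (ltW st)).
  by rewrite derive1E => /uD[].
Qed.

End product_rule.

(** * Smooth maps and mixed derivatives *)

Section smooth.
Context (R : realType).
Implicit Types (V W : normedModType R).

Lemma smooth_differentiable V W (A : set V) (f : V -> W) x :
  smooth A f -> A x -> differentiable f x.
Proof. by move=> sf Ax; have [df _] := sf 1%N; exact: df. Qed.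

Lemma smooth_continuous V W (A : set V) (f : V -> W) x :
  smooth A f -> A x -> {for x, continuous f}.
Proof. by move=> sf Ax; have := sf 0%N x Ax. Qed.

Lemma smooth_derive V W (A : set V) (f : V -> W) v :
  smooth A f -> smooth A ('D_v f).
Proof. by move=> sf n; have [_] := sf n.+1; apply. Qed.

Lemma deriveDr V W (f : V -> W) x u v : differentiable f x ->
  'D_(u + v) f x = 'D_u f x + 'D_v f x.
Proof. by move=> df; rewrite !deriveE// linearD. Qed.

Lemma deriveZr V W (f : V -> W) x a v : differentiable f x ->
  'D_(a *: v) f x = a *: 'D_v f x.
Proof. by move=> df; rewrite !deriveE// linearZ. Qed.

Lemma derive_sumr V W (f : V -> W) x (I : Type) (r : seq I) (v : I -> V) :
  differentiable f x -> 'D_(\sum_(i <- r) v i) f x = \sum_(i <- r) 'D_(v i) f x.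
Proof.
move=> df; rewrite deriveE// linear_sum; apply: eq_bigr => i _.
by rewrite deriveE.
Qed.

Lemma derive_comp V W (X : normedModType R) (f : V -> W) (g : W -> X) x v :
  differentiable f x -> differentiable g (f x) ->
  'D_v (g \o f) x = 'D_('D_v f x) g (f x).
Proof.
move=> df dg; rewrite !deriveE//; last exact: differentiable_comp.
by rewrite diff_comp.
Qed.

Lemma is_derive_line V W (f : V -> W) (b u : V) (x : R) :
  differentiable f (b + x *: u) ->
  is_derive x (1 : R) (fun s : R => f (b + s *: u)) ('D_u f (b + x *: u)).
Proof.
move=> df.
have dl : is_diff x (fun s : R => b + s *: u) (fun s : R => s *: u).
  have -> : (fun s : R => b + s *: u) = cst b + *:%R^~ u by [].
  exact: (is_diff_eq (is_diffD (is_diff_cst b x) (is_diff_scalel x u)) (add0r _)).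
pose l : R -> V := fun s : R => b + s *: u.
have dlx : differentiable l x by case: dl.
have l' : 'D_1 l x = u.
  rewrite deriveE//; case: dl => _; rewrite -/l => ->.
  by rewrite scale1r.
have dc : differentiable (f \o l) x by exact: differentiable_comp.
have := @derivableP _ _ _ _ x 1 (diff_derivable dc).
by rewrite derive_comp// l'.
Qed.

(** The mean value theorem twice: for the difference in the direction [v] as a function along [u],
    then for 'D_u f along [v]. *)
Lemma schwarz_mean V (A : set V) (f : V -> R) (a u v : V) (h : R) : 0 < h ->
  smooth A f ->
  (forall x y, 0 <= x <= h -> 0 <= y <= h -> A (a + x *: u + y *: v)) ->
  exists x y, [/\ 0 <= x <= h, 0 <= y <= h &
   f (a + h *: u + h *: v) - f (a + h *: u) - f (a + h *: v) + f a =
   h ^+ 2 * 'D_v ('D_u f) (a + x *: u + y *: v)].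
Proof.
move=> h0 sf hA.
have h0h : 0 <= h <= h by rewrite ltW//=.
have h00 : 0 <= (0 : R) <= h by rewrite lexx ltW.
have A0 x : 0 <= x <= h -> A (a + x *: u).
  by move=> xh; have := hA _ _ xh h00; rewrite scale0r addr0.
pose phi x := f (a + h *: v + x *: u) - f (a + x *: u).
have dphi x : 0 <= x <= h -> is_derive x (1 : R) phi
    ('D_u f (a + h *: v + x *: u) - 'D_u f (a + x *: u)).
  move=> xh; apply: is_deriveB; apply: is_derive_line.
  - by apply: (smooth_differentiable sf); rewrite addrAC; exact: hA.
  - by apply: (smooth_differentiable sf); exact: A0.
have [x xh phiE] : exists2 x, x \in `[0, h]%R & phi h - phi 0 =
    ('D_u f (a + h *: v + x *: u) - 'D_u f (a + x *: u)) * (h - 0).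
  apply: MVT_segment; first exact: ltW.
    by move=> x; rewrite in_itv/= => /andP[x0 xh]; apply: dphi; rewrite !ltW.
  apply: derivable_within_continuous => x; rewrite in_itv/= => xh.
  by case: (dphi x xh).
rewrite in_itv/= in xh.
pose psi y := 'D_u f (a + x *: u + y *: v).
have dpsi y : 0 <= y <= h -> is_derive y (1 : R) psi
    ('D_v ('D_u f) (a + x *: u + y *: v)).
  move=> yh; apply: is_derive_line.
  by apply: (smooth_differentiable (smooth_derive u sf)); exact: hA.
have [y yh psiE] : exists2 y, y \in `[0, h]%R & psi h - psi 0 =
    'D_v ('D_u f) (a + x *: u + y *: v) * (h - 0).
  apply: MVT_segment; first exact: ltW.
    by move=> y; rewrite in_itv/= => /andP[y0 yh]; apply: dpsi; rewrite !ltW.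
  apply: derivable_within_continuous => y; rewrite in_itv/= => yh.
  by case: (dpsi y yh).
exists x, y; split=> //.
have E1 : 'D_u f (a + h *: v + x *: u) - 'D_u f (a + x *: u) =
    'D_v ('D_u f) (a + x *: u + y *: v) * h.
  by move: psiE; rewrite /psi !subr0 !scale0r !addr0 addrAC => ->.
move: phiE; rewrite E1 /phi !subr0 !scale0r !addr0 => phiE.
rewrite [a + h *: u + _]addrAC expr2 mulrC mulrA -phiE; ring.
Qed.

(** The two points differ in general: they are the mean value points of the two orders of
    differentiation, and only their distance to [a] is known. *)
Lemma continuous_eq_approx V (F G : V -> R) a :
  {for a, continuous F} -> {for a, continuous G} ->
  (forall d, 0 < d -> exists p q, [/\ ball a d p, ball a d q & F p = G q]) ->
  F a = G a.
Proof.
move=> cF cG H; apply/eqP; rewrite -subr_eq0 -normr_le0.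
apply/ler_addgt0Pl => e e0; rewrite addr0.
have e2 : 0 < e / 2 by rewrite divr_gt0.
have N2 : \forall x \near a, `|F a - F x| < e / 2.
  by move/cvgrPdist_lt : cF; apply.
have N3 : \forall x \near a, `|G a - G x| < e / 2.
  by move/cvgrPdist_lt : cG; apply.
have : \forall x \near a, `|F a - F x| < e / 2 /\ `|G a - G x| < e / 2.
  exact: filterI N2 N3.
move=> /nbhs_ballP[d /= d0 Hd].
have [p [q [bp bq Fp]]] := H d d0.
have [H2 _] := Hd p bp; have [_ H3] := Hd q bq.
rewrite -(subrKA (F p)); apply: (le_trans (ler_normD _ _)).
apply: (@le_trans _ _ (e / 2 + e / 2)); last by rewrite -splitr.
by apply: lerD; [exact: ltW|rewrite Fp distrC; exact: ltW].
Qed.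

(** The second difference of [schwarz_mean] is symmetric in [u] and [v]. It is the source of the
    symmetry of the metric. *)
Lemma schwarz V (A : set V) (f : V -> R) (a u v : V) :
  open A -> A a -> smooth A f -> 'D_u ('D_v f) a = 'D_v ('D_u f) a.
Proof.
move=> oA Aa sf; symmetry.
apply: (@continuous_eq_approx V ('D_v ('D_u f)) ('D_u ('D_v f)) a).
- exact: (smooth_continuous (smooth_derive v (smooth_derive u sf)) Aa).
- exact: (smooth_continuous (smooth_derive u (smooth_derive v sf)) Aa).
move=> e e0.
have : \forall x \near a, A x by exact: open_nbhs_nbhs.
move=> /nbhs_ballP[d' /= d'0 Hd].
pose d := Num.min e d'.
have d0 : 0 < d by rewrite lt_min e0.
(* With h = d / (2 K), the parallelogram with sides h u and h v stays in the ball of radius d. The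
   summand 1 keeps K positive when both directions vanish. *)
pose K := `|u| + `|v| + 1.
have K0 : 0 < K by rewrite ltr_wpDl// addr_ge0.
pose h := d / (2 * K).
have h0 : 0 < h by rewrite divr_gt0// mulr_gt0.
have inball x y u' v' : `|u'| + `|v'| = K - 1 ->
    0 <= x <= h -> 0 <= y <= h -> ball a d (a + x *: u' + y *: v').
  move=> uv /andP[x0 xh] /andP[y0 yh].
  rewrite -ball_normE /ball_/= -addrA opprD addrA subrr sub0r normrN.
  apply: (le_lt_trans (ler_normD _ _)); rewrite !normrZ !ger0_norm//.
  apply: (@le_lt_trans _ _ (h * (`|u'| + `|v'|))).
    by rewrite mulrDr lerD// ler_wpM2r.
  rewrite uv; apply: (@lt_le_trans _ _ (h * (2 * K))).
    by rewrite ltr_pM2l//; lra.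
  by rewrite /h divfK// mulf_neq0// lt0r_neq0.
have Kuv : `|u| + `|v| = K - 1 by rewrite /K addrK.
have Kvu : `|v| + `|u| = K - 1 by rewrite addrC.
have de x : ball a d x -> ball a e x.
  by apply: le_ball; rewrite ge_min lexx.
have dA x : ball a d x -> A x.
  by move=> bx; apply: Hd; apply: le_ball bx; rewrite ge_min lexx orbT.
have [x [y [xh yh E1]]] := @schwarz_mean V A f a u v h h0 sf (fun x y xh yh =>
  dA _ (inball x y u v Kuv xh yh)).
have [x' [y' [x'h y'h E2]]] := @schwarz_mean V A f a v u h h0 sf (fun x y xh yh =>
  dA _ (inball x y v u Kvu xh yh)).
exists (a + x *: u + y *: v), (a + x' *: v + y' *: u); split.
- exact/de/inball.
- exact/de/inball.
- apply: (mulfI (lt0r_neq0 (exprn_gt0 2 h0))).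
  apply: etrans (esym E1) _; apply: etrans _ E2.
  have -> : a + h *: v + h *: u = a + h *: u + h *: v by rewrite addrAC.
  by congr (_ + _); rewrite addrAC.
Qed.

End smooth.

(** * Tangent spaces and fields along the trajectory *)

Section tangent_space.
Context (R : realType) (m : nat) (M : manifold R m).
Implicit Types (i j k : idx M) (p : M) (v w : 'cV[R]_m).

Lemma transition_domain_open i j : open (chart i @` (dom i `&` dom j)).
Proof.
rewrite openE => _ [p [ip jp] <-]; rewrite /interior.
have ci : (chart i @` dom i) (chart i p) by exists p.
have N1 : \forall x \near chart i p, (chart i @` dom i) x.
  by apply: open_nbhs_nbhs; split=> //; exact: chart_open.
have N2 : \forall x \near chart i p, dom j (param i x).
  apply: (param_continuous ci); rewrite chartK//.
  by apply: open_nbhs_nbhs; split=> //; exact: dom_open.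
apply: filterS2 N1 N2 => _ [q iq <-]; rewrite chartK// => jq.
by exists q.
Qed.

Lemma transition_near i j p : dom i p -> dom j p ->
  \forall x \near chart i p, (chart i @` (dom i `&` dom j)) x.
Proof.
move=> ip jp; apply: open_nbhs_nbhs; split; first exact: transition_domain_open.
by exists p.
Qed.

Lemma transition_differentiable i j p : dom i p -> dom j p ->
  differentiable (chart j \o param i) (chart i p).
Proof.
by move=> ip jp; apply: (smooth_differentiable (transition_smooth i j)); exists p.
Qed.

Lemma transition_comp i j k p v : dom i p -> dom j p -> dom k p ->
  'D_('D_v (chart j \o param i) (chart i p)) (chart k \o param j) (chart j p) =
  'D_v (chart k \o param i) (chart i p).
Proof.
move=> ip jp kp.
have jE : chart j p = (chart j \o param i) (chart i p) by rewrite /= chartK.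
rewrite jE -derive_comp; last 2 first.
- exact: transition_differentiable.
- by rewrite -jE; exact: transition_differentiable.
apply: near_eq_derive; apply: filterS (transition_near ip jp) => _ [q [iq jq] <-] /=.
by rewrite (chartK iq) (chartK jq).
Qed.

Lemma transition_id i p v : dom i p -> 'D_v (chart i \o param i) (chart i p) = v.
Proof.
move=> ip; rewrite -[RHS](derive_id (chart i p)).
apply: near_eq_derive; apply: filterS (transition_near ip ip) => _ [q [iq _] <-] /=.
by rewrite (chartK iq).
Qed.

Lemma tangent_subspace p : subspace (tangent p).
Proof.
split=> [|a v w [v0 vE] [w0 wE]].
  by split=> // i j ip jp; rewrite derive0.
split=> [i ip|i j ip jp]; rewrite !fctE; first by rewrite v0// w0// scaler0 addr0.
have dij := transition_differentiable ip jp.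
by rewrite (vE i j)// (wE i j)// deriveDr// deriveZr.
Qed.

Lemma coord_vector_in i p w : dom i p -> coord_vector i p w i = w.
Proof. by move=> ip; rewrite /coord_vector asboolT// transition_id. Qed.

Lemma coord_vector_tangent i p w : dom i p -> tangent p (coord_vector i p w).
Proof.
move=> ip; split=> [j jp|j k jp kp]; rewrite /coord_vector; first by rewrite asboolF.
by rewrite (asboolT jp) (asboolT kp) (transition_comp _ ip jp kp).
Qed.

Lemma tangent_coord i p (v : idx M -> 'cV[R]_m) : dom i p -> tangent p v -> v = coord_vector i p (v i).
Proof.
move=> ip [v0 vE]; apply/funext => j; rewrite /coord_vector.
by case: asboolP => jp; [exact: vE|exact: v0].
Qed.

Lemma tangent_inj i p (v w : idx M -> 'cV[R]_m) : dom i p -> tangent p v -> tangent p w ->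
  v i = w i -> v = w.
Proof.
by move=> ip tv tw vw; rewrite (tangent_coord ip tv) vw -tangent_coord.
Qed.

Definition coord_frame i p (r : 'I_m) : idx M -> 'cV[R]_m :=
  coord_vector i p (delta_mx r 0).

Lemma coord_frame_tangent i p r : dom i p -> tangent p (coord_frame i p r).
Proof. exact: coord_vector_tangent. Qed.

Lemma tangent_frameE i p (v : idx M -> 'cV[R]_m) : dom i p -> tangent p v ->
  v = \sum_r v i r 0 *: coord_frame i p r.
Proof.
move=> ip tv; apply: (tangent_inj ip tv).
  by apply: (subspace_comb (tangent_subspace p)) => r; exact: coord_frame_tangent.
rewrite fct_sumE.
have -> : \sum_r (v i r 0 *: coord_frame i p r) i = \sum_r v i r 0 *: delta_mx r 0.
  by apply: eq_bigr => r _; rewrite -[delta_mx r 0](coord_vector_in _ ip).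
apply/matrixP => r s; rewrite (ord1 s) summxE (bigD1 r)//=.
rewrite !mxE !eqxx/= mulr1 big1 ?addr0// => r' r'r.
by rewrite !mxE eq_sym (negbTE r'r)/= mulr0.
Qed.

End tangent_space.

Lemma derive1_translate (R : realType) (V : normedModType R) (f : R -> V) (c t : R) :
  derive1 (fun s => f (s + c)) t = derive1 f (t + c).
Proof.
rewrite /derive1 (_ : (fun h => _) = (fun h => h^-1 *: (f (h + (t + c)) - f (t + c))))//.
by apply/funext => h; rewrite addrA.
Qed.

Section along.
Context (R : realType) (m : nat) (M : manifold R m) (tau : R)
  (L : M -> (idx M -> 'cV[R]_m) -> R -> R) (gamma : R -> M).
Hypotheses (LL : lagrangian_function tau L) (gP : periodic_trajectory tau L gamma).
Notation g := (metric L gamma).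
Notation T t := (tangent (gamma t)).

Lemma gamma_smooth : smooth_map gamma. Proof. by case: gP. Qed.

Lemma gamma_periodic t : gamma (t + tau) = gamma t. Proof. by case: gP. Qed.

Lemma gamma_dom_open (i : idx M) : open (gamma @^-1` dom i).
Proof. by apply: open_comp => [t _|]; [exact: gamma_smooth.1|exact: dom_open]. Qed.

Lemma gamma_dom_near (i : idx M) t : dom i (gamma t) ->
  \forall s \near t, dom i (gamma s).
Proof. by move=> it; apply: open_nbhs_nbhs; split=> //; exact: gamma_dom_open. Qed.

Lemma gamma_chart_diff (i : idx M) t : dom i (gamma t) ->
  differentiable (chart i \o gamma) t.
Proof. by move=> it; exact: (smooth_differentiable (gamma_smooth.2 i)). Qed.

Lemma velocity_tangent t : T t (velocity gamma t).
Proof.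
split=> [i it|i j it jt]; rewrite /velocity; first by rewrite asboolF.
rewrite (asboolT it) (asboolT jt) !derive1E.
have H := derive_comp (1 : R) (gamma_chart_diff it) (transition_differentiable it jt).
rewrite -H; apply: near_eq_derive; apply: filterS (gamma_dom_near it) => s si /=.
by rewrite chartK.
Qed.

Let z (i : idx M) (t : R) : 'cV[R]_m * 'cV[R]_m * R :=
  (chart i (gamma t), velocity gamma t i, t).

Let A (i : idx M) := [set z : 'cV[R]_m * 'cV[R]_m * R | (chart i @` dom i) z.1.1].

Let A_open i : open (A i).
Proof.
apply: (open_comp (f := fun z : 'cV[R]_m * 'cV[R]_m * R => z.1.1)); last exact: chart_open.
move=> x _; apply: (@continuous_comp _ _ _ fst fst); exact: cvg_fst.
Qed.

Let vert (a : 'cV[R]_m) : 'cV[R]_m * 'cV[R]_m * R := (0, a, 0).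

Let zA i t (x y : R) a b : dom i (gamma t) -> A i (z i t + x *: vert a + y *: vert b).
Proof. by move=> it; rewrite /A /= !scaler0 !addr0; exists (gamma t). Qed.

(** Turns the fibre Hessian into a second derivative, in two vertical directions, of a smooth
    function of the coordinates, where bilinearity of derivatives and [schwarz] apply. *)
Lemma metricE i t a b : dom i (gamma t) -> T t a -> T t b ->
  g t a b = 'D_(vert (a i)) ('D_(vert (b i)) (local_lagrangian L i)) (z i t).
Proof.
move=> it ta tb; have [sm _ _] := LL; have smi := sm i.
have ST := tangent_subspace (gamma t).
have LE x y : L (gamma t) (velocity gamma t + x *: a + y *: b) t =
    local_lagrangian L i (z i t + x *: vert (a i) + y *: vert (b i)).
  rewrite /local_lagrangian /= !scaler0 !addr0 chartK//; congr L.
  apply: (tangent_inj it); last by rewrite coord_vector_in.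
    have tv := velocity_tangent t.
    exact: (subspaceD ST (subspaceD ST tv (subspaceZ ST x ta)) (subspaceZ ST y tb)).
  exact: coord_vector_tangent.
have A0 x a' : A i (z i t + x *: vert a').
  by have := zA x 0 a' 0 it; rewrite scale0r addr0.
have inner x : derive1 (fun y : R => L (gamma t) (velocity gamma t + x *: a + y *: b) t) 0 =
    'D_(vert (b i)) (local_lagrangian L i) (z i t + x *: vert (a i)).
  under eq_fun do rewrite LE.
  rewrite derive1E.
  have := @is_derive_line R _ _ (local_lagrangian L i) (z i t + x *: vert (a i)) (vert (b i)) 0.
  rewrite scale0r addr0 => H; have [_ ->//] := H (smooth_differentiable smi (A0 _ _)).
rewrite /metric /fiber_hessian; under eq_fun do rewrite inner.
rewrite derive1E.
have := @is_derive_line R _ _ ('D_(vert (b i)) (local_lagrangian L i)) (z i t) (vert (a i)) 0.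
rewrite scale0r addr0 => H.
have Az : A i (z i t) by have := A0 0 0; rewrite scale0r addr0.
by have [_ ->//] := H (smooth_differentiable (smooth_derive _ smi) Az).
Qed.

Lemma metric_symbilinear t : symbilinear_on (T t) (g t).
Proof.
have [i it] := dom_cover (gamma t); have [sm _ _] := LL; have smi := sm i.
have ST := tangent_subspace (gamma t).
have Az : A i (z i t) by exists (gamma t).
split=> [c x y w tx ty tw|x y tx ty].
  have txy : T t (c *: x + y) by exact: (subspaceD ST (subspaceZ ST c tx) ty).
  rewrite (metricE it txy tw) (metricE it tx tw) (metricE it ty tw).
  have -> : vert ((c *: x + y) i) = c *: vert (x i) + vert (y i).
    by rewrite /vert; congr (_, _, _); rewrite /= ?scaler0 ?addr0.
  have dd := smooth_differentiable (smooth_derive (vert (w i)) smi) Az.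
  by rewrite deriveDr// deriveZr.
rewrite (metricE it tx ty) (metricE it ty tx).
exact: (schwarz (vert (x i)) (vert (y i)) (@A_open i) Az smi).
Qed.

Lemma metric_pos t v : T t v -> v <> 0 -> 0 < g t v v.
Proof.
by move=> tv v0; have [_ _ pos] := LL; exact: (pos _ _ _ _ (velocity_tangent t)).
Qed.

Lemma velocity_periodic t : velocity gamma (t + tau) = velocity gamma t.
Proof.
apply/funext => i; rewrite /velocity gamma_periodic; case: asboolP => // it.
rewrite -derive1_translate; congr (derive1 _ t).
by apply/funext => s /=; rewrite gamma_periodic.
Qed.

Lemma metric_periodic t v w : T t v -> T t w -> g (t + tau) v w = g t v w.
Proof.
move=> tv tw; rewrite /metric /fiber_hessian velocity_periodic gamma_periodic.
have ST := tangent_subspace (gamma t); have [_ per _] := LL.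
have E x y : L (gamma t) (velocity gamma t + x *: v + y *: w) (t + tau) =
    L (gamma t) (velocity gamma t + x *: v + y *: w) t.
  apply: per; have tvel := velocity_tangent t.
  exact: (subspaceD ST (subspaceD ST tvel (subspaceZ ST x tv)) (subspaceZ ST y tw)).
by under eq_fun do under eq_fun do rewrite E.
Qed.

End along.

Section is_derive_pointwise.
Context (R : realType).
Implicit Types (f g : R -> R) (x df dg : R).

Lemma is_derive_sum_fun (I : Type) (r : seq I) (h : I -> R -> R) (x : R) (dh : I -> R) :
  (forall i, is_derive x (1 : R) (h i) (dh i)) ->
  is_derive x (1 : R) (fun t => \sum_(i <- r) h i t) (\sum_(i <- r) dh i).
Proof.
move=> H; elim: r => [|i r IH].
  rewrite big_nil (_ : (fun t => _) = cst 0); first exact: is_derive_cst.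
  by apply/funext => t; rewrite big_nil.
rewrite big_cons (_ : (fun t => _) = h i + (fun t => \sum_(i <- r) h i t)).
  exact: is_deriveD.
by apply/funext => t; rewrite big_cons.
Qed.

Lemma is_deriveM_fun f g x df dg : is_derive x (1 : R) f df -> is_derive x (1 : R) g dg ->
  is_derive x (1 : R) (fun t => f t * g t) (df * g x + f x * dg).
Proof.
move=> fD gD; rewrite (_ : (fun t => _) = f * g)//.
apply: is_derive_eq (is_deriveM fD gD) _.
by rewrite addrC; congr (_ + _); rewrite /GRing.scale/= mulrC.
Qed.

Lemma is_deriveD_fun f g x df dg : is_derive x (1 : R) f df -> is_derive x (1 : R) g dg ->
  is_derive x (1 : R) (fun t => f t + g t) (df + dg).
Proof. exact: is_deriveD. Qed.

Lemma is_derive_unique f x df dg : is_derive x (1 : R) f df ->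
  is_derive x (1 : R) f dg -> df = dg.
Proof. by move=> [_ <-] [_ <-]. Qed.

Lemma derivable_is_derive1 f x : derivable f x 1 -> is_derive x (1 : R) f (derive1 f x).
Proof. by move=> fD; rewrite derive1E; exact: derivableP. Qed.

Lemma derive1_entry m n (A : R -> 'M[R]_(m, n)) (x : R) i j : derivable A x 1 ->
  is_derive x (1 : R) (fun t => A t i j) (derive1 A x i j).
Proof.
move=> dA; have := (derivable_mxP A x 1).1 dA i j => dAij.
by rewrite derive1E derive_mx// mxE; exact: derivableP.
Qed.

Lemma entry_continuous m n (A : R -> 'M[R]_(m, n)) (x : R) i j :
  {for x, continuous A} -> {for x, continuous (fun t => A t i j)}.
Proof.
move=> cA; apply: (@continuous_comp _ _ _ A (fun N : 'M[R]_(m, n) => N i j)) => //.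
exact: coord_continuous.
Qed.

Lemma continuousM_fun f g x : {for x, continuous f} -> {for x, continuous g} ->
  {for x, continuous (fun t => f t * g t)}.
Proof. by move=> cf cg; exact: continuousM. Qed.

Lemma continuousD_fun f g x : {for x, continuous f} -> {for x, continuous g} ->
  {for x, continuous (fun t => f t + g t)}.
Proof. by move=> cf cg; exact: continuousD. Qed.

Lemma continuous_sum_fun (I : Type) (r : seq I) (h : I -> R -> R) x :
  (forall i, {for x, continuous (h i)}) ->
  {for x, continuous (fun t => \sum_(i <- r) h i t)}.
Proof.
move=> H; elim: r => [|i r IH].
  rewrite (_ : (fun t => _) = cst 0); first exact: cvg_cst.
  by apply/funext => t; rewrite big_nil.
rewrite (_ : (fun t => _) = fun t => h i t + \sum_(i <- r) h i t).
  exact: continuousD_fun.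
by apply/funext => t; rewrite big_cons.
Qed.

Lemma derivable_continuous_at (V : normedModType R) (f : R -> V) (x : R) :
  derivable f x 1 -> {for x, continuous f}.
Proof. by move=> fD; apply/differentiable_continuous/derivable1_diffP. Qed.

Lemma derive1_lin (V : normedModType R) (f h : R -> V) (c t : R) :
  derivable f t 1 -> derivable h t 1 ->
  derivable (fun s => c *: f s + h s) t 1 /\
  derive1 (fun s => c *: f s + h s) t = c *: derive1 f t + derive1 h t.
Proof.
move=> df dh; have dcf : derivable (c *: f) t 1 by exact: derivableZ.
have E : (fun s => c *: f s + h s) = c *: f + h by [].
rewrite E !derive1E; split; first exact: (derivableD dcf dh).
by rewrite (deriveD dcf dh) (deriveZ c df).
Qed.

End is_derive_pointwise.

(** * Regularity of fields along the trajectory *)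

Section fields.
Context (R : realType) (m : nat) (M : manifold R m) (tau : R)
  (L : M -> (idx M -> 'cV[R]_m) -> R -> R) (gamma : R -> M)
  (D : (R -> idx M -> 'cV[R]_m) -> R -> idx M -> 'cV[R]_m)
  (U : R -> (idx M -> 'cV[R]_m) -> idx M -> 'cV[R]_m).
Hypotheses (LL : lagrangian_function tau L) (gP : periodic_trajectory tau L gamma)
  (Dcov : covariant_derivative tau gamma D)
  (Dmet : metric_compatible gamma (metric L gamma) D)
  (Usym : symmetric_operator tau gamma (metric L gamma) U).
Notation g := (metric L gamma).
Notation T t := (tangent (gamma t)).
Notation field := (R -> idx M -> 'cV[R]_m).
Implicit Types (xi eta phi : field) (i j : idx M) (t a b : R).

(** Near t, the coordinates in another chart are combinations of those in the chart [i], with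
    coefficients the derivatives of the transition map along gamma, which are derivable. *)
Lemma derivable_field_chart xi i t : field_along gamma xi -> dom i (gamma t) ->
  derivable (fun s => xi s i) t 1 -> derivable_field gamma xi t.
Proof.
move=> fx it dx j jt.
pose f r s := 'D_(delta_mx r 0) (chart j \o param i) (chart i (gamma s)).
have df r : derivable (f r) t 1.
  apply: diff_derivable.
  apply: (@differentiable_comp _ _ _ _ (chart i \o gamma)
    ('D_(delta_mx r 0) (chart j \o param i))); first exact: (gamma_chart_diff gP).
  apply: (smooth_differentiable (smooth_derive _ (transition_smooth i j))).
  by exists (gamma t).
have E : \forall s \near t, \sum_r xi s i r 0 *: f r s = xi s j.
  apply: filterS2 (gamma_dom_near gP it) (gamma_dom_near gP jt) => s si sj.
  have [_ /(_ i j si sj) ->] := fx s.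
  have vE : xi s i = \sum_r xi s i r 0 *: delta_mx r 0.
    apply/matrixP => q c; rewrite (ord1 c) summxE (bigD1 q)//=.
    rewrite !mxE !eqxx/= mulr1 big1 ?addr0// => r rq.
    by rewrite !mxE eq_sym (negbTE rq)/= mulr0.
  rewrite [in RHS]vE derive_sumr; last exact: transition_differentiable.
  by apply: eq_bigr => r _; rewrite deriveZr//; exact: transition_differentiable.
apply: near_eq_derivable E _; apply/derivable_mxP => q c.
have dE : is_derive t (1 : R)
    (fun s => \sum_r xi s i r 0 * f r s q c)
    (\sum_r (derive1 (fun s => xi s i) t r 0 * f r t q c +
             xi t i r 0 * derive1 (f r) t q c)).
  apply: is_derive_sum_fun => r; apply: is_deriveM_fun.
    exact: (@derive1_entry _ _ _ (fun s => xi s i) t r 0 dx).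
  exact: (@derive1_entry _ _ _ (f r) t q c (df r)).
have := dE; rewrite (_ : (fun s => _) = (fun x => (\sum_r xi x i r 0 *: f r x) q c)).
  by case.
by apply/funext => s; rewrite summxE; apply: eq_bigr => r _; rewrite mxE.
Qed.

(** Extended by 0 outside the chart, because [metric_compatible] and the tangency clause of
    [covariant_derivative] speak of fields along the whole trajectory. Derivability is asked only at
    one time, so the jump at the border of the chart does no harm. *)
Definition frame i (r : 'I_m) : field := fun s =>
  if `[< dom i (gamma s) >] then coord_frame i (gamma s) r else 0.

Lemma frame_along i r : field_along gamma (frame i r).
Proof.
move=> s; rewrite /frame; case: asboolP => si; first exact: coord_frame_tangent.
by have [] := tangent_subspace (gamma s).
Qed.

Lemma frame_in i r t : dom i (gamma t) -> frame i r t i = delta_mx r 0.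
Proof. by move=> it; rewrite /frame asboolT// /coord_frame coord_vector_in. Qed.

Lemma frameE i t (v : idx M -> 'cV[R]_m) : dom i (gamma t) -> T t v ->
  v = \sum_r v i r 0 *: frame i r t.
Proof.
move=> it tv; rewrite {1}(tangent_frameE it tv); apply: eq_bigr => r _.
by rewrite /frame asboolT.
Qed.

Lemma frame_near i r t : dom i (gamma t) ->
  \forall s \near t, delta_mx r 0 = frame i r s i.
Proof. by move=> it; apply: filterS (gamma_dom_near gP it) => s /frame_in ->. Qed.

Lemma frame_derivable i r t : dom i (gamma t) -> derivable_field gamma (frame i r) t.
Proof.
move=> it; apply: (derivable_field_chart (frame_along i r) it).
apply: near_eq_derivable (@frame_near i r t it) _; exact: derivable_cst.
Qed.

Definition christoffel := projT1 (cid Dcov.1).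

Lemma christoffelP : [/\ forall i, smooth (gamma @^-1` dom i) (christoffel ^~ i),
    forall t i, christoffel (t + tau) i = christoffel t i &
    forall xi t i, D xi t i =
      if `[< dom i (gamma t) >]
      then derive1 (fun s => xi s i) t + christoffel t i *m xi t i else 0].
Proof. exact: (projT2 (cid Dcov.1)). Qed.

Lemma D_tangent xi t : field_along gamma xi -> derivable_field gamma xi t -> T t (D xi t).
Proof. exact: Dcov.2. Qed.

Lemma D_in xi t i : dom i (gamma t) ->
  D xi t i = derive1 (fun s => xi s i) t + christoffel t i *m xi t i.
Proof. by move=> it; have [_ _ ->] := christoffelP; rewrite asboolT. Qed.

Lemma christoffel_cont i t p q : dom i (gamma t) ->
  {for t, continuous (fun s => christoffel s i p q)}.
Proof.
have [sG _ _] := christoffelP => it.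
apply: (@entry_continuous _ _ _ (christoffel ^~ i)).
exact: (smooth_continuous (sG i)).
Qed.

Lemma D_frame i r t : dom i (gamma t) ->
  D (frame i r) t = \sum_p christoffel t i p r *: frame i p t.
Proof.
move=> it; have tD := D_tangent (frame_along i r) (@frame_derivable i r t it).
rewrite (frameE it tD); apply: eq_bigr => p _; congr (_ *: _).
rewrite D_in// frame_in// derive1E -(near_eq_derive _ (@frame_near i r t it)).
rewrite derive_cst add0r mxE (bigD1 r)//= !mxE !eqxx/= mulr1 big1 ?addr0// => q qr.
by rewrite !mxE (negbTE qr)/= mulr0.
Qed.

Definition coef i t (p q : 'I_m) : R := g t (frame i p t) (frame i q t).

Lemma metric_frameE i t v w : dom i (gamma t) -> T t v -> T t w ->
  g t v w = \sum_p \sum_q v i p 0 * w i q 0 * coef i t p q.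
Proof.
move=> it tv tw; have ST := tangent_subspace (gamma t).
have gb := metric_symbilinear LL gP t.
have Tf r : T t (frame i r t) by exact: frame_along.
rewrite {1}(frameE it tv) (symbil_suml ST gb _ Tf tw).
apply: eq_bigr => p _; rewrite {1}(frameE it tw) (symbil_sumr ST gb _ Tf (Tf p)).
by rewrite mulr_sumr; apply: eq_bigr => q _; rewrite mulrA.
Qed.

(** Metric compatibility applied to the frame. It shows that the coefficients of the metric are
    continuously differentiable without differentiating the Lagrangian further. *)
Lemma coef_derive i p q t : dom i (gamma t) ->
  is_derive t (1 : R) (fun s => coef i s p q)
   (\sum_r christoffel t i r p * coef i t r q +
    \sum_r christoffel t i r q * coef i t p r).
Proof.
move=> it; have ST := tangent_subspace (gamma t).
have gb := metric_symbilinear LL gP t.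
have := Dmet (frame_along i p) (frame_along i q) (@frame_derivable i p t it) (@frame_derivable i q t it).
have Tf r : T t (frame i r t) by exact: frame_along.
rewrite (@D_frame i p t it) (@D_frame i q t it).
by rewrite (symbil_suml ST gb _ Tf (Tf q)) (symbil_sumr ST gb _ Tf (Tf p)).
Qed.

Lemma coef_cont i p q t : dom i (gamma t) -> {for t, continuous (fun s => coef i s p q)}.
Proof.
by move=> it; apply: derivable_continuous_at; have [] := @coef_derive i p q t it.
Qed.

Definition in_dom i a b := forall t, a <= t <= b -> dom i (gamma t).

Lemma coef_H1 i p q a b : in_dom i a b -> exists dG, H1 a b (fun s => coef i s p q) dG.
Proof.
move=> iab; eexists; apply: C1_H1 => [t /iab it|]; first exact: coef_derive.
apply: cont_on_at => t /iab it; apply: continuousD_fun;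
  apply: continuous_sum_fun => r; apply: continuousM_fun;
  by [exact: christoffel_cont|exact: coef_cont].
Qed.

Lemma chart_cousin a b (Q : R -> R -> Prop) : a <= b ->
  (forall x y z, x <= y -> y <= z -> Q x y -> Q y z -> Q x z) ->
  (forall i x y, a <= x -> x <= y -> y <= b -> in_dom i x y -> Q x y) -> Q a b.
Proof.
move=> ab Qcat Qloc; apply: cousin => // t _.
have [i it] := dom_cover (gamma t).
have /nbhs_ballP[e /= e0 He] := gamma_dom_near gP it.
exists e => // x y ax yb tx xy yt; apply: (Qloc i) => // s /andP[xs sy].
by apply: He; rewrite -ball_normE /ball_/= ltr_distlC; apply/andP; split;
  [exact: lt_le_trans xs|exact: le_lt_trans yt].
Qed.

(** [Xspace] without periodicity, since the argument also needs fields that close up only modulo the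
    [zeta a]. *)
Definition sobolev_field xi := field_along gamma xi /\
  forall i a b, a <= b -> in_dom i a b -> forall r : 'I_m, W12 a b (fun t => xi t i r 0).

(** By [H1_derive] the coordinates are derivable almost everywhere with the weak derivative as
    value; at such times the pointwise definition of [D] gives the expected expression. *)
Lemma sobolev_chart xi i a b : sobolev_field xi -> a <= b -> in_dom i a b ->
  exists v : 'I_m -> R -> R, [/\ forall r, H1 a b (fun t => xi t i r 0) (v r),
    aeon a b (derivable_field gamma xi) &
    aeon a b (fun t => forall r, D xi t i r 0 =
      v r t + \sum_p christoffel t i r p * xi t i p 0)].
Proof.
move=> [fx Wx] ab iab.
have Hr r : exists v, H1 a b (fun t => xi t i r 0) v by exact/W12_H1/Wx.
pose v r := projT1 (cid (Hr r)).
have Hv r : H1 a b (fun t => xi t i r 0) (v r) by exact: (projT2 (cid (Hr r))).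
have ae1 : aeon a b (fun t => forall r, derivable (fun t => xi t i r 0) t 1 /\
    derive1 (fun t => xi t i r 0) t = v r t).
  by apply: aeon_forall => r; exact: H1_derive.
have dmx t : (forall r, derivable (fun t => xi t i r 0) t 1 /\
    derive1 (fun t => xi t i r 0) t = v r t) -> derivable (fun t => xi t i) t 1.
  by move=> H; apply/derivable_mxP => r c; rewrite (ord1 c); have [] := H r.
exists v; split=> //.
  apply: aeonS ae1 => t tab H; apply: (derivable_field_chart fx (iab t tab)).
  exact: dmx.
apply: aeonS ae1 => t tab H r; rewrite D_in; last exact: iab.
rewrite !mxE; congr (_ + _); have [_ <-] := H r.
by have [_ <-] := @derive1_entry _ _ _ (fun s => xi s i) t r 0 (dmx _ H); rewrite derive1E.
Qed.

Lemma sobolev_ae_derivable xi a b : sobolev_field xi -> a <= b ->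
  aeon a b (derivable_field gamma xi).
Proof.
move=> Wx ab; apply: (@chart_cousin _ _ (fun x y => aeon x y (derivable_field gamma xi))) => //.
  by move=> x y z _ _; exact: aeon_cat.
by move=> i x y _ xy _ ixy; have [v []] := sobolev_chart Wx xy ixy.
Qed.

(** In one chart the pairing is a sum of products of Sobolev functions, so it has some weak
    derivative. Almost everywhere this is the classical derivative, which metric compatibility
    identifies; [chart_cousin] glues the charts. Every integration by parts below goes through this
    lemma. *)
Lemma metric_H1 xi phi a b : sobolev_field xi -> sobolev_field phi -> a <= b ->
  H1 a b (fun t => g t (xi t) (phi t))
         (fun t => g t (D xi t) (phi t) + g t (xi t) (D phi t)).
Proof.
move=> Wx Wp ab; apply: (@chart_cousin _ _ (fun x y => H1 x y _ _)) => //.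
  by move=> x y z; exact: H1_cat.
move=> i x y _ xy _ ixy.
have [v [Hv dx _]] := sobolev_chart Wx xy ixy.
have [w [Hw dp _]] := sobolev_chart Wp xy ixy.
have [u Hu] : exists u, H1 x y (fun t => g t (xi t) (phi t)) u.
  have Hpq p q : exists u, H1 x y (fun t => xi t i p 0 * phi t i q 0 * coef i t p q) u.
    have [dG HG] := coef_H1 p q ixy.
    by eexists; apply: H1M HG => //; exact: H1M.
  have := fun p => H1_sum (index_enum 'I_m) xy (fun q => projT2 (cid (Hpq p q))).
  move=> /(H1_sum (index_enum 'I_m) xy) H.
  eexists; apply: H1_eq H => //; last exact: aeonT.
  by move=> t txy; rewrite -metric_frameE//; [exact: ixy|exact: Wx.1|exact: Wp.1].
apply: H1_eq (Hu) => //.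
have dxp : aeon x y (fun t => derivable_field gamma xi t /\ derivable_field gamma phi t).
  by apply: aeonS2 dx dp.
apply: aeonS2 (H1_derive Hu) dxp => t txy [du <-] [dxt dpt].
by have [_ <-] := Dmet Wx.1 Wp.1 dxt dpt; rewrite derive1E.
Qed.

(** Tangency is asked only almost everywhere, so that [D xi] qualifies: where [xi] is not derivable
    its value is arbitrary. *)
Definition L2_field xi := forall i a b, a <= b -> in_dom i a b ->
  aeon a b (fun t => T t (xi t)) /\ forall r : 'I_m, L2 a b (fun t => xi t i r 0).

Lemma metric_L1 xi phi a b : L2_field xi -> L2_field phi -> a <= b ->
  L1 a b (fun t => g t (xi t) (phi t)).
Proof.
move=> Lx Lp ab; apply: (@chart_cousin _ _ (fun x y => L1 x y _)) => //.
  by move=> x y z; exact: L1_cat.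
move=> i x y _ xy _ ixy; have [tx Lxr] := Lx i x y xy ixy.
have [tp Lpr] := Lp i x y xy ixy.
apply: (@L1_ae _ _ _ (fun t => \sum_p \sum_q coef i t p q * (xi t i p 0 * phi t i q 0))).
  apply: aeonS2 tx tp => t txy tx tp; rewrite (metric_frameE (ixy t txy) tx tp).
  by apply: eq_bigr => p _; apply: eq_bigr => q _; rewrite mulrC.
apply: L1_sum => p; apply: L1_sum => q; apply: L1_contM => //; last exact: L2M_L1.
by apply: cont_on_at => t /ixy it; exact: coef_cont.
Qed.

Lemma sobolev_L2 xi : sobolev_field xi -> L2_field xi.
Proof.
move=> Wx i a b ab iab; split; first by apply: aeonT => t _; exact: Wx.1.
move=> r; have [v Hv] := W12_H1 (Wx.2 i a b ab iab r).
exact: (cont_on_L2 (H1_cont ab Hv)).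
Qed.

Lemma sobolev_D_L2 xi : sobolev_field xi -> L2_field (D xi).
Proof.
move=> Wx i a b ab iab; have [v [Hv dx DE]] := sobolev_chart Wx ab iab; split.
  by apply: aeonS dx => t _ dt; apply: D_tangent => //; exact: Wx.1.
move=> r; apply: (@L2_ae _ _ _ (fun t => v r t + \sum_p christoffel t i r p * xi t i p 0)).
  by apply: aeonS DE => t _ ->.
apply: L2D; first by case: (Hv r).
apply: L2_sum => p; apply: L2_contM => //.
  by apply: cont_on_at => t /iab it; exact: christoffel_cont.
exact: (cont_on_L2 (H1_cont ab (Hv p))).
Qed.

Definition potential := projT1 (cid (let: And3 e _ _ := Usym in e)).

Lemma potentialP : [/\ forall i, smooth (gamma @^-1` dom i) (potential ^~ i),
    forall t i, potential (t + tau) i = potential t i &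
    forall t v i, U t v i = potential t i *m v i].
Proof. exact: (projT2 (cid (let: And3 e _ _ := Usym in e))). Qed.

Lemma U_tangent t v : T t v -> T t (U t v).
Proof. by case: Usym => _ H _; exact: H. Qed.

Lemma U_sym t v w : T t v -> T t w -> g t (U t v) w = g t v (U t w).
Proof. by case: Usym => _ _ H; exact: H. Qed.

Lemma U_linear t : linear_on setT (U t).
Proof.
move=> c v w _ _; apply/funext => i; have [_ _ UE] := potentialP.
rewrite UE (_ : (c *: v + w) i = c *: v i + w i)//.
rewrite (_ : (c *: U t v + U t w) i = c *: U t v i + U t w i)// !UE.
by rewrite mulmxDr scalemxAr.
Qed.

Lemma potential_cont i t p q : dom i (gamma t) ->
  {for t, continuous (fun s => potential s i p q)}.
Proof.
have [sG _ _] := potentialP => it.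
apply: (@entry_continuous _ _ _ (potential ^~ i)).
exact: (smooth_continuous (sG i)).
Qed.

Lemma U_L2 xi : sobolev_field xi -> L2_field (fun t => U t (xi t)).
Proof.
move=> Wx i a b ab iab; have [tx xL] := sobolev_L2 Wx ab iab; split.
  by apply: aeonS tx => t _; exact: U_tangent.
move=> r; have [_ _ UE] := potentialP.
apply: (@L2_ae _ _ _ (fun t => \sum_p potential t i r p * xi t i p 0)).
  by apply: aeonT => t _; rewrite UE mxE.
apply: L2_sum => p; apply: L2_contM => //.
by apply: cont_on_at => t /iab it; exact: potential_cont.
Qed.

Lemma sobolev_subspace : subspace sobolev_field.
Proof.
split=> [|c xi phi [fx Wx] [fp Wp]].
  split=> [t|i a b ab iab r]; first by have [] := tangent_subspace (gamma t).
  apply: (@H1_W12 _ _ _ _ (fun=> 0)).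
  by apply: H1_eq (H1_cst a b 0) => //; [move=> t _; rewrite mxE|exact: aeonT].
split=> [t|i a b ab iab r]; first exact: (tangent_subspace (gamma t)).2.
have [v Hv] := W12_H1 (Wx i a b ab iab r); have [w Hw] := W12_H1 (Wp i a b ab iab r).
apply: (@H1_W12 _ _ _ _ (fun t => c * v t + w t)).
apply: H1_eq (H1D (H1Z c ab Hv) Hw) => //; last exact: aeonT.
by move=> t _; rewrite !mxE.
Qed.

Lemma D_linear c xi phi t : field_along gamma xi -> field_along gamma phi ->
  derivable_field gamma xi t -> derivable_field gamma phi t ->
  D (c *: xi + phi) t = c *: D xi t + D phi t.
Proof.
move=> fx fp dx dp; apply/funext => i; have [_ _ DE] := christoffelP.
rewrite (_ : (c *: D xi t + D phi t) i = c *: D xi t i + D phi t i)// !DE.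
case: asboolP => it; last by rewrite scaler0 addr0.
have dxi := dx i it; have dpi := dp i it.
rewrite (_ : (c *: xi + phi) t i = c *: xi t i + phi t i)// mulmxDr -scalemxAr scalerDr.
rewrite addrACA; congr (_ + _).
exact: (derive1_lin c dxi dpi).2.
Qed.

Lemma derivable_field_lin c xi phi t :
  derivable_field gamma xi t -> derivable_field gamma phi t ->
  derivable_field gamma (c *: xi + phi) t.
Proof.
move=> dx dp i it.
exact: (derive1_lin c (dx i it) (dp i it)).1.
Qed.

Definition sobolev_fun (f : R -> R) := forall a b, a <= b -> exists v, H1 a b f v.

Lemma sobolev_scale (f : R -> R) xi : sobolev_fun f -> sobolev_field xi ->
  sobolev_field (fun t => f t *: xi t).
Proof.
move=> Wf [fx Wx]; split=> [t|i a b ab iab r].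
  exact: (subspaceZ (tangent_subspace (gamma t)) _ (fx t)).
have [v Hv] := Wf a b ab; have [w Hw] := W12_H1 (Wx i a b ab iab r).
apply: H1_W12; apply: H1_eq (H1M ab Hv Hw) => //; last exact: aeonT.
by move=> t _; rewrite !mxE.
Qed.

Lemma D_scale (f : R -> R) xi t : field_along gamma xi ->
  derivable f t 1 -> derivable_field gamma xi t ->
  derivable_field gamma (fun t => f t *: xi t) t /\
  D (fun t => f t *: xi t) t = derive1 f t *: xi t + f t *: D xi t.
Proof.
move=> fx df dx; have [_ _ DE] := christoffelP.
have E i : dom i (gamma t) -> is_derive t (1 : R) (fun s => f s *: xi s i)
    (derive1 f t *: xi t i + f t *: derive1 (fun s => xi s i) t).
  move=> it; have H r c : is_derive t (1 : R) (fun s => (f s *: xi s i) r c)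
      (derive1 f t * xi t i r c + f t * derive1 (fun s => xi s i) t r c).
    rewrite (_ : (fun s => _) = (fun s => f s * xi s i r c)); last first.
      by apply/funext => s; rewrite mxE.
    apply: is_deriveM_fun; first exact: derivable_is_derive1.
    exact: (@derive1_entry _ _ _ (fun s => xi s i) t r c (dx i it)).
  have dfx : derivable (fun s => f s *: xi s i) t 1.
    by apply/derivable_mxP => r c; case: (H r c).
  apply: DeriveDef => //; rewrite derive_mx//; apply/matrixP => r c.
  by rewrite !mxE; case: (H r c).
split=> [i it|]; first by case: (E i it).
apply/funext => i.
rewrite (_ : (derive1 f t *: xi t + f t *: D xi t) i =
  derive1 f t *: xi t i + f t *: D xi t i)// !DE.
case: asboolP => it; last first.
  by have [->//] := fx t; rewrite !scaler0 addr0.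
rewrite (_ : (fun s => _) = (fun s => f s *: xi s i))//.
rewrite derive1E; case: (E i it) => _ ->.
by rewrite scalerDr scalemxAr addrA.
Qed.

Lemma C1_sobolev xi : field_along gamma xi -> (forall t, derivable_field gamma xi t) ->
  (forall i t r, dom i (gamma t) -> {for t, continuous (fun s => D xi s i r 0)}) ->
  sobolev_field xi.
Proof.
move=> fx dx cD; split=> // i a b ab iab r.
apply: (@H1_W12 _ _ _ _ (fun t => derive1 (fun s => xi s i) t r 0)).
apply: C1_H1 => [t tab|].
  exact: (@derive1_entry _ _ _ (fun s => xi s i) t r 0 (dx t i (iab t tab))).
apply: (@cont_on_eq _ _ _ (fun t => D xi t i r 0 +
    -1 * \sum_p christoffel t i r p * xi t i p 0)).
  move=> t /iab it; rewrite D_in// !mxE mulN1r addrK; by [].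
apply: cont_on_at => t /iab it; apply: continuousD_fun; first exact: cD.
apply: continuousM_fun; first exact: cvg_cst.
apply: continuous_sum_fun => p; apply: continuousM_fun; first exact: christoffel_cont.
apply: (@entry_continuous _ _ _ (fun s => xi s i)).
exact: derivable_continuous_at (dx t i it).
Qed.

Lemma solution_sobolev xi : variational_solution gamma D U xi ->
  sobolev_field xi /\ sobolev_field (D xi).
Proof.
move=> [fx dx dDx DDx]; have [_ _ UE] := potentialP.
have fDx : field_along gamma (D xi) by move=> t; exact: D_tangent.
split; apply: C1_sobolev => // i t r it.
  apply: (@entry_continuous _ _ _ (fun s => D xi s i)).
  exact: derivable_continuous_at (dDx t i it).
rewrite (_ : (fun s => _) = (fun s => \sum_p potential s i r p * xi s i p 0)); last first.
  by apply/funext => s; rewrite DDx UE mxE.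
apply: continuous_sum_fun => p; apply: continuousM_fun; first exact: potential_cont.
apply: (@entry_continuous _ _ _ (fun s => xi s i)).
exact: derivable_continuous_at (dx t i it).
Qed.

End fields.

(** * The Poincare inequality *)

Section quadratic_bounds.
Context (R : realType) (m : nat).
Implicit Types (v : 'I_m -> R) (B : 'I_m -> 'I_m -> R).

Definition qform B v : R := \sum_p \sum_q v p * v q * B p q.

Lemma qform_upper B K v : (forall p q, `|B p q| <= K) ->
  `|qform B v| <= K * m%:R * \sum_p v p ^+ 2.
Proof.
move=> BK; apply: (@le_trans _ _ (\sum_p \sum_q K * ((v p ^+ 2 + v q ^+ 2) / 2))).
  apply: (le_trans (ler_norm_sum _ _ _)); apply: ler_sum => p _.
  apply: (le_trans (ler_norm_sum _ _ _)); apply: ler_sum => q _.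
  rewrite normrM mulrC; apply: ler_pM => //.
  rewrite ler_norml; apply/andP; split.
    by have := sqr_ge0 (v p + v q); nra.
  by have := sqr_ge0 (v p - v q); nra.
have E1 : \sum_(p < m) \sum_(q < m) v p ^+ 2 = m%:R * \sum_p v p ^+ 2.
  rewrite mulr_sumr; apply: eq_bigr => p _.
  by rewrite sumr_const card_ord mulr_natl.
have E2 : \sum_(p < m) \sum_(q < m) v q ^+ 2 = m%:R * \sum_p v p ^+ 2.
  by rewrite exchange_big.
under eq_bigr do rewrite -mulr_sumr -mulr_suml big_split/=.
rewrite -mulr_sumr -mulr_suml big_split/= E1 E2.
by rewrite le_eqVlt; apply/orP; left; apply/eqP; field.
Qed.

Lemma sum_sqr_le v : (\sum_p v p) ^+ 2 <= m%:R * \sum_p v p ^+ 2.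
Proof.
have := @qform_upper (fun _ _ => 1) 1 v (fun _ _ => (eq_ind_r (fun x => x <= 1) (lexx 1) (normr1 R))).
rewrite mul1r; apply: le_trans; apply: le_trans (ler_norm _).
rewrite /qform expr2 mulr_suml le_eqVlt; apply/orP; left; apply/eqP.
by apply: eq_bigr => p _; rewrite mulr_sumr; apply: eq_bigr => q _; rewrite mulr1.
Qed.

Lemma continuous_sum_top (T : topologicalType) (I : Type) (r : seq I) (h : I -> T -> R) :
  (forall i, continuous (h i)) -> continuous (fun t => \sum_(i <- r) h i t).
Proof.
move=> H; elim: r => [|i r IH].
  rewrite (_ : (fun t => _) = cst 0); first exact: cst_continuous.
  by apply/funext => t; rewrite big_nil.
rewrite (_ : (fun t => _) = fun t => h i t + \sum_(i <- r) h i t).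
  by move=> x; apply: cvgD; [exact: H|exact: IH].
by apply/funext => t; rewrite big_cons.
Qed.

(** The constant is the minimum of the form on the Euclidean unit sphere; the general case follows
    by homogeneity. *)
Lemma posdef_lower B : (forall v, (exists p, v p != 0) -> 0 < qform B v) ->
  exists2 c, 0 < c & forall v, c * \sum_p v p ^+ 2 <= qform B v.
Proof.
move=> Bpos.
pose N (v : 'rV[R]_m) := \sum_p v ord0 p ^+ 2.
pose Q (v : 'rV[R]_m) := qform B (v ord0).
have cc p : continuous (fun v : 'rV[R]_m => v ord0 p : R) by exact: coord_continuous.
have cM (f h : 'rV[R]_m -> R) : continuous f -> continuous h ->
    continuous (fun x => f x * h x).
  by move=> cf ch x; exact: (continuousM (cf x) (ch x)).
have cN : continuous N.
  by apply: continuous_sum_top => p; exact: (cM _ _ (cc p) (cc p)).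
have cQ : continuous Q.
  apply: continuous_sum_top => p; apply: continuous_sum_top => q.
  by apply: (cM _ _ (cM _ _ (cc p) (cc q))); exact: cst_continuous.
pose S := [set v : 'rV[R]_m | N v = 1].
have N0 (v : 'rV[R]_m) : v != 0 -> 0 < N v.
  move=> /rV0Pn[p vp]; rewrite /N (bigD1 p)//= ltr_wpDr//.
    by apply: sumr_ge0 => q _; exact: sqr_ge0.
  by rewrite exprn_even_gt0.
have cS : compact S.
  apply: (@subclosed_compact _ _ [set v : 'rV[R]_m | forall i, `[-1, 1]%classic (v ord0 i)]).
  - apply: (@closed_comp _ _ N [set 1]); last exact: closed_eq.
    by move=> v _; exact: cN.
  - by apply: (@rV_compact R m (fun=> `[-1, 1]%classic)) => i; exact: segment_compact.
  - move=> v Nv p /=; rewrite in_itv/= -ler_norml -(@expr_le1 _ 2)//.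
    rewrite real_normK ?num_real// -Nv /N (bigD1 p)//= lerDl.
    by apply: sumr_ge0 => q _; exact: sqr_ge0.
have scale (v : 'I_m -> R) : (exists p, v p != 0) -> exists w a, [/\ S w, 0 < a,
    qform B v = a * Q w & \sum_p v p ^+ 2 = a].
  move=> [p vp]; pose v' : 'rV[R]_m := \row_p v p.
  have v'0 : v' != 0 by apply/rV0Pn; exists p; rewrite mxE.
  pose a := \sum_p v p ^+ 2.
  have Na : N v' = a by apply: eq_bigr => q _; rewrite mxE.
  have a0 : 0 < a by rewrite -Na; exact: N0.
  have sa : Num.sqrt a ^+ 2 = a by rewrite sqr_sqrtr ?ltW.
  have sa0 : Num.sqrt a != 0 by rewrite sqrtr_eq0 -ltNge.
  exists ((Num.sqrt a)^-1 *: v'), a; split=> //.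
  - have E x : N (x *: v') = x ^+ 2 * N v'.
      by rewrite /N mulr_sumr; apply: eq_bigr => q _; rewrite !mxE exprMn.
    by rewrite /S /= E Na exprVn sa mulVf// lt0r_neq0.
  - rewrite /Q /qform mulr_sumr; apply: eq_bigr => q _; rewrite mulr_sumr.
    apply: eq_bigr => r _; rewrite !mxE -{1}sa.
    by field.
(* The sphere is empty when m = 0; then every vector is zero and any constant will do. *)
have [S0|S0] := pselect (S !=set0); last first.
  exists 1 => // v; have [vn|/forallNP vz] := pselect (exists p, v p != 0).
    by have [w [a [Sw _ _ _]]] := scale v vn; case: S0; exists w.
  have v0 p : v p = 0 by have /negP := vz p; rewrite negbK => /eqP.
  rewrite big1 => [|p _]; last by rewrite v0 expr0n.
  rewrite mulr0 /qform big1// => p _; rewrite big1// => q _.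
  by rewrite v0 !mul0r.
have [c /set_mem Sc cmin] := EVT_min_rV S0 cS (continuous_subspaceT cQ).
exists (Q c).
  apply: Bpos; apply: contrapT => /forallNP cz.
  have c0 : c = 0.
    by apply/rowP => p; rewrite mxE; have /negP := cz p; rewrite negbK => /eqP.
  have := Sc; rewrite /S /= c0 /N big1 => [/eqP|p _]; last by rewrite mxE expr0n.
  by rewrite eq_sym oner_eq0.
move=> v; have [vn|/forallNP vz] := pselect (exists p, v p != 0); last first.
  have v0 p : v p = 0 by have /negP := vz p; rewrite negbK => /eqP.
  rewrite big1 => [|p _]; last by rewrite v0 expr0n.
  rewrite mulr0 /qform big1// => p _; rewrite big1// => q _.
  by rewrite v0 !mul0r.
have [w [a [Sw a0 -> ->]]] := scale v vn.
rewrite mulrC ler_pM2l//; apply: cmin; exact/mem_set.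
Qed.

End quadratic_bounds.

(** Nonnegativity of [b] at c v + w and at - c v + w, multiplied by [c^-1]. *)
Lemma symbil_young (R : realType) (E : lmodType R) (S : set E) (b : E -> E -> R)
  (c : R) v w : subspace S -> symbilinear_on S b -> (forall x, S x -> 0 <= b x x) ->
  0 < c -> S v -> S w -> `|2 * b v w| <= c * b v v + c^-1 * b w w.
Proof.
move=> SS bb b0 c0 Sv Sw; have cu : c != 0 by rewrite lt0r_neq0.
have H a : 0 <= a ^+ 2 * b v v + a * (2 * b v w) + b w w.
  have Sav := subspaceZ SS a Sv; have := b0 _ (subspaceD SS Sav Sw).
  rewrite (symbil_quadD SS bb Sav Sw) (symbilZl SS bb a Sv Sav).
  rewrite (symbilZr SS bb a Sv Sv) (symbilZl SS bb a Sv Sw).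
  by rewrite expr2 -mulrA [2 * (a * _)]mulrCA.
have Hc a : 0 <= c^-1 * (a ^+ 2 * b v v + a * (2 * b v w) + b w w).
  by rewrite mulr_ge0// invr_ge0 ltW.
have := Hc c; have := Hc (- c).
rewrite sqrrN !mulrDr expr2 !mulNr mulrN -!mulrA !mulKf//.
by move=> H1 H2; rewrite ler_norml; apply/andP; split; lra.
Qed.

Lemma continuous_near_le (R : realType) (f : R -> R) (x e : R) :
  {for x, continuous f} -> 0 < e -> \forall y \near x, `|f y - f x| <= e.
Proof.
move=> cf e0; have /cvgrPdist_le /(_ e e0) := cf.
by apply: filterS => y; rewrite distrC.
Qed.

Lemma near_and3 (R : realType) (P Q S : R -> Prop) (x : R) :
  (\forall y \near x, P y) -> (\forall y \near x, Q y) ->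
  (\forall y \near x, S y) -> \forall y \near x, [/\ P y, Q y & S y].
Proof. exact: filterS3. Qed.

Lemma near_forall_fin (R : realType) (I : finType) (P : R -> I -> Prop) (x : R) :
  (forall i, \forall y \near x, P y i) -> \forall y \near x, forall i, P y i.
Proof.
move=> H; have : \forall y \near x, forall i, i \in enum I -> P y i.
  elim: (enum I) => [|i s IH]; first by apply: (@filterS _ (nbhs x) _ setT) => //; exact: filterT.
  apply: filterS2 (H i) IH => y Pi Ps j.
  by rewrite inE => /orP[/eqP -> //|]; exact: Ps.
by apply: filterS => y Py i; apply: Py; rewrite mem_enum.
Qed.

Lemma Int_cst (R : realType) (a b k : R) : a <= b -> Int a b (fun=> k) = k * (b - a).
Proof.
move=> ab; have E : Int a b (fun=> k) = k * fine (@lebesgue_measure R `[a, b]%classic).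
  by rewrite /Int; apply: Rintegral_cst.
rewrite E lebesgue_measure_itv /= lte_fin; congr (_ * _).
have := ab; rewrite le_eqVlt => /orP[/eqP <-|ab'].
  by rewrite ltxx subrr.
by rewrite ab' -EFinB.
Qed.

(** Meant for u = |xi|^2 and w = |D xi|^2, for which the hypothesis on [du] is Young's inequality.
    Working with the square of the norm avoids the norm itself, which need not be differentiable at
    zeros of xi. *)
Lemma poincare_scalar (R : realType) (a b : R) (u w du : R -> R) :
  a <= b -> H1 a b u du -> u a = 0 -> L1 a b w ->
  (forall t, a <= t <= b -> 0 <= u t) -> aeon a b (fun t => 0 <= w t) ->
  (forall l, 0 < l -> aeon a b (fun t => `|du t| <= l * u t + l^-1 * w t)) ->
  Int a b u <= 4 * (b - a) ^+ 2 * Int a b w.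
Proof.
move=> ab Hu ua L1w u0 w0 duw.
have := ab; rewrite le_eqVlt => /orP[/eqP <-|ab'].
  by rewrite 2!Int_aa mulr0.
pose d := b - a; have d0 : 0 < d by rewrite subr_gt0.
have L1u : L1 a b u by exact: (cont_on_L1 (H1_cont ab Hu)).
pose A := Int a b u; pose B := Int a b w.
(* Integrating u <= l A + B / l over [a, b] gives A <= d (l A + B / l). With this l the coefficient
   of A is 1/2, and the constant becomes 4 d^2. *)
pose l := (2 * d)^-1; have l0 : 0 < l by rewrite invr_gt0 mulr_gt0.
pose k t := l * u t + l^-1 * w t.
have L1k : L1 a b k by apply: L1D; exact: L1Z.
have k0 : aeon a b (fun t => 0 <= k t).
  apply: aeonS w0 => t tab wt; rewrite /k; apply: addr_ge0; apply: mulr_ge0 => //.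
  - exact: ltW.
  - exact: u0.
  - by rewrite invr_ge0 ltW.
have ukt t : a <= t <= b -> u t <= l * A + l^-1 * B.
  move=> /andP[at_ tb].
  have Hut := H1_sub (lexx a) at_ tb Hu.
  have := H1_Int Hut at_; rewrite ua subr0 => ->.
  apply: (@le_trans _ _ (Int a t k)).
    apply: Int_le; first exact: L2_L1 Hut.1.
      by apply: L1_sub L1k.
    apply: (aeon_sub (lexx a) tb); apply: aeonS (duw l l0) => s _.
    exact: le_trans (ler_norm _).
  have -> : l * A + l^-1 * B = Int a b k by rewrite IntD ?IntZ//; exact: L1Z.
  rewrite (@Int_cat _ a t b)// lerDl; apply: Int_ge0.
  exact: (aeon_sub at_ (lexx b) k0).
have : A <= d * (l * A + l^-1 * B).
  have -> : d * (l * A + l^-1 * B) = Int a b (fun=> l * A + l^-1 * B).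
    by rewrite Int_cst// mulrC.
  apply: Int_le => //; first exact: (cont_on_L1 (@cont_on_cst _ a b _)).
  by apply: aeonT => t; exact: ukt.
rewrite -/d -/A -/B /l invrK mulrDr mulrA.
have -> : d * (2 * d)^-1 = 2^-1 by field; rewrite lt0r_neq0.
by move=> H; nra.
Qed.

#[local] Opaque metric coef potential christoffel Int.

Section estimates.
Context (R : realType) (m : nat) (M : manifold R m) (tau : R)
  (L : M -> (idx M -> 'cV[R]_m) -> R -> R) (gamma : R -> M)
  (D : (R -> idx M -> 'cV[R]_m) -> R -> idx M -> 'cV[R]_m)
  (U : R -> (idx M -> 'cV[R]_m) -> idx M -> 'cV[R]_m).
Hypotheses (LL : lagrangian_function tau L) (gP : periodic_trajectory tau L gamma)
  (Dcov : covariant_derivative tau gamma D)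
  (Dmet : metric_compatible gamma (metric L gamma) D)
  (Usym : symmetric_operator tau gamma (metric L gamma) U).
Notation g := (metric L gamma).
Notation T t := (tangent (gamma t)).
Notation field := (R -> idx M -> 'cV[R]_m).
Notation sobolev := (sobolev_field gamma).
Implicit Types (xi eta phi : field) (i j : idx M) (t a b : R).

Lemma metric_ge0 t v : T t v -> 0 <= g t v v.
Proof.
move=> tv; have [->|/eqP v0] := eqVneq v 0; last exact/ltW/(metric_pos LL gP).
have ST := tangent_subspace (gamma t).
by rewrite (symbil0l ST (metric_symbilinear LL gP t) (subspace0 ST)).
Qed.

Lemma metric_young t v w (c : R) : 0 < c -> T t v -> T t w ->
  `|2 * g t v w| <= c * g t v v + c^-1 * g t w w.
Proof.
move=> c0 tv tw; exact: (symbil_young (tangent_subspace (gamma t)) (metric_symbilinear LL gP t)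
  (@metric_ge0 t) c0 tv tw).
Qed.

(** Near each time, the metric in a chart is bounded below by half its lower bound at that time,
    while the entries of the metric and of the potential stay bounded. Local constants are added up
    by [cousin]. *)
Lemma U_bound a b : a <= b -> exists2 C, 0 <= C &
  forall t v, a <= t <= b -> T t v -> g t (U t v) (U t v) <= C * g t v v.
Proof.
move=> ab; pose Q x y := exists2 C, 0 <= C &
  forall t v, x <= t <= y -> T t v -> g t (U t v) (U t v) <= C * g t v v.
apply: (@cousin _ a b Q) => // [x y z xy yz [C C0 HC] [C' C'0 HC']|t0 _].
  exists (C + C'); first exact: addr_ge0.
  move=> t v /andP[xt tz] tv; have g0 := metric_ge0 tv.
  have [ty|/ltW yt] := leP t y.
    by apply: (le_trans (HC t v _ tv)); rewrite ?xt// ler_wpM2r// lerDl.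
  by apply: (le_trans (HC' t v _ tv)); rewrite ?yt// ler_wpM2r// lerDr.
have [i it] := dom_cover (gamma t0).
have [c c0 Hc] : exists2 c, 0 < c & forall v : 'I_m -> R,
    c * \sum_p v p ^+ 2 <= qform (fun p q => coef L gamma i t0 p q) v.
  apply: posdef_lower => v [p vp].
  pose w : idx M -> 'cV[R]_m := \sum_p v p *: frame gamma i p t0.
  have ST := tangent_subspace (gamma t0).
  have tw : T t0 w.
    by apply: (subspace_comb ST) => q; exact: frame_along.
  have wi q : w i q 0 = v q.
    rewrite /w fct_sumE summxE (bigD1 q)//= -/((v q *: frame gamma i q t0) i).
    rewrite (_ : (v q *: frame gamma i q t0) i = v q *: frame gamma i q t0 i)//.
    rewrite frame_in// !mxE !eqxx/= mulr1 big1 ?addr0// => r rq.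
    rewrite (_ : (v r *: frame gamma i r t0) i = v r *: frame gamma i r t0 i)//.
    by rewrite frame_in// !mxE eq_sym (negbTE rq) mulr0.
  have := metric_pos LL gP tw; rewrite (metric_frameE LL gP it tw tw).
  rewrite /qform; under eq_bigr do under eq_bigr do rewrite !wi.
  apply=> w0; move: vp; rewrite -wi w0 mxE eqxx.
  by [].
(* A perturbation of the entries by at most [e] changes the form by at most e m |v|^2 <= (c / 2)
   |v|^2. The summand 1 avoids division by zero when m = 0. *)
pose e := c / 2 / (m%:R + 1).
have m1 : (0 : R) < m%:R + 1 by rewrite ltr_wpDl.
have e0 : 0 < e by rewrite !divr_gt0.
have Kaux (x y s1 s2 : R) : x <= 1 -> y <= s2 -> 0 <= s1 -> x + y <= 1 + s1 + s2.
  by move=> *; lra.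
have Kaux2 (x y s1 s2 : R) : x <= 1 -> y <= s1 -> 0 <= s2 -> x + y <= 1 + s1 + s2.
  by move=> *; lra.
(* A common bound for the entries of the potential and of the metric at all times where they differ
   by at most 1 from their values at [t0]. *)
pose K := 1 + \sum_p \sum_q `|potential Usym t0 i p q| + \sum_p \sum_q `|coef L gamma i t0 p q|.
have ge0s (f : 'I_m -> 'I_m -> R) : 0 <= \sum_p \sum_q `|f p q|.
  by apply: sumr_ge0 => p _; apply: sumr_ge0 => q _.
have les (f : 'I_m -> 'I_m -> R) p q : `|f p q| <= \sum_p \sum_q `|f p q|.
  rewrite (bigD1 p)//= (bigD1 q)//= -addrA lerDl addr_ge0//.
    by apply: sumr_ge0.
  by apply: sumr_ge0 => ? _; apply: sumr_ge0.
have K0 : 0 <= K by rewrite /K !addr_ge0.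
have Ncoef p q := continuous_near_le (@coef_cont _ _ _ _ _ _ _ LL gP Dcov Dmet i p q t0 it) e0.
have Ncoef1 p q := continuous_near_le (@coef_cont _ _ _ _ _ _ _ LL gP Dcov Dmet i p q t0 it) ltr01.
have Npot p q := continuous_near_le (@potential_cont _ _ _ _ _ _ _ Usym i t0 p q it) ltr01.
pose PP t (pq : 'I_m * 'I_m) :=
   [/\ `|coef L gamma i t pq.1 pq.2 - coef L gamma i t0 pq.1 pq.2| <= e,
      `|coef L gamma i t pq.1 pq.2 - coef L gamma i t0 pq.1 pq.2| <= 1 &
    `|potential Usym t i pq.1 pq.2 - potential Usym t0 i pq.1 pq.2| <= 1].
have NPP : \forall t \near t0, forall pq, PP t pq.
  apply: (@near_forall_fin R _ PP t0) => pq.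
  exact: (near_and3 (Ncoef pq.1 pq.2) (Ncoef1 pq.1 pq.2) (Npot pq.1 pq.2)).
have : \forall t \near t0, dom i (gamma t) /\ forall pq, PP t pq.
  exact: filterI (gamma_dom_near gP it) NPP.
move=> /nbhs_ballP[d /= d0 Hd]; exists d => // x y _ _ tx xy yt.
exists (K * m%:R * (m%:R * (K ^+ 2 * m%:R)) / (c / 2)).
  by rewrite !mulr_ge0// ?exprn_ge0// invr_ge0 ltW// divr_gt0.
move=> t v /andP[xt ty] tv.
have [it' near_t] : dom i (gamma t) /\ forall pq, PP t pq.
  apply: Hd; rewrite -ball_normE /ball_/= ltr_distlC; apply/andP.
  by split; [exact: lt_le_trans xt|exact: le_lt_trans yt].
pose x_ p := v i p 0; pose n2 := \sum_p x_ p ^+ 2.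
have n20 : 0 <= n2 by apply: sumr_ge0 => p _; exact: sqr_ge0.
have lower : c / 2 * n2 <= g t v v.
  rewrite (metric_frameE LL gP it' tv tv).
  have -> : \sum_p \sum_q v i p 0 * v i q 0 * coef L gamma i t p q =
      qform (fun p q => coef L gamma i t0 p q) x_ +
      qform (fun p q => coef L gamma i t p q - coef L gamma i t0 p q) x_.
    rewrite /qform -big_split; apply: eq_bigr => p _; rewrite -big_split.
    by apply: eq_bigr => q _ /=; rewrite -mulrDr addrC subrK.
  have ce p q : `|coef L gamma i t p q - coef L gamma i t0 p q| <= e.
    by case: (near_t (p, q)).
  have up := qform_upper x_ ce.
  have lo := Hc x_.
  have : e * m%:R * n2 <= c / 2 * n2.
    apply: ler_wpM2r => //; rewrite /e -mulrA.
    apply: ler_piMr; first by rewrite ltW// divr_gt0.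
    by rewrite [X in X <= _]mulrC ler_pdivrMr// mul1r lerDl.
  move: up; rewrite ler_norml => /andP[up _]; rewrite -/n2 in up lo *.
  move=> H; lra.
have tUv := U_tangent Usym tv.
have cK p q : `|coef L gamma i t p q| <= K.
  have [_ H _] := near_t (p, q).
  rewrite -[coef _ _ _ _ _ _](subrK (coef L gamma i t0 p q)).
  apply: le_trans (ler_normD _ _) _; exact: (Kaux _ _ _ _ H (les (fun p q => coef L gamma i t0 p q) p q)
    (ge0s (fun p q => potential Usym t0 i p q))).
have pK p q : `|potential Usym t i p q| <= K.
  have [_ _ H] := near_t (p, q).
  rewrite -[potential _ _ _ _ _](subrK (potential Usym t0 i p q)).
  apply: le_trans (ler_normD _ _) _; exact: (Kaux2 _ _ _ _ H (les (fun p q => potential Usym t0 i p q) p q)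
    (ge0s (fun p q => coef L gamma i t0 p q))).
have upper : g t (U t v) (U t v) <= K * m%:R * \sum_p (U t v i p 0) ^+ 2.
  rewrite (metric_frameE LL gP it' tUv tUv).
  exact: le_trans (ler_norm _) (qform_upper (fun p => U t v i p 0) cK).
have comp p : (U t v i p 0) ^+ 2 <= m%:R * (K ^+ 2 * n2).
  have [_ _ UE] := potentialP Usym; rewrite UE mxE.
  apply: (le_trans (sum_sqr_le _)); rewrite ler_wpM2l// mulr_sumr.
  apply: ler_sum => q _; rewrite exprMn ler_wpM2r ?sqr_ge0//.
  by rewrite -(real_normK (num_real (potential _ _ _ _ _))) lerXn2r ?nnegrE.
have comps : \sum_p (U t v i p 0) ^+ 2 <= m%:R * (m%:R * (K ^+ 2 * n2)).
  apply: (@le_trans _ _ (\sum_(p < m) m%:R * (K ^+ 2 * n2))).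
    by apply: ler_sum => p _; exact: comp.
  by rewrite sumr_const card_ord -[leLHS]mulr_natl.
apply: (le_trans upper).
have n2g : n2 <= g t v v / (c / 2) by rewrite ler_pdivlMr ?divr_gt0// mulrC.
apply: (@le_trans _ _ (K * m%:R * (m%:R * (m%:R * (K ^+ 2 * (g t v v / (c / 2))))))).
  rewrite ler_wpM2l ?mulr_ge0//; apply: (le_trans comps).
  by rewrite ler_wpM2l// ler_wpM2l// ler_wpM2l// exprn_ge0.
by rewrite le_eqVlt; apply/orP; left; apply/eqP; ring.
Qed.

Lemma U_young a b : a <= b -> exists2 C, 0 <= C &
  forall t v, a <= t <= b -> T t v -> `|g t (U t v) v| <= C * g t v v.
Proof.
move=> /U_bound[C C0 HC]; exists (C + 1); first by rewrite addr_ge0.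
move=> t v tab tv; have := HC t v tab tv.
have := metric_young ltr01 (U_tangent Usym tv) tv.
have := metric_ge0 tv.
move: (g t v v) (g t (U t v) v) (g t (U t v) (U t v)) => x y z x0.
rewrite invr1 !mul1r normrM ger0_norm// => yz zx.
by have := normr_ge0 y; nra.
Qed.

Lemma sobolev_poincare xi a b : a <= b -> sobolev xi -> xi a = 0 ->
  Int a b (fun t => g t (xi t) (xi t)) <=
  4 * (b - a) ^+ 2 * Int a b (fun t => g t (D xi t) (D xi t)).
Proof.
move=> ab Wx xa.
have ST := tangent_subspace (gamma a).
have DL := sobolev_D_L2 gP Dcov Wx.
have tD : aeon a b (fun t => T t (D xi t)).
  apply: aeonS (sobolev_ae_derivable gP Dcov Wx ab) => t _ dx.
  exact: (D_tangent Dcov Wx.1 dx).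
apply: (poincare_scalar ab (metric_H1 LL gP Dcov Dmet Wx Wx ab) _
  (metric_L1 LL gP Dcov Dmet DL DL ab)).
- by rewrite xa; exact: (symbil0l ST (metric_symbilinear LL gP a) (subspace0 ST)).
- by move=> t _; exact: (metric_ge0 (Wx.1 t)).
- by apply: aeonS tD => t _; exact: metric_ge0.
- move=> l l0; apply: aeonS tD => t _ ts.
  have := metric_young l0 (Wx.1 t) ts.
  rewrite (symbilC (metric_symbilinear LL gP t) ts (Wx.1 t)).
  by rewrite mulr_natl mulr2n.
Qed.

End estimates.

(** * Continuously differentiable functions of one variable *)

Section scalar.
Context (R : realType).
Implicit Types (f h : R -> R) (a b t : R).

(** Multiplication by an exponential makes [e] monotone towards its zero at 0 on either side, so
    that [e] is also nonpositive. *)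
Lemma gronwall_zero (e de : R -> R) (K c : R) :
  (forall t, `|t| <= c -> is_derive t (1 : R) e (de t)) ->
  (forall t, `|t| <= c -> `|de t| <= K * e t) -> e 0 = 0 ->
  (forall t, 0 <= e t) -> forall t, `|t| <= c -> e t = 0.
Proof.
move=> De dele e0 ege t tc; have c0 : 0 <= c by exact: le_trans (normr_ge0 t) tc.
have dexp (l s : R) : is_derive s (1 : R) (fun s => expR (l * s)) (l * expR (l * s)).
  have dl : is_derive s (1 : R) (fun s : R => l * s) l.
    have := is_deriveM_fun (is_derive_cst l s 1) (is_derive_id s (1 : R)).
    by rewrite mul0r add0r mulr1.
  have := is_derive1_comp (is_derive_expR (l * s)) dl.
  by rewrite mulrC.
have dprod l s : `|s| <= c -> is_derive s (1 : R) (fun s => e s * expR (l * s))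
    ((de s + l * e s) * expR (l * s)).
  move=> sc; have := is_deriveM_fun (De s sc) (dexp l s).
  by rewrite mulrDl [l * e s]mulrC -mulrA.
have inc x a b : - c <= a -> b <= c -> x \in `]a, b[%R -> `|x| <= c.
  move=> ca bc; rewrite in_itv/= => /andP[ax xb]; rewrite ler_norml.
  by rewrite (le_trans ca (ltW ax)) (le_trans (ltW xb) bc).
have cprod l a b : - c <= a -> b <= c ->
    {within `[a, b], continuous (fun s => e s * expR (l * s))}.
  move=> ca bc; apply: derivable_within_continuous => x; rewrite in_itv/= => /andP[ax xb].
  have xc : `|x| <= c by rewrite ler_norml (le_trans ca ax) (le_trans xb bc).
  by case: (dprod l x xc).
have := tc; rewrite ler_norml => /andP[ct1 ct2].
apply/eqP; rewrite eq_le ege andbT.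
have expp l : 0 < expR (l * t) :> R by exact: expR_gt0.
(* For t >= 0 the product e(s) exp(- K s) does not increase; for t < 0 the product e(s) exp(K s)
   does not decrease up to 0. *)
have [t0|t0] := leP 0 t.
  rewrite -(pmulr_lle0 _ (expp (- K))).
  have := @ler0_derive1_nincr R (fun s => e s * expR (- K * s)) 0 t.
  have mc0 : - c <= 0 by rewrite oppr_le0.
  move=> /(_ _ _ (cprod (- K) 0 t mc0 ct2)) H.
  have := H _ _ 0 t (lexx 0) t0 (lexx t).
  rewrite e0 mul0r; apply=> x /(inc x 0 t mc0 ct2) xc; first by case: (dprod (- K) x xc).
  rewrite derive1E; case: (dprod (- K) x xc) => _ ->.
  rewrite pmulr_lle0 ?expR_gt0// mulNr subr_le0.
  exact: le_trans (ler_norm _) (dele x xc).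
rewrite -(pmulr_lle0 _ (expp K)).
have := @ger0_derive1_ndecr R (fun s => e s * expR (K * s)) t 0.
move=> /(_ _ _ (cprod K t 0 ct1 c0)) H.
have := H _ _ t 0 (lexx t) (ltW t0) (lexx 0).
rewrite e0 mul0r; apply=> x /(inc x t 0 ct1 c0) xc; first by case: (dprod K x xc).
rewrite derive1E; case: (dprod K x xc) => _ ->.
rewrite mulr_ge0 ?expR_ge0// -lerBlDr sub0r.
by have := dele x xc; rewrite ler_norml => /andP[].
Qed.

Definition C1fun f := (forall t, derivable f t 1) /\ continuous (derive1 f).

Lemma C1fun_is f h : (forall t, is_derive t (1 : R) f (h t)) -> continuous h -> C1fun f.
Proof.
move=> fD ch; split=> [t|]; first by case: (fD t).
rewrite (_ : derive1 f = h)//; apply/funext => t.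
by rewrite derive1E; case: (fD t).
Qed.

Lemma C1fun_derive f t : C1fun f -> is_derive t (1 : R) f (derive1 f t).
Proof. by move=> [fD _]; exact: derivable_is_derive1. Qed.

Lemma C1fun_cont f : C1fun f -> continuous f.
Proof. by move=> [fD _] t; exact: derivable_continuous_at. Qed.

Lemma C1fun_cst k : C1fun (fun=> k).
Proof.
have c0 : continuous (fun _ : R => (0 : R)) by exact: cst_continuous.
by apply: C1fun_is c0 => t; exact: is_derive_cst.
Qed.

Lemma C1funD f h : C1fun f -> C1fun h -> C1fun (fun t => f t + h t).
Proof.
move=> cf ch; apply: (@C1fun_is _ (fun t => derive1 f t + derive1 h t)) => [t|].
  exact: is_deriveD_fun (C1fun_derive t cf) (C1fun_derive t ch).
by move=> t; apply: continuousD_fun; [exact: cf.2|exact: ch.2].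
Qed.

Lemma C1funM f h : C1fun f -> C1fun h -> C1fun (fun t => f t * h t).
Proof.
move=> cf ch; apply: (@C1fun_is _ (fun t => derive1 f t * h t + f t * derive1 h t)) => [t|].
  exact: is_deriveM_fun (C1fun_derive t cf) (C1fun_derive t ch).
have [_ cf'] := cf; have [_ ch'] := ch.
have cfc := C1fun_cont cf; have chc := C1fun_cont ch.
move=> t; exact (continuousD_fun (continuousM_fun (cf' t) (chc t))
  (continuousM_fun (cfc t) (ch' t))).
Qed.

Lemma C1fun_sum (I : Type) (r : seq I) (F : I -> R -> R) :
  (forall i, C1fun (F i)) -> C1fun (fun t => \sum_(i <- r) F i t).
Proof.
move=> H; elim: r => [|i r IH].
  by under eq_fun do rewrite big_nil; exact: C1fun_cst.
by under eq_fun do rewrite big_cons; exact: C1funD.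
Qed.

Lemma C1fun_prod (I : Type) (r : seq I) (F : I -> R -> R) :
  (forall i, C1fun (F i)) -> C1fun (fun t => \prod_(i <- r) F i t).
Proof.
move=> H; elim: r => [|i r IH].
  by under eq_fun do rewrite big_nil; exact: C1fun_cst.
by under eq_fun do rewrite big_cons; exact: C1funM.
Qed.

Lemma C1funV f : C1fun f -> (forall t, f t != 0) -> C1fun (fun t => (f t)^-1).
Proof.
move=> cf f0; apply: (@C1fun_is _ (fun t => - 1 * ((f t)^-1 * (f t)^-1) * derive1 f t)).
  move=> t; have [df _] := cf.
  have dV : derivable (fun t => (f t)^-1) t 1 by exact: derivableV.
  apply: (DeriveDef dV); rewrite (deriveV (f0 t) (df t)).
  by rewrite derive1E /GRing.scale/= expr2 invfM mulN1r.
have cV : continuous (fun t => (f t)^-1).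
  by move=> t; apply: (@cvgV _ _ _ _ f) => //; exact: C1fun_cont.
have [_ cf'] := cf; have c1 : continuous (fun _ : R => -1 : R) by exact: cst_continuous.
move=> t; exact (continuousM_fun (continuousM_fun (c1 t) (continuousM_fun (cV t) (cV t)))
  (cf' t)).
Qed.

Lemma C1fun_det n (A : R -> 'M[R]_n) :
  (forall i j, C1fun (fun t => A t i j)) -> C1fun (fun t => \det (A t)).
Proof.
move=> H; apply: C1fun_sum => s; apply: C1funM; first exact: C1fun_cst.
exact: C1fun_prod.
Qed.

Lemma C1fun_invmx n (A : R -> 'M[R]_n) : (forall t, A t \in unitmx) ->
  (forall i j, C1fun (fun t => A t i j)) -> forall i j, C1fun (fun t => invmx (A t) i j).
Proof.
move=> uA H i j.
rewrite (_ : (fun t => _) = fun t => (\det (A t))^-1 * cofactor (A t) j i).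
  apply: C1funM.
    apply: C1funV => [|t]; first exact: C1fun_det.
    by have := uA t; rewrite unitmxE unitfE.
  apply: C1funM; first exact: C1fun_cst.
  apply: (@C1fun_det _ (fun t => row' j (col' i (A t)))) => a b.
  by under eq_fun do rewrite !mxE; exact: H.
by apply/funext => t; rewrite /invmx uA !mxE.
Qed.

Lemma C1fun_sobolev f : C1fun f -> sobolev_fun f.
Proof.
move=> cf a b ab; exists (derive1 f); apply: C1_H1 => [t _|]; first exact: C1fun_derive.
by apply: cont_on_at => t _; exact: cf.2.
Qed.

(* The primitive vanishing at 0; both integrals are taken over intervals
   starting at - `|t| - 1, so that no orientation of the interval is needed. *)
Definition primitive f t : R :=
  Int (- `|t| - 1) t f - Int (- `|t| - 1) 0 f.

Lemma primitiveE f a t : continuous f -> a <= t -> a <= 0 ->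
  primitive f t = Int a t f - Int a 0 f.
Proof.
move=> cf at_ a0; rewrite /primitive; set c := - _ - 1.
have c0 : c <= 0 by rewrite /c -opprD oppr_le0 addr_ge0.
have ct : c <= t by rewrite /c; have := ler_norm (- t); rewrite normrN; lra.
have L x y : L1 x y f by apply: cont_on_L1; apply: cont_on_at => s _; exact: cf.
have [ac|/ltW ca] := leP a c.
  rewrite (@Int_cat _ a c t)// (@Int_cat _ a c 0)//; ring.
rewrite (@Int_cat _ c a t)// (@Int_cat _ c a 0)//; ring.
Qed.

Lemma primitive_derive f t : continuous f -> is_derive t (1 : R) (primitive f) (f t).
Proof.
move=> cf; pose a := - `|t| - 1.
have at_ : a < t.
  by rewrite /a; have := ler_norm (- t); rewrite normrN; lra.
have a0 : a <= 0 by rewrite /a -opprD oppr_le0 addr_ge0.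
have iF : (@lebesgue_measure R).-integrable `[a, t + 1] (EFin \o f).
  apply: continuous_compact_integrable; first exact: segment_compact.
  exact: continuous_subspaceT.
have tt1 : t < t + 1 by rewrite ltrDl.
have [dI dIE] := continuous_FTC1_closed tt1 iF at_ (cf t).
have near_t : \forall s \near t, Int a s f + - Int a 0 f = primitive f s.
  have : t \in `]a, (t + 1)[%R by rewrite in_itv/= at_ tt1.
  move=> /near_in_itvoo; apply: filterS => s; rewrite in_itv/= => /andP[as_ _].
  by rewrite (@primitiveE f a s)// ltW.
apply: (near_eq_is_derive near_t); rewrite -[f t]addr0.
have dI1 : is_derive t (1 : R) (fun s => Int a s f) (f t).
  by rewrite -dIE; exact: derivable_is_derive1.
exact (is_deriveD_fun dI1 (is_derive_cst (- Int a 0 f) t (1 : R))).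
Qed.

Lemma primitive_C1 f : continuous f -> C1fun (primitive f).
Proof.
by move=> cf; exact: (C1fun_is (fun t => @primitive_derive f t cf) cf).
Qed.

Lemma primitive0 f : primitive f 0 = 0.
Proof. by rewrite /primitive subrr. Qed.

Lemma primitive_lin c f h : continuous f -> continuous h ->
  forall t, primitive (fun s => c * f s + h s) t = c * primitive f t + primitive h t.
Proof.
move=> cf ch t; have L u x y : continuous u -> L1 x y u.
  by move=> cu; apply: cont_on_L1; apply: cont_on_at => s _; exact: cu.
have E x : Int (- `|t| - 1) x (fun s => c * f s + h s) =
    c * Int (- `|t| - 1) x f + Int (- `|t| - 1) x h.
  by rewrite IntD ?IntZ//; [exact: L|apply: L1Z; exact: L|exact: L].
rewrite /primitive !E; ring.
Qed.

(** The increment over a period has zero derivative, hence is constant. These constants are the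
    jumps of the lifted fields. *)
Lemma primitive_periodic f p : continuous f -> (forall t, f (t + p) = f t) ->
  forall t, primitive f (t + p) = primitive f t + primitive f p.
Proof.
move=> cf fp t.
pose d s := primitive f (s + p) + -1 * primitive f s.
have dD s : is_derive s (1 : R) d 0.
  have -> : 0 = f (s + p) + -1 * f s by rewrite fp; ring.
  have H1 : is_derive s (1 : R) (fun s => primitive f (s + p)) (f (s + p)).
    have ds : is_derive s (1 : R) (fun s => s + p) 1.
      have := is_deriveD_fun (is_derive_id s (1 : R)) (is_derive_cst p s (1 : R)).
      by rewrite addr0.
    have := @is_derive1_comp _ (primitive f) _ s _ _ (@primitive_derive f (s + p) cf) ds.
    by rewrite mulr1.
  have H2 := is_deriveM_fun (is_derive_cst (-1 : R) s (1 : R)) (@primitive_derive f s cf).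
  rewrite mul0r add0r in H2.
  exact (is_deriveD_fun H1 H2).
have := is_derive_0_is_cst t 0 dD; rewrite /d primitive0 add0r mulr0 addr0.
by move=> <-; ring.
Qed.

End scalar.

(** * The second variation and the variational system *)

Section forms.
Context (R : realType) (m : nat) (M : manifold R m) (tau : R)
  (L : M -> (idx M -> 'cV[R]_m) -> R -> R) (gamma : R -> M)
  (D : (R -> idx M -> 'cV[R]_m) -> R -> idx M -> 'cV[R]_m)
  (U : R -> (idx M -> 'cV[R]_m) -> idx M -> 'cV[R]_m).
Hypotheses (LL : lagrangian_function tau L) (gP : periodic_trajectory tau L gamma)
  (Dcov : covariant_derivative tau gamma D)
  (Dmet : metric_compatible gamma (metric L gamma) D)
  (Usym : symmetric_operator tau gamma (metric L gamma) U).
Notation g := (metric L gamma).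
Notation T t := (tangent (gamma t)).
Notation field := (R -> idx M -> 'cV[R]_m).
Notation sobolev := (sobolev_field gamma).
Notation solution := (variational_solution gamma D U).
Implicit Types (xi eta phi : field) (i j : idx M) (t a b : R).

Definition h_on a b xi phi :=
  Int a b (fun t => g t (D xi t) (D phi t) + g t (U t (xi t)) (phi t)).

Lemma hformE xi phi : hform tau g D U xi phi = h_on 0 tau xi phi.
Proof. by rewrite /h_on IntE. Qed.

Lemma h_on_L1 a b xi phi : sobolev xi -> sobolev phi -> a <= b ->
  L1 a b (fun t => g t (D xi t) (D phi t)) /\
  L1 a b (fun t => g t (U t (xi t)) (phi t)).
Proof.
move=> Wx Wp ab; split.
  exact (metric_L1 LL gP Dcov Dmet (sobolev_D_L2 gP Dcov Wx) (sobolev_D_L2 gP Dcov Wp) ab).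
exact (metric_L1 LL gP Dcov Dmet (U_L2 Usym Wx) (sobolev_L2 Wp) ab).
Qed.

Lemma h_on_symbilinear a b : a <= b -> symbilinear_on sobolev (h_on a b).
Proof.
move=> ab; split=> [c x y z Wx Wy Wz|x y Wx Wy].
  have H4 (k p q r s : R) : k * p + q + (k * r + s) = k * (p + r) + (q + s).
    by rewrite mulrDr addrACA.
  have [Lx Lx'] := h_on_L1 Wx Wz ab; have [Ly Ly'] := h_on_L1 Wy Wz ab.
  rewrite /h_on -(IntZ c (L1D Lx Lx')) -(IntD (L1Z c (L1D Lx Lx')) (L1D Ly Ly')).
  apply: Int_ae.
  have dx := sobolev_ae_derivable gP Dcov Wx ab.
  have dy := sobolev_ae_derivable gP Dcov Wy ab.
  have dz := sobolev_ae_derivable gP Dcov Wz ab.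
  apply: aeonS2 (aeonS2 (fun t _ => @conj _ _) dx dy) dz => t _ [dxt dyt] dzt.
  have gb := metric_symbilinear LL gP t.
  rewrite (D_linear Dcov c Wx.1 Wy.1 dxt dyt).
  rewrite (_ : (c *: x + y) t = c *: x t + y t)//.
  rewrite (U_linear Usym t c Logic.I Logic.I).
  rewrite (gb.1 c _ _ _ (D_tangent Dcov Wx.1 dxt) (D_tangent Dcov Wy.1 dyt) (D_tangent Dcov Wz.1 dzt)).
  rewrite (gb.1 c _ _ _ (U_tangent Usym (Wx.1 t)) (U_tangent Usym (Wy.1 t)) (Wz.1 t)).
  exact (H4 c _ _ _ _).
apply: Int_ae.
have dx := sobolev_ae_derivable gP Dcov Wx ab.
have dy := sobolev_ae_derivable gP Dcov Wy ab.
apply: aeonS2 dx dy => t _ dxt dyt.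
have gb := metric_symbilinear LL gP t.
rewrite (symbilC gb (D_tangent Dcov Wx.1 dxt) (D_tangent Dcov Wy.1 dyt)).
rewrite (U_sym Usym (Wx.1 t) (Wy.1 t)).
by rewrite (symbilC gb (Wx.1 t) (U_tangent Usym (Wy.1 t))).
Qed.

Lemma h_on_cat a b c xi phi : sobolev xi -> sobolev phi -> a <= b -> b <= c ->
  h_on a c xi phi = h_on a b xi phi + h_on b c xi phi.
Proof.
move=> Wx Wp ab bc; have [Lx Lx'] := h_on_L1 Wx Wp (le_trans ab bc).
exact (Int_cat ab bc (L1D Lx Lx')).
Qed.

(** On an interval this short, the Poincare inequality makes the potential term no larger than the
    kinetic one. Vanishing at the left end alone suffices for that inequality. *)
Lemma h_on_ge0 C a b xi : (forall t v, a <= t <= b -> T t v -> `|g t (U t v) v| <= C * g t v v) ->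
  0 <= C -> a <= b -> 4 * C * (b - a) ^+ 2 <= 1 -> sobolev xi -> xi a = 0 -> 0 <= h_on a b xi xi.
Proof.
move=> HC C0 ab small Wx xa.
have H5 (x y z : R) : - C * y <= z -> y <= 4 * (b - a) ^+ 2 * x -> 0 <= x -> 0 <= x + z.
  move=> Hz Hy x0; have H1 : C * y <= C * (4 * (b - a) ^+ 2 * x) by exact: ler_wpM2l.
  have H2 : 4 * C * (b - a) ^+ 2 * x <= x by rewrite -[leRHS]mul1r ler_wpM2r.
  lra.
have [L1 L2] := h_on_L1 Wx Wx ab.
have Lx := metric_L1 LL gP Dcov Dmet (sobolev_L2 Wx) (sobolev_L2 Wx) ab.
rewrite /h_on (IntD L1 L2).
have P := sobolev_poincare LL gP Dcov Dmet ab Wx xa.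
have I0 : 0 <= Int a b (fun t => g t (D xi t) (D xi t)).
  apply: Int_ge0; apply: aeonS (sobolev_ae_derivable gP Dcov Wx ab) => t _ dx.
  exact (metric_ge0 LL gP (D_tangent Dcov Wx.1 dx)).
have UI : - C * Int a b (fun t => g t (xi t) (xi t)) <= Int a b (fun t => g t (U t (xi t)) (xi t)).
  rewrite -(IntZ (- C) Lx); apply: (Int_le (L1Z (- C) Lx) L2).
  apply: aeonT => t tab; have := HC t (xi t) tab (Wx.1 t).
  by rewrite ler_norml mulNr => /andP[].
exact (H5 _ _ _ UI P I0).
Qed.

Lemma XspaceE xi : Xspace tau gamma xi <-> sobolev xi /\ forall t, xi (t + tau) = xi t.
Proof. by split=> [[]|[[]]]; split. Qed.

Lemma Xspace_subspace : subspace (Xspace tau gamma).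
Proof.
have [S0 SD] := sobolev_subspace gamma.
split=> [|c x y /XspaceE[Wx px] /XspaceE[Wy py]]; apply/XspaceE; split=> //.
  exact: SD.
by move=> t; rewrite (_ : (c *: x + y) (t + tau) = c *: x (t + tau) + y (t + tau))// px py.
Qed.

Lemma Xspace_sobolev xi : Xspace tau gamma xi -> sobolev xi.
Proof. by case/XspaceE. Qed.

(* A field vanishing at sufficiently many equidistant points has [0 <= h], by
   the Poincare inequality between consecutive points. *)
Lemma hform_maxneg : 0 < tau -> exists n, maxneg (Xspace tau gamma) (h_on 0 tau) n.
Proof.
move=> tau0; have [C C0 HC] := U_young LL gP Dcov Dmet Usym (ltW tau0).
(* Then 4 C tau^2 <= N <= N^2, so steps of length tau / N satisfy the smallness condition of
   [h_on_ge0]. The successor keeps N nonzero. *)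
pose N := (Num.bound (4 * C * tau ^+ 2)).+1.
pose d := tau / N%:R.
have N0 : (0 : R) < N%:R by rewrite ltr0n.
have d0 : 0 < d by exact: divr_gt0.
have small : 4 * C * d ^+ 2 <= 1.
  have KN : 4 * C * tau ^+ 2 <= N%:R.
    have c0 : 0 <= 4 * C * tau ^+ 2 by apply: mulr_ge0; [exact: mulr_ge0|exact: sqr_ge0].
    apply: (le_trans (ltW (archi_boundP c0))); by rewrite ler_nat.
  have N1 : (1 : R) <= N%:R by rewrite ler1n.
  rewrite /d expr_div_n mulrA ler_pdivrMr ?exprn_gt0// mul1r.
  by apply: (le_trans KN); rewrite expr2 ler_peMl// ltW.
have Ndt : N%:R * d = tau by rewrite /d mulrC divfK// gt_eqF.
have [ch chP] : exists ch : 'I_N -> idx M, forall j : 'I_N, dom (ch j) (gamma (j%:R * d)).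
  exists (fun j : 'I_N => projT1 (cid (dom_cover (gamma (j%:R * d))))) => j.
  exact (projT2 (cid (dom_cover (gamma (j%:R * d))))).
pose I := ('I_N * 'I_m)%type.
(* The coordinates of [xi] at the times j d with 0 <= j < N. The last time tau is left out because
   each step uses only its left end. *)
pose l (xi : field) (c : 'I_#|{: I}|) : R :=
  let: (j, p) := enum_val c in xi (j%:R * d) (ch j) p 0.
apply: (@exists_maxneg _ _ _ _ Xspace_subspace _ #|{: I}| l).
- have [H1 H2] := h_on_symbilinear (ltW tau0); split.
    move=> c x y z /Xspace_sobolev Wx /Xspace_sobolev Wy /Xspace_sobolev Wz.
    exact: H1.
  by move=> x y /Xspace_sobolev Wx /Xspace_sobolev Wy; exact: H2.
- move=> c k x y _ _; rewrite /l; case: (enum_val c) => j p.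
  by rewrite (_ : (k *: x + y) _ _ = k *: x (j%:R * d) (ch j) + y (j%:R * d) (ch j))// !mxE.
move=> xi /Xspace_sobolev Wx lx.
have x0 (j : nat) : (j < N)%N -> xi (j%:R * d) = 0.
  move=> jN; pose j' := Ordinal jN.
  rewrite (frameE (chP j') (Wx.1 _)) big1// => p _.
  have := lx (enum_rank (j', p)); rewrite /l enum_rankK => ->.
  by rewrite scale0r.
suff H : forall n : nat, (n <= N)%N -> 0 <= h_on 0 (n%:R * d) xi xi.
  by rewrite -Ndt; exact: H.
have dge (n : nat) : 0 <= n%:R * d :> R by rewrite mulr_ge0// ltW.
elim=> [_|n IH nN]; first by rewrite mul0r /h_on Int_aa.
have nn : n%:R * d <= n.+1%:R * d by rewrite ler_pM2r// ler_nat.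
rewrite (h_on_cat Wx Wx (dge n) nn) addr_ge0//; first exact: (IH (ltnW nN)).
apply: (h_on_ge0 _ C0 nn _ Wx (x0 n nN)).
  move=> t v /andP[nt tn] tv; apply: HC => //; rewrite (le_trans (dge n) nt)/=.
  by rewrite -Ndt (le_trans tn)// ler_pM2r// ler_nat.
by rewrite -mulrBl -natrB// subSnn mul1r.
Qed.

Lemma solution_tangent xi t : solution xi -> T t (D xi t).
Proof. by case=> fx dx _ _; exact (D_tangent Dcov fx (dx t)). Qed.

(** Since D (D xi) = U xi, the integrand is the derivative of the pairing of D xi with phi. *)
Lemma solution_by_parts a b xi phi : solution xi -> sobolev phi -> a <= b ->
  h_on a b xi phi = g b (D xi b) (phi b) - g a (D xi a) (phi a).
Proof.
move=> Sx Wp ab; have [_ WDx] := solution_sobolev Dcov Usym Sx.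
have [_ _ _ DD] := Sx.
rewrite (H1_Int (metric_H1 LL gP Dcov Dmet WDx Wp ab) ab).
apply: Int_eq => t _; rewrite -(DD t); exact (addrC _ _).
Qed.

Lemma solution_lin c x y : solution x -> solution y -> solution (c *: x + y).
Proof.
move=> [fx dx dDx Dx] [fy dy dDy Dy].
have fDx t : T t (D x t) by exact (D_tangent Dcov fx (dx t)).
have fDy t : T t (D y t) by exact (D_tangent Dcov fy (dy t)).
have E : D (c *: x + y) = c *: D x + D y.
  by apply/funext => t; exact (D_linear Dcov c fx fy (dx t) (dy t)).
split.
- by move=> t; exact ((tangent_subspace (gamma t)).2 c _ _ (fx t) (fy t)).
- by move=> t; exact (derivable_field_lin (dx t) (dy t)).
- by move=> t; rewrite E; exact (derivable_field_lin (dDx t) (dDy t)).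
move=> t; rewrite E (D_linear Dcov c fDx fDy (dDx t) (dDy t)) Dx Dy.
by rewrite -(U_linear Usym t c Logic.I Logic.I).
Qed.

Lemma D_solution_lin c x y t : solution x -> solution y ->
  D (c *: x + y) t = c *: D x t + D y t.
Proof. by move=> [fx dx _ _] [fy dy _ _]; exact (D_linear Dcov c fx fy (dx t) (dy t)). Qed.

Lemma solution0 : solution 0.
Proof.
have d0 t : derivable_field gamma (0 : field) t by move=> i it; exact: derivable_cst.
have E : D 0 = 0 :> field.
  apply/funext => t; apply/funext => i; have [_ _ ->] := christoffelP Dcov.
  case: asboolP => // _; rewrite (_ : (0 : field) t i = 0)// mulmx0 addr0.
  by rewrite derive1E derive_cst.
split=> [t|t|t|t]; first by have [] := tangent_subspace (gamma t).
- exact: d0.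
- by rewrite E; exact: d0.
rewrite !E; apply/funext => i; have [_ _ ->] := potentialP Usym.
by rewrite (_ : (0 : field) t i = 0)// mulmx0.
Qed.

Lemma solution_comb (I : finType) (c : I -> R) (x : I -> field) :
  (forall i : I, solution (x i)) ->
  solution (\sum_i c i *: x i) /\
  forall t, D (\sum_i c i *: x i) t = \sum_i c i *: D (x i) t.
Proof.
move=> Sx; elim: (index_enum I) => [|i r [S1 S2]].
  rewrite big_nil; split; first exact: solution0.
  move=> t; rewrite big_nil.
  have := D_solution_lin (-1) t solution0 solution0.
  by rewrite scaler0 addr0 scaleN1r addNr.
rewrite big_cons; split; first exact (solution_lin (c i) (Sx i) S1).
by move=> t; rewrite big_cons (D_solution_lin (c i) t (Sx i) S1) S2.
Qed.

(** Uniqueness by an energy estimate: e = |x|^2 + |D x|^2 satisfies |e'| <= (2 + C) e, where C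
    bounds U on [- |t|, |t|], and [gronwall_zero] applies. *)
Lemma solution_zero x : solution x -> x 0 = 0 -> D x 0 = 0 -> x = 0.
Proof.
move=> Sx x0 Dx0; have [fx dx dDx DD] := Sx.
have fD t : T t (D x t) by exact (D_tangent Dcov fx (dx t)).
pose e t := g t (x t) (x t) + g t (D x t) (D x t).
pose de t := (g t (D x t) (x t) + g t (x t) (D x t)) +
   (g t (U t (x t)) (D x t) + g t (D x t) (U t (x t))).
have ge0x t := metric_ge0 LL gP (fx t).
have ge0D t := metric_ge0 LL gP (fD t).
have gb t := metric_symbilinear LL gP t.
have g00 : g 0 0 0 = 0.
  have S0 := tangent_subspace (gamma 0).
  by rewrite (symbil0l S0 (gb 0) (subspace0 S0)).
have H6 (c p q r u v : R) : 0 <= c -> `|2 * p| <= 1 * v + 1^-1 * u -> `|2 * q| <= 1 * r + 1^-1 * v ->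
    r <= c * u -> 0 <= u -> 0 <= v -> `|p + p + (q + q)| <= (2 + c) * (u + v).
  rewrite invr1 !mul1r => c0 Hp Hq ru u0 v0; have cv : 0 <= c * v by exact: mulr_ge0.
  move: Hp Hq; rewrite !ler_norml => /andP[p1 p2] /andP[q1 q2].
  by apply/andP; split; nra.
have H7 (u v : R) : u + v = 0 -> 0 <= v -> 0 < u -> False.
  by move=> uv v0 u0; have := ltr_wpDr v0 u0; rewrite uv ltxx.
have e0 t : e t = 0.
  have tt : - `|t| <= `|t| by exact: le_trans (_ : _ <= 0) (normr_ge0 t); rewrite oppr_le0.
  have [C C0 HC] := U_bound LL gP Dcov Dmet Usym tt.
  apply: (@gronwall_zero _ e de (2 + C) `|t|) => //.
  - move=> s _; apply: is_deriveD_fun; first exact (Dmet fx fx (dx s) (dx s)).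
    by have := Dmet fD fD (dDx s) (dDx s); rewrite DD.
  - move=> s; rewrite ler_norml => sc.
    have UU := HC s _ sc (fx s); have tU := U_tangent Usym (fx s).
    rewrite /de (symbilC (gb s) (fx s) (fD s)) (symbilC (gb s) (fD s) tU).
    have Y1 := metric_young LL gP ltr01 (fD s) (fx s).
    have Y2 := metric_young LL gP ltr01 tU (fD s).
    exact (H6 _ _ _ _ _ _ C0 Y1 Y2 UU (ge0x s) (ge0D s)).
  - by rewrite /e x0 Dx0 g00 addr0.
  - by move=> s; rewrite /e addr_ge0.
apply/funext => t; apply: contrapT => xt.
exact (H7 _ _ (e0 t) (ge0D t) (metric_pos LL gP (fx t) xt)).
Qed.

Lemma solution_unique x y : solution x -> solution y ->
  x 0 = y 0 -> D x 0 = D y 0 -> x = y.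
Proof.
move=> Sx Sy xy Dxy; have E : -1 *: x + y = 0.
  apply: (solution_zero (solution_lin (-1) Sx Sy)).
    by rewrite (_ : (_ *: _ + _) 0 = -1 *: x 0 + y 0)// xy scaleN1r addNr.
  by rewrite (D_solution_lin (-1) 0 Sx Sy) Dxy scaleN1r addNr.
by apply/eqP; rewrite -subr_eq0 -oppr_eq0 opprB addrC -scaleN1r E.
Qed.

Lemma D_shift x t : D (fun s => x (s + tau)) t = D x (t + tau).
Proof.
have [_ gper _] := gP.
apply/funext => i; have [_ per DE] := christoffelP Dcov.
rewrite !DE gper; case: asboolP => // _.
by rewrite per (@derive1_translate _ _ (fun s => x s i) tau t).
Qed.

Lemma solution_shift x : solution x -> solution (fun s => x (s + tau)).
Proof.
have [_ gper _] := gP; move=> [fx dx dDx DD].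
have E : D (fun s => x (s + tau)) = (fun s => D x (s + tau)) by apply/funext => t; exact: D_shift.
have dsh (y : field) t : derivable_field gamma y (t + tau) -> derivable_field gamma (fun s => y (s + tau)) t.
  move=> dy i it; have dyi : derivable (fun s => y s i) (t + tau) 1 by apply: dy; rewrite gper.
  apply: diff_derivable; apply: (@differentiable_comp _ _ _ _ (fun s => s + tau) (fun s => y s i)).
    by apply/derivable1_diffP.
  by apply/derivable1_diffP.
split=> [t|t|t|t].
- by have := fx (t + tau); rewrite gper.
- exact: dsh.
- by rewrite E; exact: dsh.
- rewrite E D_shift DD; apply/funext => i; have [_ per UE] := potentialP Usym.
  by rewrite !UE per.
Qed.

End forms.

(** * Reduction modulo the periodic solutions *)

Section projection.
Context (R : realType) (E : lmodType R) (S : set E) (b : E -> E -> R).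
Hypotheses (SS : subspace S) (bb : symbilinear_on S b)
  (bpos : forall x, S x -> x <> 0 -> 0 < b x x).
Context (k : nat) (z : 'I_k -> E).
Hypotheses (Sz : forall a, S (z a)) (zfree : lin_indep z).

Definition gram_mx : 'M[R]_k := \matrix_(a, c) b (z a) (z c).
Definition coord a v : R := \sum_c invmx gram_mx a c * b (z c) v.
Definition span_proj v : E := \sum_a coord a v *: z a.

Lemma gram_mx_quad (x : 'I_k -> R) : (exists a, x a != 0) ->
  0 < \sum_a \sum_c x a * x c * gram_mx a c.
Proof.
move=> [a0 xa0].
rewrite (_ : \sum_a _ = b (\sum_a x a *: z a) (\sum_a x a *: z a)).
  apply: bpos; first exact: subspace_comb.
  by move=> /zfree/(_ a0)/eqP; rewrite (negbTE xa0).
rewrite (symbil_suml SS bb _ Sz (subspace_comb SS _ Sz)); apply: eq_bigr => a _.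
rewrite (symbil_sumr SS bb _ Sz (Sz a)) mulr_sumr; apply: eq_bigr => c _.
by rewrite mxE mulrA.
Qed.

Lemma gram_mx_unit : gram_mx \in unitmx.
Proof.
rewrite unitmxE unitfE; apply/negP => /det0P[v v0 vG].
have [a va] : exists a, v 0 a != 0 by apply/rV0Pn.
have := gram_mx_quad (ex_intro (fun a => v 0 a != 0) a va).
rewrite exchange_big/= big1 ?ltxx// => c _.
have := congr1 (fun A : 'rV_k => A 0 c) vG; rewrite !mxE => vc.
transitivity (v 0 c * \sum_d v 0 d * gram_mx d c); last by rewrite vc mulr0.
by rewrite mulr_sumr; apply: eq_bigr => d _; rewrite mulrCA mulrA.
Qed.

Lemma gram_mx_sym : gram_mx^T = gram_mx.
Proof. by apply/matrixP => a c; rewrite !mxE (symbilC bb). Qed.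

Lemma inv_gram_mx_sym a c : invmx gram_mx a c = invmx gram_mx c a.
Proof. by rewrite -[in LHS]gram_mx_sym -trmx_inv mxE. Qed.

Lemma inv_gram_mx_quad (x : 'I_k -> R) : (exists a, x a != 0) ->
  0 < \sum_a \sum_c x a * x c * invmx gram_mx a c.
Proof.
move=> [a0 xa0]; pose y a := \sum_c invmx gram_mx a c * x c.
have xE a : x a = \sum_c gram_mx a c * y c.
  have := congr1 (fun A : 'M[R]_k => (A *m (\col_d x d)) a ord0) (mulmxV gram_mx_unit).
  rewrite mul1mx -mulmxA !mxE => <-; apply: eq_bigr => c _; congr (_ * _).
  by rewrite !mxE; apply: eq_bigr => d _; rewrite mxE.
rewrite (_ : \sum_a _ = \sum_a \sum_c y a * y c * gram_mx a c).
  apply: gram_mx_quad; apply: contrapT => /forallNP y0; move: xa0.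
  rewrite xE big1 ?eqxx// => c _; have /negP/negPn/eqP -> := y0 c.
  by rewrite mulr0.
rewrite (eq_bigr (fun a => x a * y a)) => [|a _]; last first.
  by rewrite mulr_sumr; apply: eq_bigr => c _; rewrite -mulrA [x c * _]mulrC.
apply: eq_bigr => a _; rewrite xE mulr_suml; apply: eq_bigr => c _.
by rewrite -mulrA mulrC [y c * _]mulrC.
Qed.

Lemma span_proj_in v : S (span_proj v).
Proof. exact: subspace_comb. Qed.

Lemma coord_lin a : linear_on S (coord a : E -> R^o).
Proof.
move=> c x y Sx Sy; rewrite /coord scaler_sumr -big_split; apply: eq_bigr => d _ /=.
rewrite (symbilDr SS bb (subspaceZ SS c Sx) Sy (Sz d)) (symbilZr SS bb c Sx (Sz d)).
by rewrite mulrDr mulrCA.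
Qed.

Lemma coord_span a (x : 'I_k -> R) : coord a (\sum_c x c *: z c) = x a.
Proof.
rewrite /coord (eq_bigr (fun d => \sum_c invmx gram_mx a d * gram_mx d c * x c)); last first.
  move=> d _; rewrite (symbil_sumr SS bb _ Sz (Sz d)) mulr_sumr.
  by apply: eq_bigr => c _; rewrite mxE [x c * _]mulrC mulrA.
rewrite exchange_big/= (eq_bigr (fun c => (invmx gram_mx *m gram_mx) a c * x c)); last first.
  by move=> c _; rewrite mxE mulr_suml.
rewrite (mulVmx gram_mx_unit) (bigD1 a)//= mxE eqxx mul1r big1 ?addr0// => c ca.
by rewrite mxE eq_sym (negbTE ca) mul0r.
Qed.

Lemma coord0 a v : (forall c, b (z c) v = 0) -> coord a v = 0.
Proof. by move=> v0; rewrite /coord big1// => c _; rewrite v0 mulr0. Qed.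

Lemma span_proj_lin : linear_on S (span_proj : E -> E).
Proof.
move=> c x y Sx Sy; rewrite /span_proj scaler_sumr -big_split; apply: eq_bigr => a _ /=.
have -> : coord a (c *: x + y) = c * coord a x + coord a y by exact: coord_lin.
by rewrite scalerDl scalerA.
Qed.

Lemma span_proj_span (x : 'I_k -> R) : span_proj (\sum_c x c *: z c) = \sum_c x c *: z c.
Proof. by apply: eq_bigr => a _; rewrite coord_span. Qed.

Lemma span_proj0 v : (forall c, b (z c) v = 0) -> span_proj v = 0.
Proof. by move=> v0; rewrite /span_proj big1// => a _; rewrite coord0// scale0r. Qed.

Lemma span_proj_orth a v : S v -> b (z a) (v - span_proj v) = 0.
Proof.
move=> Sv; have Sp := span_proj_in v.
rewrite (symbilDr SS bb Sv (subspaceN SS Sp) (Sz a)) -scaleN1r.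
rewrite (symbilZr SS bb _ Sp (Sz a)) (symbil_sumr SS bb _ Sz (Sz a)).
rewrite (eq_bigr (fun c => \sum_d gram_mx a c * invmx gram_mx c d * b (z d) v)); last first.
  by move=> c _; rewrite mulr_suml; apply: eq_bigr => d _; rewrite mxE -mulrA mulrC mulrA.
rewrite exchange_big/= (eq_bigr (fun d => (gram_mx *m invmx gram_mx) a d * b (z d) v)); last first.
  by move=> c _; rewrite mxE mulr_suml.
rewrite (mulmxV gram_mx_unit) (bigD1 a)//= mxE eqxx mul1r big1 ?addr0 ?mulN1r ?subrr// => c ca.
by rewrite mxE eq_sym (negbTE ca) mul0r.
Qed.

Lemma span_orth (x : 'I_k -> R) v : S v -> (forall a, b (z a) v = 0) ->
  b (\sum_a x a *: z a) v = 0.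
Proof.
move=> Sv v0; rewrite (symbil_suml SS bb _ Sz Sv) big1// => a _.
by rewrite v0 mulr0.
Qed.

Lemma span_proj_quad v : S v ->
  b (span_proj v) (span_proj v) = \sum_a \sum_c invmx gram_mx a c * b (z a) v * b (z c) v.
Proof.
move=> Sv; have Sp := span_proj_in v.
have -> : b (span_proj v) (span_proj v) = b (span_proj v) v.
  apply/eqP; rewrite eq_sym -subr_eq0 -mulN1r -(symbilZr SS bb _ Sp Sp) scaleN1r.
  rewrite -(symbilDr SS bb Sv (subspaceN SS Sp) Sp); apply/eqP.
  by apply: span_orth => [|a]; [exact: subspaceB|exact: span_proj_orth].
rewrite (symbil_suml SS bb _ Sz Sv); apply: eq_bigr => a _.
by rewrite mulr_suml; apply: eq_bigr => c _; rewrite mulrAC.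
Qed.

(** [orth_proj] is a choice in a set of candidates. The Gram formula gives a candidate, and applying
    [span_proj] to v - u shows that every candidate u equals it. *)
Lemma orth_projE v : S v -> orth_proj b S (lin_span z) v = v - span_proj v.
Proof.
move=> Sv; rewrite /orth_proj; set A := (X in xget 0 X).
have Sp := span_proj_in v; have Svp := subspaceB SS Sv Sp.
have Av : A (v - span_proj v).
  split; last by exists (coord ^~ v); rewrite opprB addrC subrK.
  split=> // _ [c ->].
  rewrite (symbilC bb Svp (subspace_comb SS c Sz)).
  by apply: span_orth => // a; exact: span_proj_orth.
have [[Su uo] [c vu]] : A (xget 0 A) by exact: xgetI Av.
move: (xget 0 A) Su uo vu => u Su uo vu.
have oc x a : S x -> orth_compl b S (lin_span z) x -> b (z a) x = 0.
  move=> Sx [_ H]; rewrite (symbilC bb (Sz a) Sx); apply: H.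
  exists (fun c => (c == a)%:R); rewrite (bigD1 a)//= eqxx scale1r big1 ?addr0//.
  by move=> c' /negbTE ->; rewrite scale0r.
have uE : u = v - \sum_a c a *: z a by rewrite -vu opprB addrC subrK.
rewrite uE; congr (_ - _); rewrite -span_proj_span -vu.
have -> : v - u = -1 *: u + v by rewrite scaleN1r addrC.
rewrite span_proj_lin// [span_proj u]span_proj0 ?scaler0 ?add0r// => a.
by apply: oc.
Qed.

Context (dz : 'I_k -> E).
Hypotheses (Sdz : forall a, S (dz a)) (isodz : forall a c, b (dz a) (z c) = b (z a) (dz c)).

Definition conj_proj v : E := \sum_a coord a v *: dz a.

(** The polarization of b(Z, v + (v - span_proj v)), where Z = [conj_proj v] has the coordinates of
    v along the [z a], but carried by the [dz a]. Its symmetry is not visible: it comes from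
    [isodz], through [conj_proj_span_proj]. *)
Definition boundary v w : R := b (conj_proj v) w + b (conj_proj w) (v - span_proj v).

Lemma conj_proj_in v : S (conj_proj v).
Proof. exact: subspace_comb. Qed.

Lemma conj_proj_lin : linear_on S (conj_proj : E -> E).
Proof.
move=> c x y Sx Sy; rewrite /conj_proj scaler_sumr -big_split; apply: eq_bigr => a _ /=.
have -> : coord a (c *: x + y) = c * coord a x + coord a y by exact: coord_lin.
by rewrite scalerDl scalerA.
Qed.

Lemma conj_proj_span_proj v w : b (conj_proj v) (span_proj w) = b (conj_proj w) (span_proj v).
Proof.
have bE u u' : b (conj_proj u) (span_proj u') = \sum_a \sum_c coord a u * (coord c u' * b (dz a) (z c)).
  rewrite (symbil_suml SS bb _ Sdz (span_proj_in u')); apply: eq_bigr => a _.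
  by rewrite -mulr_sumr (symbil_sumr SS bb _ Sz (Sdz a)).
rewrite !bE exchange_big; apply: eq_bigr => a _; apply: eq_bigr => c _.
by rewrite mulrCA isodz (symbilC bb (Sz c) (Sdz a)).
Qed.

Lemma boundary_symbilinear : symbilinear_on S boundary.
Proof.
have BE v w : S v -> S w ->
    boundary v w = b (conj_proj v) w + (b (conj_proj w) v - b (conj_proj w) (span_proj v)).
  move=> Sv Sw; congr (_ + _).
  rewrite (symbilDr SS bb Sv (subspaceN SS (span_proj_in v)) (conj_proj_in w)) -scaleN1r.
  by rewrite (symbilZr SS bb _ (span_proj_in v) (conj_proj_in w)) mulN1r.
split=> [c x y w Sx Sy Sw|x y Sx Sy].
  have Sxy := SS.2 c _ _ Sx Sy.
  rewrite !BE// (conj_proj_lin c Sx Sy) (span_proj_lin c Sx Sy).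
  rewrite (bb.1 c _ _ _ (conj_proj_in x) (conj_proj_in y) Sw).
  have bD u v : S u -> S v -> b (conj_proj w) (c *: u + v) = c * b (conj_proj w) u + b (conj_proj w) v.
    move=> Su Sv; rewrite (symbilDr SS bb (subspaceZ SS c Su) Sv (conj_proj_in w)).
    by rewrite (symbilZr SS bb c Su (conj_proj_in w)).
  rewrite (bD _ _ Sx Sy) (bD _ _ (span_proj_in x) (span_proj_in y)).
  by ring.
by rewrite !BE// (conj_proj_span_proj y x) addrCA.
Qed.

Lemma boundary_span (x : 'I_k -> R) v : S v ->
  boundary (\sum_a x a *: z a) v = b (\sum_a x a *: dz a) v.
Proof.
move=> Sv; rewrite /boundary span_proj_span subrr.
rewrite (symbilC bb (conj_proj_in v) (subspace0 SS)) (symbil0l SS bb (conj_proj_in v)) addr0.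
by congr (b _ v); apply: eq_bigr => a _; rewrite coord_span.
Qed.

End projection.

(* Applied with [xi = z + eta], [z' = a + Z], [Z' = Y + Uz], [d = eta'] and [e]
   the component of [d] along the span of the periodic solutions; the terms
   subtracted are the derivative of [b Z (xi + eta)]. *)
Lemma reduction_identity (R : realType) (E : lmodType R) (S : set E) (b : E -> E -> R)
    (a Z d Uz Ue z eta Y e : E) :
  subspace S -> symbilinear_on S b ->
  S a -> S Z -> S d -> S Uz -> S Ue -> S z -> S eta -> S Y -> S e ->
  b Y z = b a Z -> b a d = - b Y eta -> b a d = b a e -> b Uz eta = b Ue z ->
  b (a + Z + d) (a + Z + d) + b (Uz + Ue) (z + eta)
    - (b (Y + Uz) (z + eta + eta) + b Z (a + Z + d + d)) =
  b d d + b Ue eta - 4 * b e e + b (a + 2 *: e) (a + 2 *: e).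
Proof.
move=> SS bb Sa SZ Sd SUz SUe Sz Seta SY Se Yz ad ae sU.
have SD := subspaceD SS.
have saZ := SD _ _ Sa SZ; have saZd := SD _ _ saZ Sd; have szeta := SD _ _ Sz Seta.
have S2e : S (2 *: e) := subspaceZ SS 2 Se.
have SYU := SD _ _ SY SUz; have SUU := SD _ _ SUz SUe.
rewrite (symbil_quadD SS bb saZ Sd) (symbil_quadD SS bb Sa SZ) (symbil_quadD SS bb Sa S2e).
rewrite (symbilDl bb Sa SZ Sd).
rewrite (symbilDr SS bb szeta Seta SYU) (symbilDr SS bb Sz Seta SYU).
rewrite (symbilDr SS bb Sz Seta SUU) (symbilDr SS bb saZd Sd SZ) (symbilDr SS bb saZ Sd SZ).
rewrite (symbilDr SS bb Sa SZ SZ).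
rewrite (symbilDl bb SUz SUe Sz) (symbilDl bb SUz SUe Seta).
rewrite (symbilDl bb SY SUz Sz) (symbilDl bb SY SUz Seta).
rewrite (symbilC bb SZ Sa) (symbilZr SS bb 2 Se Sa) (symbilZl SS bb 2 Se S2e) (symbilZr SS bb 2 Se Se).
rewrite Yz -ae sU.
have -> : b Y eta = - b a d by rewrite ad opprK.
by ring.
Qed.

Lemma comb_cst (R : realType) (m k : nat) (I : Type) (l : 'I_k -> R)
    (x : 'I_k -> R -> I -> 'cV[R]_m) (t : R) :
  (\sum_a l a *: x a) t = \sum_a l a *: x a t.
Proof.
elim: (index_enum _) => [|a r IH]; first by rewrite !big_nil.
by rewrite !big_cons -IH.
Qed.

Lemma Int_sum (R : realType) (a b : R) (I : Type) (r : seq I) (u : I -> R -> R) :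
  (forall i, L1 a b (u i)) ->
  Int a b (fun t => \sum_(i <- r) u i t) = \sum_(i <- r) Int a b (u i).
Proof.
move=> uL; elim: r => [|i r IH].
  rewrite big_nil (_ : (fun t => _) = fun t => 0 * 0); last first.
    by apply/funext => t; rewrite big_nil mul0r.
  by rewrite (IntZ 0 (L10 a b)) mul0r.
rewrite big_cons -IH -(IntD (uL i) (L1_sum r uL)); congr (Int a b _).
by apply/funext => t; rewrite big_cons.
Qed.

(** * Splitting fields along the periodic solutions *)

Section jacobi.
Context (R : realType) (m : nat) (M : manifold R m) (tau : R)
  (L : M -> (idx M -> 'cV[R]_m) -> R -> R) (gamma : R -> M)
  (D : (R -> idx M -> 'cV[R]_m) -> R -> idx M -> 'cV[R]_m)
  (U : R -> (idx M -> 'cV[R]_m) -> idx M -> 'cV[R]_m).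
Hypotheses (LL : lagrangian_function tau L) (gP : periodic_trajectory tau L gamma)
  (Dcov : covariant_derivative tau gamma D)
  (Dmet : metric_compatible gamma (metric L gamma) D)
  (Usym : symmetric_operator tau gamma (metric L gamma) U)
  (tau_gt0 : 0 < tau).
Notation g := (metric L gamma).
Notation T t := (tangent (gamma t)).
Notation field := (R -> idx M -> 'cV[R]_m).
Notation vec := (idx M -> 'cV[R]_m).
Notation sobolev := (sobolev_field gamma).
Notation solution := (variational_solution gamma D U).
Context (k : nat) (zeta : 'I_k -> field).
Hypotheses (zS : forall a, solution (zeta a))
  (zper : forall a t, zeta a (t + tau) = zeta a t)
  (ziso : forall a b t, g t (D (zeta a) t) (zeta b t) = g t (zeta a t) (D (zeta b) t))
  (zfree : forall t, lin_indep (fun a => zeta a t)).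
Implicit Types (xi eta phi : field) (t : R).

Local Notation ST := (fun t => tangent_subspace (gamma t)).
Local Notation BB := (metric_symbilinear LL gP).

Let BP t (v : vec) : T t v -> v <> 0 -> 0 < g t v v := metric_pos LL gP (v := v).

Lemma z_tangent a t : T t (zeta a t).
Proof. by case: (zS a). Qed.

Lemma Dz_tangent a t : T t (D (zeta a) t).
Proof. exact (solution_tangent Dcov t (zS a)). Qed.

Lemma z_derivable a t : derivable_field gamma (zeta a) t.
Proof. by case: (zS a). Qed.

Lemma Dz_derivable a t : derivable_field gamma (D (zeta a)) t.
Proof. by case: (zS a). Qed.

Lemma z_sobolev a : sobolev (zeta a).
Proof. exact (solution_sobolev Dcov Usym (zS a)).1. Qed.

Lemma Dz_sobolev a : sobolev (D (zeta a)).
Proof. exact (solution_sobolev Dcov Usym (zS a)).2. Qed.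

Definition inv_gram t a b : R := invmx (gram_mx (g t) (fun a => zeta a t)) a b.
Definition jcoord t a (v : vec) : R := coord (g t) (fun a => zeta a t) a v.
Definition jproj t (v : vec) : vec := span_proj (g t) (fun a => zeta a t) v.

Lemma derivable_fields_subspace t :
  subspace [set x : field | field_along gamma x /\ derivable_field gamma x t].
Proof.
split=> [|c x y [fx dx] [fy dy]].
  split=> [s|i it]; first exact (subspace0 (ST s)).
  exact: derivable_cst.
split=> [s|]; first exact ((ST s).2 c _ _ (fx s) (fy s)).
exact (derivable_field_lin dx dy).
Qed.

Lemma D_linear_on t : linear_on
  [set x : field | field_along gamma x /\ derivable_field gamma x t]
  (fun x => D x t : vec).
Proof. by move=> c x y [fx dx] [fy dy]; exact (D_linear Dcov c fx fy dx dy). Qed.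

Definition comb (f : 'I_k -> R -> R) (x : 'I_k -> field) : field :=
  fun t => \sum_a f a t *: x a t.

Lemma comb_sum f x : comb f x = \sum_a (fun t => f a t *: x a t).
Proof. by apply/funext => t; rewrite fct_sumE. Qed.

Lemma comb_sobolev f x : (forall a, sobolev_fun (f a)) -> (forall a, sobolev (x a)) ->
  sobolev (comb f x).
Proof.
move=> Wf Wx; rewrite comb_sum.
apply (subspace_sum (sobolev_subspace gamma)) => a.
exact (sobolev_scale (Wf a) (Wx a)).
Qed.

Lemma comb_D f x t : (forall a, field_along gamma (x a)) ->
  (forall a, derivable (f a) t 1) -> (forall a, derivable_field gamma (x a) t) ->
  derivable_field gamma (comb f x) t /\
  D (comb f x) t = \sum_a derive1 (f a) t *: x a t + \sum_a f a t *: D (x a) t.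
Proof.
move=> fx df dx.
have S a : [set x : field | field_along gamma x /\ derivable_field gamma x t]
    (fun t => f a t *: x a t).
  split=> [s|]; first exact (subspaceZ (ST s) (f a s) (fx a s)).
  exact (D_scale Dcov (fx a) (df a) (dx a)).1.
rewrite comb_sum; split; first exact (subspace_sum (derivable_fields_subspace t) S).2.
have -> := linear_on_sum (derivable_fields_subspace t) (D_linear_on (t := t)) S.
rewrite -big_split; apply: eq_bigr => a _.
exact (D_scale Dcov (fx a) (df a) (dx a)).2.
Qed.

Lemma pairing_derivable x y t : field_along gamma x -> field_along gamma y ->
  derivable_field gamma x t -> derivable_field gamma y t ->
  {for t, continuous (fun s => g s (x s) (y s))}.
Proof.
move=> fx fy dx dy; apply: derivable_continuous_at.
by have [] := Dmet fx fy dx dy.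
Qed.

Lemma inv_gram_C1 a b : C1fun (fun t => inv_gram t a b).
Proof.
apply: (@C1fun_invmx _ _ (fun t => gram_mx (g t) (fun a => zeta a t))) => [t|c d].
  exact (gram_mx_unit (ST t) (BB t) (BP (t := t)) (fun a => z_tangent a t) (@zfree t)).
rewrite (_ : (fun t => _) = (fun t => g t (zeta c t) (zeta d t))); last first.
  by apply/funext => t; rewrite mxE.
apply: (C1fun_is (fun t => Dmet (fun t => z_tangent c t) (fun t => z_tangent d t)
  (@z_derivable c t) (@z_derivable d t))) => t.
exact (continuousD_fun
  (pairing_derivable (Dz_tangent c) (z_tangent d) (@Dz_derivable c t) (@z_derivable d t))
  (pairing_derivable (z_tangent c) (Dz_tangent d) (@z_derivable c t) (@Dz_derivable d t))).
Qed.

Lemma inv_gram_sym t a b : inv_gram t a b = inv_gram t b a.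
Proof. exact (inv_gram_mx_sym (BB t) (fun a => z_tangent a t) a b). Qed.

Definition jcoef xi a t : R := jcoord t a (xi t).
Definition jpart xi : field := comb (jcoef xi) zeta.
(** What remains of D ([jpart xi]) after the terms with derivatives of the coefficients are removed;
    the field Z of the completed square. *)
Definition jconj xi : field := comb (jcoef xi) (fun a => D (zeta a)).
Definition perp xi : field := xi - jpart xi.

Lemma jpartE xi t : jpart xi t = jproj t (xi t).
Proof. by []. Qed.

Lemma perpE xi t : perp xi t = xi t - jproj t (xi t).
Proof. by []. Qed.

Lemma perp_lin xi : perp xi = -1 *: jpart xi + xi.
Proof. by rewrite scaleN1r addrC. Qed.

Lemma jcoef_sobolev xi a : sobolev xi -> sobolev_fun (jcoef xi a).
Proof.
move=> Wx x y xy.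
have H c : exists v, H1 x y (fun t => inv_gram t a c * g t (zeta c t) (xi t)) v.
  have [u Hu] := C1fun_sobolev (inv_gram_C1 a c) xy.
  eexists; exact (H1M xy Hu (metric_H1 LL gP Dcov Dmet (z_sobolev c) Wx xy)).
eexists; exact (H1_sum (index_enum 'I_k) xy (fun c => projT2 (cid (H c)))).
Qed.

Lemma jcoef_derivable xi a t : field_along gamma xi -> derivable_field gamma xi t ->
  derivable (jcoef xi a) t 1.
Proof.
move=> fx dx.
have H c := is_deriveM_fun (C1fun_derive t (inv_gram_C1 a c))
  (Dmet (z_tangent c) fx (@z_derivable c t) dx).
by have [] := is_derive_sum_fun (index_enum 'I_k) H.
Qed.

Lemma jpart_sobolev xi : sobolev xi -> sobolev (jpart xi).
Proof. by move=> Wx; apply: comb_sobolev => a; [exact: jcoef_sobolev|exact: z_sobolev]. Qed.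

Lemma jconj_sobolev xi : sobolev xi -> sobolev (jconj xi).
Proof. by move=> Wx; apply: comb_sobolev => a; [exact: jcoef_sobolev|exact: Dz_sobolev]. Qed.

Lemma perp_sobolev xi : sobolev xi -> sobolev (perp xi).
Proof.
by move=> Wx; rewrite perp_lin; exact ((sobolev_subspace gamma).2 _ _ _ (jpart_sobolev Wx) Wx).
Qed.

Lemma perp_orth xi a t : T t (xi t) -> g t (zeta a t) (perp xi t) = 0.
Proof.
exact (@span_proj_orth _ _ _ _ (ST t) (BB t) (BP (t := t)) _ _ (fun a => z_tangent a t)
  (@zfree t) a (xi t)).
Qed.

Lemma orth_derive eta a t : field_along gamma eta ->
  (forall s, g s (zeta a s) (eta s) = 0) -> derivable_field gamma eta t ->
  g t (zeta a t) (D eta t) = - g t (D (zeta a) t) (eta t).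
Proof.
move=> fe e0 de.
have H := Dmet (z_tangent a) fe (@z_derivable a t) de.
have E : (fun s : R => g s (zeta a s) (eta s)) = (fun=> 0) by apply/funext.
rewrite E in H.
have := is_derive_unique H (is_derive_cst (0 : R) t (1 : R)).
by move=> /eqP; rewrite addrC addr_eq0 => /eqP.
Qed.

(* For [eta] orthogonal to the [zeta a] one has
   [g (zeta a) (D eta) = - g (D (zeta a)) eta], so that [cross] is the square of
   the component of [D eta] along the [zeta a]; unlike the latter it is
   continuous in [t]. *)
Definition cross eta t : R :=
  \sum_a \sum_b inv_gram t a b * g t (D (zeta a) t) (eta t) * g t (D (zeta b) t) (eta t).

Definition reduced_integrand eta t : R :=
  g t (D eta t) (D eta t) + g t (U t (eta t)) (eta t) - 4 * cross eta t.

(** For [eta] orthogonal to the [zeta a], the numbers - [slope eta a t] are the coordinates of the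
    F_t-component of [D eta] (see [jproj_D]). This expression contains no derivative of [eta], so it
    is continuous in t and has continuously differentiable primitives. *)
Definition slope eta a t : R := \sum_b inv_gram t a b * g t (D (zeta b) t) (eta t).

Definition defect xi t : vec :=
  \sum_a (derive1 (jcoef xi a) t + 2 * - slope (perp xi) a t) *: zeta a t.

Lemma jproj_D eta t : field_along gamma eta -> derivable_field gamma eta t ->
  (forall a s, g s (zeta a s) (eta s) = 0) ->
  jproj t (D eta t) = \sum_a - slope eta a t *: zeta a t /\
  g t (jproj t (D eta t)) (jproj t (D eta t)) = cross eta t.
Proof.
move=> fe de e0; split.
  apply: eq_bigr => a _; congr (_ *: _); rewrite /coord /slope -sumrN.
  by apply: eq_bigr => b _; rewrite (orth_derive fe (e0 b) de) mulrN.
have -> := @span_proj_quad _ _ _ _ (ST t) (BB t) (BP (t := t)) _ _ (fun a => z_tangent a t)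
  (@zfree t) _ (D_tangent Dcov fe de).
apply: eq_bigr => a _; apply: eq_bigr => b _.
rewrite (orth_derive fe (e0 a) de) (orth_derive fe (e0 b) de).
by rewrite !mulrN mulNr opprK.
Qed.

(** The instance of [reduction_identity] at a time where [xi] is derivable; what is subtracted on
    the left is the derivative of the pairing of [jconj xi] with [xi + perp xi]. *)
Lemma reduction_pointwise xi t : field_along gamma xi -> derivable_field gamma xi t ->
  g t (D xi t) (D xi t) + g t (U t (xi t)) (xi t)
  - (g t (D (jconj xi) t) ((xi + perp xi) t) + g t (jconj xi t) (D (xi + perp xi) t)) =
  reduced_integrand (perp xi) t + g t (defect xi t) (defect xi t).
Proof.
move=> fx dx.
have dco a := @jcoef_derivable xi a t fx dx.
have fzf : field_along gamma (jpart xi).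
  by move=> s; exact (subspace_comb (ST s) _ (fun a => z_tangent a s)).
have [dzf Dzf] := comb_D z_tangent dco (fun a => @z_derivable a t).
have [dZf DZf] := comb_D Dz_tangent dco (fun a => @Dz_derivable a t).
have [fe de] : field_along gamma (perp xi) /\ derivable_field gamma (perp xi) t.
  rewrite perp_lin; exact ((derivable_fields_subspace t).2 _ _ _ (conj fzf dzf) (conj fx dx)).
have e0 a s : g s (zeta a s) (perp xi s) = 0 by exact: perp_orth.
have [eE eq] := jproj_D fe de e0.
pose A : vec := \sum_a derive1 (jcoef xi a) t *: zeta a t.
pose Y : vec := \sum_a derive1 (jcoef xi a) t *: D (zeta a) t.
have tA : T t A by exact (subspace_comb (ST t) _ (fun a => z_tangent a t)).
have tY : T t Y by exact (subspace_comb (ST t) _ (fun a => Dz_tangent a t)).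
have tZ : T t (jconj xi t) by exact (subspace_comb (ST t) _ (fun a => Dz_tangent a t)).
have tz : T t (jpart xi t) by exact: fzf.
have td : T t (D (perp xi) t) := D_tangent Dcov fe de.
have tp : T t (jproj t (D (perp xi) t)).
  exact (subspace_comb (ST t) _ (fun a => z_tangent a t)).
have xE : xi t = jpart xi t + perp xi t by rewrite perpE jpartE addrC subrK.
have xE' : xi = 1 *: jpart xi + perp xi by rewrite scale1r addrC subrK.
have DxE : D xi t = A + jconj xi t + D (perp xi) t.
  rewrite [in LHS]xE' (D_linear Dcov 1 fzf fe dzf de) scale1r.
  by rewrite Dzf.
have xpE : (xi + perp xi) t = jpart xi t + perp xi t + perp xi t by rewrite -xE.
have DxpE : D (xi + perp xi) t = A + jconj xi t + D (perp xi) t + D (perp xi) t.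
  rewrite -DxE; have := D_linear Dcov 1 fx fe dx de.
  by rewrite !scale1r.
(* The variational equation enters here: D (D (zeta a)) = U (zeta a). *)
have DZE : D (jconj xi) t = Y + U t (jpart xi t).
  rewrite DZf; congr (_ + _).
  have -> := linear_on_comb (subspaceT _) (U_linear Usym t) (fun a => jcoef xi a t)
    (e := fun a => zeta a t) (fun a => Logic.I).
  by apply: eq_bigr => a _; have [_ _ _ ->] := zS a.
have UE : U t (xi t) = U t (jpart xi t) + U t (perp xi t).
  rewrite xE; exact (linear_onD (U_linear Usym t) Logic.I Logic.I).
pose f' a := derive1 (jcoef xi a) t; pose f a := jcoef xi a t.
have E1 a : g t (D (zeta a) t) (jpart xi t) = \sum_b f b * g t (D (zeta a) t) (zeta b t) :=
  symbil_sumr (ST t) (BB t) f (fun b => z_tangent b t) (Dz_tangent a t).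
have E2 a : g t (zeta a t) (jconj xi t) = \sum_b f b * g t (zeta a t) (D (zeta b) t) :=
  symbil_sumr (ST t) (BB t) f (fun b => Dz_tangent b t) (z_tangent a t).
have E12 a : g t (D (zeta a) t) (jpart xi t) = g t (zeta a t) (jconj xi t).
  rewrite (E1 a) (E2 a); apply: eq_bigr => b _.
  exact (f_equal (fun x => f b * x) (ziso a b t)).
(* The four relations asked by [reduction_identity]: [Yz] is the symmetry [ziso]; [Ad] is the
   differentiated orthogonality of [zeta a] and [perp xi]; [Ae] holds because A lies in the span of
   the [zeta a t]; [Us] is the symmetry of U and of the metric. *)
have Yz : g t Y (jpart xi t) = g t A (jconj xi t).
  have F1 : g t Y (jpart xi t) = \sum_a f' a * g t (D (zeta a) t) (jpart xi t) :=
    symbil_suml (ST t) (BB t) f' (fun a => Dz_tangent a t) tz.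
  have F2 : g t A (jconj xi t) = \sum_a f' a * g t (zeta a t) (jconj xi t) :=
    symbil_suml (ST t) (BB t) f' (fun a => z_tangent a t) tZ.
  rewrite F1 F2; apply: eq_bigr => a _.
  exact (f_equal (fun x => f' a * x) (E12 a)).
have Ad : g t A (D (perp xi) t) = - g t Y (perp xi t).
  have F1 : g t A (D (perp xi) t) = \sum_a f' a * g t (zeta a t) (D (perp xi) t) :=
    symbil_suml (ST t) (BB t) f' (fun a => z_tangent a t) td.
  have F2 : g t Y (perp xi t) = \sum_a f' a * g t (D (zeta a) t) (perp xi t) :=
    symbil_suml (ST t) (BB t) f' (fun a => Dz_tangent a t) (fe t).
  rewrite F1 F2 -sumrN; apply: eq_bigr => a _.
  exact (etrans (f_equal (fun x => f' a * x) (orth_derive fe (e0 a) de)) (mulrN _ _)).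
have Ae : g t A (D (perp xi) t) = g t A (jproj t (D (perp xi) t)).
  apply/eqP; rewrite -subr_eq0 -mulN1r -(symbilZr (ST t) (BB t) _ tp tA) scaleN1r.
  rewrite -(symbilDr (ST t) (BB t) td (subspaceN (ST t) tp) tA); apply/eqP.
  apply (span_orth (ST t) (BB t) (fun a => z_tangent a t)).
    exact (subspaceB (ST t) td tp).
  move=> a; exact (@span_proj_orth _ _ _ _ (ST t) (BB t) (BP (t := t)) _ _ (fun a => z_tangent a t)
    (@zfree t) a _ td).
have Us : g t (U t (jpart xi t)) (perp xi t) = g t (U t (perp xi t)) (jpart xi t).
  exact (etrans (U_sym Usym tz (fe t)) (symbilC (BB t) tz (U_tangent Usym (fe t)))).
have pE : defect xi t = A + 2 *: jproj t (D (perp xi) t).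
  rewrite eE scaler_sumr -big_split; apply: eq_bigr => a _.
  by rewrite scalerDl scalerA.
rewrite xpE DxpE DZE pE UE DxE xE /reduced_integrand -eq.
exact (reduction_identity (ST t) (BB t) tA tZ td (U_tangent Usym tz)
  (U_tangent Usym (fe t)) tz (fe t) tY tp Yz Ad Ae Us).
Qed.

Local Notation h_on := (h_on L gamma D U).

Lemma jcoord_lin t a : linear_on (T t) (jcoord t a : vec -> R^o).
Proof. exact (coord_lin (ST t) (BB t) (fun a => z_tangent a t) a). Qed.

Lemma jproj_lin t : linear_on (T t) (jproj t).
Proof. exact (span_proj_lin (ST t) (BB t) (fun a => z_tangent a t)). Qed.

Lemma jproj_tangent t v : T t (jproj t v).
Proof. exact (subspace_comb (ST t) _ (fun a => z_tangent a t)). Qed.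

Definition end_form t (v w : vec) : R :=
  boundary (g t) (fun a => zeta a t) (fun a => D (zeta a) t) v w.

Lemma end_form_symbilinear t : symbilinear_on (T t) (end_form t).
Proof.
exact (boundary_symbilinear (ST t) (BB t) (fun a => z_tangent a t)
  (fun a => Dz_tangent a t) (fun a c => ziso a c t)).
Qed.

Lemma jcoord_span t a (x : 'I_k -> R) : jcoord t a (\sum_c x c *: zeta c t) = x a.
Proof.
exact (coord_span (ST t) (BB t) (BP (t := t)) (fun a => z_tangent a t) (@zfree t) a x).
Qed.

Lemma end_form_span t (x : 'I_k -> R) v : T t v ->
  end_form t (\sum_a x a *: zeta a t) v = g t (\sum_a x a *: D (zeta a) t) v.
Proof.
exact (boundary_span (ST t) (BB t) (BP (t := t)) (fun a => z_tangent a t) (@zfree t)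
  (fun a => Dz_tangent a t) x (v := v)).
Qed.

(* The end terms vanish on periodic fields. Subtracting them completes the
   square in [h_jump_quad] and makes the solutions with the data [q a]
   orthogonal to the periodic fields. *)
Definition h_jump xi phi : R :=
  h_on 0 tau xi phi - (end_form tau (xi tau) (phi tau) - end_form 0 (xi 0) (phi 0)).

Lemma h_jump_symbilinear : symbilinear_on sobolev h_jump.
Proof.
have [hl hs] := h_on_symbilinear LL gP Dcov Dmet Usym (ltW tau_gt0).
have [b0l b0s] := end_form_symbilinear 0; have [btl bts] := end_form_symbilinear tau.
have H (c p q r p' q' r' : R) : c * p + p' - (c * q + q' - (c * r + r')) =
    c * (p - (q - r)) + (p' - (q' - r')) by clear; ring.
split=> [c x y z Wx Wy Wz|x y Wx Wy]; rewrite /h_jump.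
  rewrite (hl c x y z Wx Wy Wz).
  rewrite (btl c _ _ _ (Wx.1 tau) (Wy.1 tau) (Wz.1 tau)).
  rewrite (b0l c _ _ _ (Wx.1 0) (Wy.1 0) (Wz.1 0)).
  exact (H _ _ _ _ _ _ _).
rewrite (hs x y Wx Wy) (bts _ _ (Wx.1 tau) (Wy.1 tau)) (b0s _ _ (Wx.1 0) (Wy.1 0)).
by [].
Qed.

(** The end terms of [h_jump] are the increment over [0, tau] of the pairing of [jconj xi] with
    [xi + perp xi], a Sobolev function by [metric_H1]. So [reduction_pointwise], valid almost
    everywhere, can be integrated. *)
Lemma h_jump_quad xi : sobolev xi ->
  L1 0 tau (fun t => reduced_integrand (perp xi) t + g t (defect xi t) (defect xi t)) /\
  h_jump xi xi = Int 0 tau (fun t => reduced_integrand (perp xi) t + g t (defect xi t) (defect xi t)).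
Proof.
move=> Wx; have Wp := perp_sobolev Wx; have t0 := ltW tau_gt0.
have WZ := jconj_sobolev Wx.
have Wxp : sobolev (xi + perp xi) := subspaceD (sobolev_subspace gamma) Wx Wp.
have H := metric_H1 LL gP Dcov Dmet WZ Wxp t0.
have [Lu1 Lu2] := h_on_L1 LL gP Dcov Dmet Usym Wx Wx t0.
have Lu := L1D Lu1 Lu2; have Lv := L2_L1 H.1.
have uv := aeonS (fun t _ dx => reduction_pointwise Wx.1 dx) (sobolev_ae_derivable gP Dcov Wx t0).
split; first exact (L1_ae uv (L1B Lu Lv)).
rewrite -(Int_ae uv) (IntB Lu Lv) /h_jump.
have BE t : end_form t (xi t) (xi t) = g t (jconj xi t) ((xi + perp xi) t).
  symmetry; exact (symbilDr (ST t) (BB t) (Wx.1 t) (Wp.1 t) (WZ.1 t)).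
congr (_ - _); rewrite (BE tau) (BE 0).
exact (H1_Int H t0).
Qed.

Lemma g_periodic t v w : T t v -> T t w -> g (t + tau) v w = g t v w.
Proof. exact: (metric_periodic LL gP). Qed.

Lemma Dz_periodic a t : D (zeta a) (t + tau) = D (zeta a) t.
Proof.
rewrite -(D_shift gP Dcov); congr (D _ t); apply/funext => s; exact: zper.
Qed.

Lemma inv_gram_periodic a b t : inv_gram (t + tau) a b = inv_gram t a b.
Proof.
have E : gram_mx (g (t + tau)) (fun a => zeta a (t + tau)) = gram_mx (g t) (fun a => zeta a t).
  have -> : (fun a => zeta a (t + tau)) = (fun a => zeta a t) by apply/funext.
  rewrite /gram_mx; apply: eq_mx => c d.
  exact (g_periodic (z_tangent c t) (z_tangent d t)).
exact (f_equal (fun A : 'M[R]_k => invmx A a b) E).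
Qed.

Lemma jcoord_periodic a t v : T t v -> jcoord (t + tau) a v = jcoord t a v.
Proof.
move=> tv; apply: eq_bigr => b _.
have gE : g (t + tau) (zeta b (t + tau)) v = g t (zeta b t) v.
  by rewrite zper; exact (g_periodic (z_tangent b t) tv).
exact (f_equal2 (fun x y => x * y) (inv_gram_periodic a b t) gE).
Qed.

Definition jump xi (l : 'I_k -> R) := forall t, xi (t + tau) = xi t + \sum_a l a *: zeta a t.

Definition quasi_periodic : set field := [set xi | sobolev xi /\ exists l, jump xi l].

Lemma quasi_periodic_sobolev xi : quasi_periodic xi -> sobolev xi.
Proof. by case. Qed.

Lemma quasi_periodic_subspace : subspace quasi_periodic.
Proof.
have [S0 SD] := sobolev_subspace gamma.
split=> [|c x y [Wx [l xl]] [Wy [l' yl]]]; (split; first by [exact: S0|exact: SD]).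
  by exists (fun=> 0) => t; rewrite big1 ?addr0// => a _; rewrite scale0r.
exists (fun a => c * l a + l' a) => t.
rewrite (_ : (c *: x + y) (t + tau) = c *: x (t + tau) + y (t + tau))// xl yl.
rewrite (_ : (c *: x + y) t = c *: x t + y t)// scalerDr addrACA; congr (_ + _).
rewrite scaler_sumr -big_split; apply: eq_bigr => a _.
by rewrite scalerDl scalerA.
Qed.

Lemma jcoef_jump xi l a t : field_along gamma xi -> jump xi l ->
  jcoef xi a (t + tau) = jcoef xi a t + l a.
Proof.
move=> fx xl; rewrite /jcoef xl.
have tl : T t (\sum_a l a *: zeta a t) by exact (subspace_comb (ST t) l (fun a => z_tangent a t)).
rewrite (jcoord_periodic a (subspaceD (ST t) (fx t) tl)).
have -> := linear_onD (@jcoord_lin t a) (fx t) tl.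
by rewrite jcoord_span.
Qed.

(** The jump lies in F_t, where the projection removes it. *)
Lemma perp_periodic xi l t : field_along gamma xi -> jump xi l -> perp xi (t + tau) = perp xi t.
Proof.
move=> fx xl; rewrite /perp.
rewrite (_ : (xi - jpart xi) (t + tau) = xi (t + tau) - jpart xi (t + tau))//.
rewrite (_ : (xi - jpart xi) t = xi t - jpart xi t)// xl.
have -> : jpart xi (t + tau) = jpart xi t + \sum_a l a *: zeta a t.
  rewrite /jpart /comb -big_split; apply: eq_bigr => a _.
  by rewrite (jcoef_jump a t fx xl) zper scalerDl.
by rewrite opprD addrACA subrr addr0.
Qed.

Lemma perp_Xperp xi : quasi_periodic xi -> Xperp tau gamma g zeta (perp xi).
Proof.
move=> [Wx [l xl]]; have Wp := perp_sobolev Wx; split.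
  by apply/XspaceE; split=> // t; exact: (perp_periodic t Wx.1 xl).
move=> t; split; first exact: Wp.1.
move=> _ [c ->].
rewrite (symbilC (BB t) (Wp.1 t) (subspace_comb (ST t) c (fun a => z_tangent a t))).
apply (span_orth (ST t) (BB t) (fun a => z_tangent a t) c (Wp.1 t)) => a.
exact (perp_orth a (Wx.1 t)).
Qed.

Lemma Xperp_orth eta a t : Xperp tau gamma g zeta eta -> g t (zeta a t) (eta t) = 0.
Proof.
move=> [[fe _ _] oe]; have [_ H] := oe t.
rewrite (symbilC (BB t) (z_tangent a t) (fe t)); apply: H.
exists (fun c => (c == a)%:R); rewrite (bigD1 a)//= eqxx scale1r big1 ?addr0//.
by move=> c /negbTE ->; rewrite scale0r.
Qed.

Lemma Xperp_sobolev eta : Xperp tau gamma g zeta eta -> sobolev eta.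
Proof. by case=> /Xspace_sobolev. Qed.

Lemma perp_linear_on : linear_on quasi_periodic perp.
Proof.
move=> c x y [Wx _] [Wy _]; apply/funext => t.
rewrite (_ : (c *: perp x + perp y) t = c *: perp x t + perp y t)// !perpE.
rewrite (_ : (c *: x + y) t = c *: x t + y t)// (jproj_lin c (Wx.1 t) (Wy.1 t)).
by rewrite opprD addrACA scalerBr.
Qed.

Lemma DperpE x t : field_along gamma x -> derivable_field gamma x t ->
  Dperp gamma g D zeta x t = D x t - jproj t (D x t).
Proof.
move=> fx dx; exact (orth_projE (ST t) (BB t) (BP (t := t)) (fun a => z_tangent a t)
  (@zfree t) (D_tangent Dcov fx dx)).
Qed.

(** Two changes turn the integrand into [reduced_integrand]: |D^perp eta|^2 is |D eta|^2 minus
    [cross], and D^perp zeta^a may be replaced by D zeta^a in pairings with [eta], which is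
    orthogonal to F_t. One [cross] plus three make four. *)
Lemma hperpE eta : Xperp tau gamma g zeta eta ->
  hperp tau gamma g D U zeta eta eta = Int 0 tau (reduced_integrand eta).
Proof.
move=> Xe; have We := Xperp_sobolev Xe; rewrite /hperp -IntE.
apply: Int_ae.
apply: aeonS (sobolev_ae_derivable gP Dcov We (ltW tau_gt0)) => t _ de.
have e0 a s := Xperp_orth a s Xe.
have [pE pq] := jproj_D We.1 de e0.
have td := D_tangent Dcov We.1 de; have tp := jproj_tangent t (D eta t).
have tn := subspaceB (ST t) td tp.
have orthF (v : vec) : T t v -> (forall a, g t (zeta a t) v = 0) ->
    forall w, g t v (jproj t w) = 0.
  move=> tv v0 w; rewrite (symbilC (BB t) tv (jproj_tangent t w)).
  exact (span_orth (ST t) (BB t) (fun a => z_tangent a t) _ tv v0).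
rewrite (DperpE We.1 de).
have -> : g t (D eta t - jproj t (D eta t)) (D eta t - jproj t (D eta t)) =
    g t (D eta t) (D eta t) - cross eta t.
  have nF := orthF _ tn (fun a => span_proj_orth (ST t) (BB t) (BP (t := t))
    (fun a => z_tangent a t) (@zfree t) a td) (D eta t).
  have H (p q r s c : R) : p = q + 2 * r + s -> r = 0 -> s = c -> q = p - c.
    by move=> -> -> ->; rewrite mulr0 addr0 addrK.
  have qE := etrans (f_equal (fun v => g t v v) (esym (subrK (jproj t (D eta t)) (D eta t))))
    (symbil_quadD (ST t) (BB t) tn tp).
  exact (H _ _ _ _ _ qE nF pq).
have cE a : g t (eta t) (Dperp gamma g D zeta (zeta a) t) = g t (D (zeta a) t) (eta t).
  have tDz := Dz_tangent a t; have tpz := jproj_tangent t (D (zeta a) t).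
  rewrite (DperpE (fun t => z_tangent a t) (@z_derivable a t)).
  rewrite (symbilDr (ST t) (BB t) tDz (subspaceN (ST t) tpz) (We.1 t)) -scaleN1r.
  rewrite (symbilZr (ST t) (BB t) (-1) tpz (We.1 t)).
  rewrite (orthF _ (We.1 t) (fun a => e0 a t) _) mulr0 addr0.
  exact (symbilC (BB t) (We.1 t) tDz).
have -> : \sum_a \sum_b invmx (gram g zeta t) a b *
    g t (eta t) (Dperp gamma g D zeta (zeta a) t) * g t (eta t) (Dperp gamma g D zeta (zeta b) t)
    = cross eta t.
  by apply: eq_bigr => a _; apply: eq_bigr => b _; rewrite !cE.
have H (p q r : R) : p - r + q - 3 * r = p + q - 4 * r.
  by clear; ring.
exact (H _ _ _).
Qed.

Lemma cont_at_loc (f : R -> R) t : (forall x y, x <= y -> cont_on x y f) -> {for t, continuous f}.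
Proof.
move=> H; have lt : t - 1 < t + 1 by rewrite ltrBlDr -addrA ltrDl.
apply: (within_continuous_continuous lt (H _ _ (ltW lt))).
by rewrite in_itv /= ltrBlDr ltrDl ltr01.
Qed.

Lemma Dz_pairing_cont eta a : sobolev eta -> continuous (fun t => g t (D (zeta a) t) (eta t)).
Proof.
move=> We t; apply: cont_at_loc => x y xy.
exact (H1_cont xy (metric_H1 LL gP Dcov Dmet (Dz_sobolev a) We xy)).
Qed.

Lemma slope_cont eta a : sobolev eta -> continuous (slope eta a).
Proof.
move=> We t; apply: continuous_sum_fun => b.
exact (continuousM_fun (C1fun_cont (inv_gram_C1 a b) (x := t)) (@Dz_pairing_cont eta b We t)).
Qed.

Lemma slope_periodic eta a t : Xspace tau gamma eta -> slope eta a (t + tau) = slope eta a t.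
Proof.
move=> [fe pe _]; apply: eq_bigr => b _.
have gE : g (t + tau) (D (zeta b) (t + tau)) (eta (t + tau)) = g t (D (zeta b) t) (eta t).
  by rewrite pe Dz_periodic; exact (g_periodic (Dz_tangent b t) (fe t)).
exact (f_equal2 (fun x y => x * y) (inv_gram_periodic a b t) gE).
Qed.

Lemma slope_lin a t c x y : field_along gamma x -> field_along gamma y ->
  slope (c *: x + y) a t = c * slope x a t + slope y a t.
Proof.
move=> fx fy; rewrite /slope mulr_sumr -big_split; apply: eq_bigr => b _ /=.
have H (p q r s : R) : q = c * r + s -> p * q = c * (p * r) + p * s.
  by move=> ->; rewrite mulrDr mulrCA.
apply: H.
exact (etrans (symbilDr (ST t) (BB t) (subspaceZ (ST t) c (fx t)) (fy t) (Dz_tangent b t))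
  (f_equal (fun r => r + _) (symbilZr (ST t) (BB t) c (fx t) (Dz_tangent b t)))).
Qed.

Lemma cross_L1 eta : sobolev eta -> L1 0 tau (cross eta).
Proof.
move=> We; apply: L1_sum => a; apply: L1_sum => b; apply: cont_on_L1.
apply: cont_on_at => t _.
have ca := @Dz_pairing_cont eta a We t; have cb := @Dz_pairing_cont eta b We t.
exact (continuousM_fun (continuousM_fun (C1fun_cont (inv_gram_C1 a b) (x := t)) ca) cb).
Qed.

Lemma reduced_integrand_L1 eta : sobolev eta -> L1 0 tau (reduced_integrand eta).
Proof.
move=> We; have [L1 L2] := h_on_L1 LL gP Dcov Dmet Usym We We (ltW tau_gt0).
exact (L1B (L1D L1 L2) (L1Z 4 (cross_L1 We))).
Qed.

Lemma hperp_le xi : quasi_periodic xi -> hperp tau gamma g D U zeta (perp xi) (perp xi) <= h_jump xi xi.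
Proof.
move=> Xx; have Wx := quasi_periodic_sobolev Xx.
rewrite (hperpE (perp_Xperp Xx)); have [Lq ->] := h_jump_quad Wx.
apply: (Int_le (reduced_integrand_L1 (perp_sobolev Wx)) Lq); apply: aeonT => t _.
have := metric_ge0 LL gP (subspace_comb (ST t)
  (fun a => derive1 (jcoef xi a) t + 2 * - slope (perp xi) a t) (fun a => z_tangent a t)).
have H (p q : R) : 0 <= q -> p <= p + q by rewrite lerDl.
exact (H _ _).
Qed.

(* Chosen so that the defect of the lift vanishes; the coefficients are periodic
   only up to constants, whence the space [quasi_periodic]. *)
Definition lift_coef eta a : R -> R := primitive (fun t => 2 * slope eta a t).

Definition lift eta : field := eta + comb (lift_coef eta) zeta.

Lemma lift_slope_cont eta a : sobolev eta -> continuous (fun t => 2 * slope eta a t).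
Proof.
move=> We t; exact (continuousM_fun (cvg_cst _) (@slope_cont eta a We t)).
Qed.

Lemma lift_sobolev eta : sobolev eta -> sobolev (lift eta).
Proof.
move=> We; apply (subspaceD (sobolev_subspace gamma) We).
apply: comb_sobolev => a; last exact: z_sobolev.
exact (C1fun_sobolev (primitive_C1 (@lift_slope_cont eta a We))).
Qed.

Lemma lift_quasi_periodic eta : Xspace tau gamma eta -> quasi_periodic (lift eta).
Proof.
move=> Xe; have We := Xspace_sobolev Xe; have [_ pe _] := Xe.
split; first exact: lift_sobolev.
exists (fun a => lift_coef eta a tau) => t.
rewrite (_ : lift eta (t + tau) = eta (t + tau) + comb (lift_coef eta) zeta (t + tau))//.
rewrite (_ : lift eta t = eta t + comb (lift_coef eta) zeta t)// pe -addrA; congr (_ + _).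
rewrite /comb -big_split; apply: eq_bigr => a _; rewrite zper /=.
have -> : lift_coef eta a (t + tau) = lift_coef eta a t + lift_coef eta a tau.
  apply: (primitive_periodic (@lift_slope_cont eta a We)) => s.
  exact (f_equal (fun r => 2 * r) (slope_periodic a s Xe)).
by rewrite scalerDl.
Qed.

Lemma lift_jcoef eta a : Xperp tau gamma g zeta eta -> jcoef (lift eta) a = lift_coef eta a.
Proof.
move=> Xe; have We := Xperp_sobolev Xe; apply/funext => t.
have tl : T t (comb (lift_coef eta) zeta t) by exact (subspace_comb (ST t) _ (fun a => z_tangent a t)).
rewrite /jcoef (linear_onD (@jcoord_lin t a) (We.1 t) tl).
have -> : jcoord t a (eta t) = 0 by apply: coord0 => b; exact (Xperp_orth b t Xe).
by rewrite add0r jcoord_span.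
Qed.

Lemma lift_perp eta : Xperp tau gamma g zeta eta -> perp (lift eta) = eta.
Proof.
move=> Xe; apply/funext => t.
have E : jpart (lift eta) = comb (lift_coef eta) zeta.
  by apply/funext => s; apply: eq_bigr => a _; rewrite (lift_jcoef a Xe).
by rewrite /perp E /lift addrK.
Qed.

Lemma lift_defect eta t : Xperp tau gamma g zeta eta -> defect (lift eta) t = 0.
Proof.
move=> Xe; have We := Xperp_sobolev Xe; rewrite /defect big1// => a _.
rewrite (lift_perp Xe) (lift_jcoef a Xe).
have -> : derive1 (lift_coef eta a) t = 2 * slope eta a t.
  by rewrite derive1E; have [_ ->] := @primitive_derive _ _ t (@lift_slope_cont eta a We).
by rewrite mulrN subrr scale0r.
Qed.

Lemma h_jump_lift eta : Xperp tau gamma g zeta eta ->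
  h_jump (lift eta) (lift eta) = hperp tau gamma g D U zeta eta eta.
Proof.
move=> Xe; have We := Xperp_sobolev Xe.
rewrite (hperpE Xe); have [_ ->] := h_jump_quad (lift_sobolev We).
apply: Int_eq => t _; rewrite (lift_perp Xe) (lift_defect t Xe).
rewrite (symbil0l (ST t) (BB t) (subspace0 (ST t))).
exact (addr0 _).
Qed.

Lemma Xperp_subspace : subspace (Xperp tau gamma g zeta).
Proof.
have [X0 XD] := Xspace_subspace tau gamma.
split=> [|c x y Xx Xy].
  split=> // t; split; first exact (subspace0 (ST t)).
  move=> _ [c ->].
  exact (symbil0l (ST t) (BB t) (subspace_comb (ST t) c (fun a => z_tangent a t))).
split; first exact (XD c x y Xx.1 Xy.1).
have fx := (Xperp_sobolev Xx).1; have fy := (Xperp_sobolev Xy).1.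
move=> t; split; first exact ((ST t).2 c _ _ (fx t) (fy t)).
move=> v Fv; have [[_ ox] [_ oy]] := (Xx.2 t, Xy.2 t).
have tv : T t v.
  by case: Fv => d ->; exact (subspace_comb (ST t) d (fun a => z_tangent a t)).
have := (BB t).1 c _ _ _ (fx t) (fy t) tv.
by rewrite ox// oy// mulr0 addr0.
Qed.

Lemma lift_linear_on : linear_on (Xperp tau gamma g zeta) lift.
Proof.
move=> c x y Xx Xy; have Wx := Xperp_sobolev Xx; have Wy := Xperp_sobolev Xy.
rewrite /lift scalerDr addrACA; congr (_ + _); apply/funext => t.
rewrite (_ : (c *: comb (lift_coef x) zeta + comb (lift_coef y) zeta) t =
  c *: comb (lift_coef x) zeta t + comb (lift_coef y) zeta t)//.
rewrite /comb scaler_sumr -big_split; apply: eq_bigr => a _ /=.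
have -> : lift_coef (c *: x + y) a t = c * lift_coef x a t + lift_coef y a t.
  rewrite /lift_coef -(primitive_lin c (@lift_slope_cont x a Wx) (@lift_slope_cont y a Wy)).
  congr (primitive _ t); apply/funext => s; rewrite (slope_lin a s c Wx.1 Wy.1).
  by rewrite mulrDr mulrCA.
by rewrite scalerDl scalerA.
Qed.

(** [perp] does not increase the form and [lift] preserves it, so [ind_mono] gives both inequalities
    although [perp] has the combinations of the [zeta a] in its kernel. *)
Lemma ind_reduction : ind quasi_periodic h_jump =
  ind (Xperp tau gamma g zeta) (hperp tau gamma g D U zeta).
Proof.
have X0 := subspace0 Xperp_subspace.
have J0 := subspace0 quasi_periodic_subspace.
have ht00 : h_jump 0 0 = 0.
  exact (symbil0l (sobolev_subspace gamma) h_jump_symbilinear (subspace0 (sobolev_subspace gamma))).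
have hp00 : hperp tau gamma g D U zeta 0 0 = 0.
  by rewrite -(h_jump_lift X0) (linear_on0 Xperp_subspace lift_linear_on).
apply/eqP; rewrite eq_le; apply/andP; split.
  apply (ind_mono quasi_periodic_subspace Xperp_subspace perp_linear_on perp_Xperp hp00) => x Xx.
  exact (le_lt_trans (hperp_le Xx)).
apply (ind_mono Xperp_subspace quasi_periodic_subspace lift_linear_on (fun x Xx => lift_quasi_periodic Xx.1) ht00).
by move=> x Xx; rewrite (h_jump_lift Xx).
Qed.

Lemma end_form_periodic t v w : T t v -> T t w -> end_form (t + tau) v w = end_form t v w.
Proof.
move=> tv tw.
have cE u : T t u -> conj_proj (g (t + tau)) (fun a => zeta a (t + tau))
    (fun a => D (zeta a) (t + tau)) u = conj_proj (g t) (fun a => zeta a t) (fun a => D (zeta a) t) u.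
  move=> tu; apply: eq_bigr => a _.
  exact (f_equal2 (fun r x => r *: x) (jcoord_periodic a tu) (Dz_periodic a t)).
have pE : jproj (t + tau) v = jproj t v.
  by apply: eq_bigr => a _; exact (f_equal2 (fun r x => r *: x) (jcoord_periodic a tv) (zper a t)).
have tc u : T t (conj_proj (g t) (fun a => zeta a t) (fun a => D (zeta a) t) u).
  exact (subspace_comb (ST t) _ (fun a => Dz_tangent a t)).
have tp : T t (v - jproj t v) := subspaceB (ST t) tv (jproj_tangent t v).
have E1 := etrans (f_equal (fun u => g (t + tau) u w) (cE v tv)) (g_periodic (tc v) tw).
have E2 := etrans (f_equal2 (fun u x => g (t + tau) u (v - x)) (cE w tw) pE) (g_periodic (tc w) tp).
exact (f_equal2 (fun p q => p + q) E1 E2).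
Qed.

Lemma h_jump_Xspace xi phi : Xspace tau gamma xi -> Xspace tau gamma phi ->
  h_jump xi phi = h_on 0 tau xi phi.
Proof.
move=> [fx px _] [fp pp _]; rewrite /h_jump.
have E : end_form tau (xi tau) (phi tau) = end_form 0 (xi 0) (phi 0).
  have := end_form_periodic (fx 0) (fp 0); rewrite -(px 0) -(pp 0).
  by rewrite (px 0) (pp 0) add0r -{1}(px 0) -{1}(pp 0) add0r.
by rewrite E subrr subr0.
Qed.

Lemma solution_jump x l t : solution x -> jump x l ->
  D x (t + tau) = D x t + \sum_a l a *: D (zeta a) t.
Proof.
move=> Sx xl; have [Sc Dc] := solution_comb Dcov Usym l zS.
rewrite -(D_shift gP Dcov).
have -> : (fun s => x (s + tau)) = 1 *: (\sum_a l a *: zeta a) + x.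
  apply/funext => s; rewrite xl scale1r addrC.
  have E := esym (comb_cst l zeta s).
  exact (f_equal (fun v => v + x s) E).
by rewrite (D_solution_lin Dcov 1 t Sc Sx) scale1r Dc addrC.
Qed.

(** After integration by parts everything is expressed at time 0. The terms with the jump [l] of [x]
    cancel against the end form, which is the purpose of that form; what survives is the pairing
    [omega] of the data of [zeta b] and [x], weighted by the jump of [phi]. *)
Lemma jump_pairing x phi l mu : solution x -> jump x l -> sobolev phi -> jump phi mu ->
  h_jump x phi = \sum_b mu b * (g 0 (zeta b 0) (D x 0) - g 0 (x 0) (D (zeta b) 0)).
Proof.
move=> Sx xl Wp pm; have [fx dx _ _] := Sx.
have tc t (c : 'I_k -> R) : T t (\sum_a c a *: zeta a t).
  exact (subspace_comb (ST t) c (fun a => z_tangent a t)).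
have td t (c : 'I_k -> R) : T t (\sum_a c a *: D (zeta a) t).
  exact (subspace_comb (ST t) c (fun a => Dz_tangent a t)).
have tx := fx 0; have tX := solution_tangent Dcov 0 Sx; have tp := Wp.1 0.
have xt := xl 0; have pt := pm 0; have Xt := solution_jump 0 Sx xl.
have tpt := subspaceD (ST 0) tp (tc 0 mu).
have txt := subspaceD (ST 0) tx (tc 0 l).
have tXt := subspaceD (ST 0) tX (td 0 l).
have gE := g_periodic tXt tpt; have BE := end_form_periodic txt tpt.
rewrite !add0r in xt pt Xt gE BE.
have [B0l B0s] := end_form_symbilinear 0.
rewrite /h_jump (solution_by_parts LL gP Dcov Dmet Usym Sx Wp (ltW tau_gt0)).
rewrite xt pt Xt gE BE.
have E1 := symbilDl (BB 0) tX (td 0 l) tpt.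
have E2 := symbilDr (ST 0) (BB 0) tp (tc 0 mu) tX.
have E3 := symbilDl (end_form_symbilinear 0) tx (tc 0 l) tpt.
have E4 := symbilDr (ST 0) (end_form_symbilinear 0) tp (tc 0 mu) tx.
have E5 := end_form_span l tpt.
have E6 := etrans (symbilC (end_form_symbilinear 0) tx (tc 0 mu)) (end_form_span mu tx).
have H (p q r u v w a b c d e : R) : p = q + r -> q = u + v -> a = b + c -> b = d + e ->
    c = r -> e = w -> p - u - (a - d) = v - w.
  by move=> -> -> -> -> -> ->; clear; ring.
rewrite (H _ _ _ _ _ _ _ _ _ _ _ E1 E2 E3 E4 E5 E6).
have F1 := symbil_sumr (ST 0) (BB 0) mu (fun b => z_tangent b 0) tX.
have F2 := symbil_suml (ST 0) (BB 0) mu (fun b => Dz_tangent b 0) tx.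
rewrite F1 F2 -sumrB; apply: eq_bigr => b _.
have H2 (p q r u v : R) : q = u -> r = v -> p * q - p * r = p * (u - v).
  by move=> -> ->; rewrite mulrBr.
exact (H2 _ _ _ _ _ (symbilC (BB 0) tX (z_tangent b 0)) (symbilC (BB 0) (Dz_tangent b 0) tx)).
Qed.

Lemma jump_comb (c : 'I_k -> R) (x : 'I_k -> field) (l : 'I_k -> 'I_k -> R) :
  (forall a, jump (x a) (l a)) ->
  jump (\sum_a c a *: x a) (fun b => \sum_a c a * l a b).
Proof.
move=> xl t; rewrite (comb_cst c x (t + tau)) (comb_cst c x t).
rewrite (eq_bigr (fun a => c a *: x a t + \sum_b c a *: (l a b *: zeta b t))); last first.
  move=> a _; rewrite -scaler_sumr -scalerDr -xl; by [].
rewrite big_split; congr (_ + _); rewrite exchange_big; apply: eq_bigr => b _ /=.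
by rewrite scaler_suml; apply: eq_bigr => a _; rewrite scalerA.
Qed.

(** * The solutions issuing from the complementary Lagrangian basis *)

Section dual_solutions.
Context (x : 'I_k -> field) (s : 'M[R]_k).
Hypotheses (xS : forall a, solution (x a)) (xjump : forall a, jump (x a) (s a))
  (zx : forall a b, g 0 (zeta b 0) (D (x a) 0) - g 0 (x a 0) (D (zeta b) 0) = (b == a)%:R)
  (sU : s \in unitmx).

Lemma dual_sobolev a : sobolev (x a).
Proof. exact (solution_sobolev Dcov Usym (xS a)).1. Qed.

(** The duality of the two bases turns [jump_pairing] into reading off one coefficient of the jump.
    For periodic [phi] this is orthogonality to X; for [phi := x b] it gives the entry [s b a], so
    that symmetry of [h_jump] forces that of [s]. *)
Lemma h_jump_dual a phi mu : sobolev phi -> jump phi mu -> h_jump (x a) phi = mu a.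
Proof.
move=> Wp pm; have H (p : 'I_k -> R) : (forall b, p b = (b == a)%:R) -> \sum_b mu b * p b = mu a.
  move=> pa; rewrite (bigD1 a)//= pa eqxx mulr1.
  by rewrite big1 ?addr0// => b /negbTE ba; rewrite pa ba mulr0.
exact (etrans (jump_pairing (xS a) (xjump a) Wp pm) (H _ (zx a))).
Qed.

Lemma jump_sym : s^T = s.
Proof.
apply/matrixP => a b; rewrite mxE.
exact (etrans (esym (h_jump_dual a (dual_sobolev b) (xjump b)))
  (etrans (h_jump_symbilinear.2 _ _ (dual_sobolev a) (dual_sobolev b))
          (h_jump_dual b (dual_sobolev a) (xjump a)))).
Qed.

Lemma quasi_periodic_dual a : quasi_periodic (x a).
Proof. by split; [exact: dual_sobolev|exists (s a)]. Qed.

Lemma Xspace_jump xi : Xspace tau gamma xi -> jump xi (fun=> 0).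
Proof. by move=> [_ px _] t; rewrite px big1 ?addr0// => a _; rewrite scale0r. Qed.

Lemma Xspace_quasi_periodic xi : Xspace tau gamma xi -> quasi_periodic xi.
Proof. by move=> Xx; split; [exact (Xspace_sobolev Xx)|exists (fun=> 0); exact (Xspace_jump Xx)]. Qed.

Lemma quasi_periodic_decomposition xi : quasi_periodic xi ->
  exists x1 x2, [/\ Xspace tau gamma x1, lin_span x x2 & xi = x1 + x2].
Proof.
(* The coefficients l s^-1 give the combination of the [x a] that has the same jump as [xi]; the
   difference is then periodic. *)
move=> [Wx [l xl]]; pose c a := ((\row_b l b) *m invmx s) 0 a.
have cs b : \sum_a c a * s a b = l b.
  have := congr1 (fun A : 'rV[R]_k => A 0 b) (mulmxKV sU (\row_b l b)).
  by rewrite [in RHS]mxE => <-; rewrite mxE.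
pose y := \sum_a c a *: x a.
have Wy : sobolev y.
  exact (subspace_comb (sobolev_subspace gamma) c dual_sobolev).
exists (xi - y), y; split; last by rewrite subrK.
  apply/XspaceE; split; first exact (subspaceB (sobolev_subspace gamma) Wx Wy).
  move=> t; rewrite (_ : (xi - y) (t + tau) = xi (t + tau) - y (t + tau))//.
  have yl : y (t + tau) = y t + \sum_a l a *: zeta a t.
    rewrite (jump_comb c xjump t : y (t + tau) = _); congr (_ + _).
    by apply: eq_bigr => b _; rewrite cs.
  rewrite xl yl opprD addrACA subrr addr0.
  by [].
by exists c.
Qed.

Lemma dual_maxneg n : maxneg setT (mxform s) n -> maxneg (lin_span x) h_jump n.
Proof.
have Wspan c : sobolev (\sum_a c a *: x a).
  exact (subspace_comb (sobolev_subspace gamma) c dual_sobolev).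
pose f (v : 'cV[R]_k) : field := \sum_a v a 0 *: x a.
apply: (@maxneg_image _ _ _ _ _ _ _ f) => //.
- move=> c u v _ _; rewrite /f scaler_sumr -big_split; apply: eq_bigr => a _ /=.
  by rewrite !mxE scalerDl scalerA.
- by move=> v _; exists (fun a => v a 0).
- move=> _ [c ->]; exists (\col_a c a) => //; apply: eq_bigr => a _; by rewrite mxE.
move=> u v _ _; rewrite /f.
rewrite (symbil_suml (sobolev_subspace gamma) h_jump_symbilinear (fun a => u a 0) dual_sobolev
  (Wspan (fun a => v a 0))).
rewrite /mxform -mulmxA mxE; apply: eq_bigr => a _.
rewrite (h_jump_dual a (Wspan _) (jump_comb (fun a => v a 0) xjump)) !mxE; congr (_ * _).
by apply: eq_bigr => c _; rewrite mulrC -[in LHS]jump_sym mxE.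
Qed.

Lemma index_difference n : maxneg setT (mxform s) n ->
  exists n1 : nat, ind (Xspace tau gamma) (hform tau g D U) = n1%:R%:E /\
    ind (Xperp tau gamma g zeta) (hperp tau gamma g D U zeta) = (n1 + n)%:R%:E.
Proof.
move=> /dual_maxneg mx2.
have SX := Xspace_subspace tau gamma.
have [n1 mx1] := hform_maxneg LL gP Dcov Dmet Usym tau_gt0.
exists n1; split.
  have -> : hform tau g D U = h_on 0 tau by apply/funext => xi; apply/funext => phi; exact: hformE.
  apply: (maxneg_ind SX _ mx1).
  have [hl hs] := h_on_symbilinear LL gP Dcov Dmet Usym (ltW tau_gt0).
  split=> [c u v w /Xspace_sobolev Wu /Xspace_sobolev Wv /Xspace_sobolev Ww|
    u v /Xspace_sobolev Wu /Xspace_sobolev Wv]; [exact: hl|exact: hs].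
rewrite -ind_reduction.
have bJ : symbilinear_on quasi_periodic h_jump.
  have [hl hs] := h_jump_symbilinear.
  split=> [c u v w /quasi_periodic_sobolev Wu /quasi_periodic_sobolev Wv /quasi_periodic_sobolev Ww|
    u v /quasi_periodic_sobolev Wu /quasi_periodic_sobolev Wv]; [exact: hl|exact: hs].
apply: (maxneg_ind quasi_periodic_subspace bJ).
have SJ := quasi_periodic_subspace.
apply: (maxneg_add SJ bJ SX _ Xspace_quasi_periodic _ quasi_periodic_decomposition) mx2.
- split=> [|a _ _ [c ->] [d ->]].
    by exists (fun=> 0); rewrite big1// => a _; rewrite scale0r.
  exists (fun b => a * c b + d b); rewrite scaler_sumr -big_split; apply: eq_bigr => b _.
  by rewrite scalerDl scalerA.
- by move=> _ [c ->]; exact (subspace_comb SJ c quasi_periodic_dual).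
- move=> x1 _ X1 [c ->]; have W1 := Xspace_sobolev X1.
  rewrite (symbil_sumr (sobolev_subspace gamma) h_jump_symbilinear c dual_sobolev W1).
  rewrite big1// => a _.
  rewrite (h_jump_symbilinear.2 _ _ W1 (dual_sobolev a)) (h_jump_dual a W1 (Xspace_jump X1)).
  exact (mulr0 _).
apply: (@maxneg_image _ _ _ _ _ _ _ (fun x => x) _ SX) mx1 => //.
- by move=> y Xy; exists y.
- by move=> u v Xu Xv; exact: h_jump_Xspace.
Qed.

End dual_solutions.

Lemma gbarE a b : gbar tau g zeta a b = Int 0 tau (fun t => inv_gram t a b).
Proof. by rewrite mxE -IntE. Qed.

Lemma gbar_sym : (gbar tau g zeta)^T = gbar tau g zeta.
Proof.
apply/matrixP => a b; rewrite mxE !gbarE.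
by apply: Int_eq => t _; exact: inv_gram_sym.
Qed.

(** The inverse Gram matrix is positive definite at each time and continuous, so the integrand has a
    positive minimum on [0, tau]; this yields the strict inequality. *)
Lemma gbar_posdef (x : 'cV[R]_k) : x != 0 -> 0 < mxform (gbar tau g zeta) x x.
Proof.
move=> x0; have t0 := ltW tau_gt0.
pose p t := \sum_a \sum_b (x a 0 * x b 0) * inv_gram t a b.
have cgi a b : cont_on 0 tau (fun t => inv_gram t a b).
  by apply: cont_on_at => t _; exact (C1fun_cont (inv_gram_C1 a b) (x := t)).
have cp : cont_on 0 tau p.
  apply: cont_on_sum => a; apply: cont_on_sum => b.
  exact (cont_onM (@cont_on_cst _ _ _ _) (cgi a b)).
have -> : mxform (gbar tau g zeta) x x = Int 0 tau p.
  have I1 a b : Int 0 tau (fun t => x a 0 * x b 0 * inv_gram t a b) = x a 0 * gbar tau g zeta a b * x b 0.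
    by rewrite (IntZ _ (cont_on_L1 (cgi a b))) gbarE mulrAC.
  have Lab a b : L1 0 tau (fun t => x a 0 * x b 0 * inv_gram t a b) := L1Z _ (cont_on_L1 (cgi a b)).
  rewrite mxform_delta /p Int_sum => [|a]; last by apply: L1_sum => b; exact: Lab.
  by apply: eq_bigr => a _; rewrite Int_sum//; apply: eq_bigr => b _.
have p0 t : 0 < p t.
  have [a xa] : exists a, x a 0 != 0.
    by move: x0 => /cV0Pn[a xa]; exists a.
  exact (inv_gram_mx_quad (ST t) (BB t) (BP (t := t)) (fun a => z_tangent a t) (@zfree t)
    (ex_intro (fun a => x a 0 != 0) a xa)).
have [c _ cmin] := EVT_min t0 cp.
apply: (@lt_le_trans _ _ (p c * (tau - 0))); first by rewrite subr0 mulr_gt0.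
rewrite -(Int_cst _ t0); apply: Int_le.
- exact: cont_on_L1 (@cont_on_cst _ _ _ _).
- exact: cont_on_L1.
by apply: aeonT => t tab; apply: cmin; rewrite in_itv.
Qed.

End jacobi.

(** * The index formula *)

(** The matrices expressing [e] through [z] and [z] through [e] satisfy A B = 1 since [e] is free,
    hence B A = 1. A relation among the [z i] is then killed by B, and so is zero. *)
Lemma lin_span_free (R : realType) (E : lmodType R) n (z : 'I_n -> E) :
  has_dim (lin_span z) n -> lin_indep z.
Proof.
move=> [e [ei es]] c c0.
have ez i : exists x : 'I_n -> R, e i = \sum_j x j *: z j.
  have : lin_span e (e i).
    exists (fun j => (j == i)%:R); rewrite (bigD1 i)//= eqxx scale1r big1 ?addr0//.
    by move=> j /negbTE ->; rewrite scale0r.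
  by rewrite es.
have ze i : exists x : 'I_n -> R, z i = \sum_j x j *: e j.
  have : lin_span z (z i).
    exists (fun j => (j == i)%:R); rewrite (bigD1 i)//= eqxx scale1r big1 ?addr0//.
    by move=> j /negbTE ->; rewrite scale0r.
  by rewrite -es.
have [a aP] := choice ez; have [b bP] := choice ze.
pose A := \matrix_(i, j) a i j; pose B := \matrix_(i, j) b i j.
have comb (x : 'rV[R]_n) (F : 'M[R]_n) (u : 'I_n -> E) :
    \sum_i x 0 i *: (\sum_j F i j *: u j) = \sum_j (x *m F) 0 j *: u j.
  under eq_bigr do rewrite scaler_sumr.
  rewrite exchange_big; apply: eq_bigr => j _ /=; rewrite mxE scaler_suml.
  by apply: eq_bigr => i _; rewrite scalerA.
have AE i : e i = \sum_j A i j *: z j.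
  by rewrite aP; apply: eq_bigr => j _; rewrite mxE.
have BE i : z i = \sum_j B i j *: e j.
  by rewrite bP; apply: eq_bigr => j _; rewrite mxE.
have AB : A *m B = 1%:M.
  apply/matrixP => i j; apply/eqP; rewrite -subr_eq0; apply/eqP; move: j.
  apply: ei.
  under eq_bigr do rewrite scalerBl.
  rewrite sumrB.
  have -> : \sum_j (A *m B) i j *: e j = e i.
    rewrite [RHS]AE; transitivity (\sum_j (row i A) 0 j *: \sum_l B j l *: e l).
      by rewrite comb -row_mul; apply: eq_bigr => j _; rewrite [in RHS]mxE.
    by apply: eq_bigr => j _; rewrite [in LHS]mxE -BE.
  rewrite (bigD1 i)//= mxE eqxx scale1r big1 ?addr0 ?subrr// => j /negbTE ji.
  by rewrite mxE eq_sym ji scale0r.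
have BA := mulmx1C AB.
pose v : 'rV[R]_n := \row_i c i.
have vB : v *m B = 0.
  apply/matrixP => r j; rewrite (ord1 r) [RHS]mxE; move: j; apply: ei.
  rewrite -comb -[RHS]c0; apply: eq_bigr => i _.
  by rewrite mxE -BE.
move=> i; have : (v *m B *m A) 0 i = c i by rewrite -mulmxA BA mulmx1 mxE.
by rewrite vB mul0mx mxE.
Qed.

(** In the derivative the terms (D x, D y) cancel and (U x, y) - (x, U y) vanishes. Up to sign this
    is the invariance of [omega] under the flow. *)
Lemma wronskian_constant (R : realType) (m : nat) (M : manifold R m) (tau : R)
    (L : M -> (idx M -> 'cV[R]_m) -> R -> R) (gamma : R -> M)
    (D : (R -> idx M -> 'cV[R]_m) -> R -> idx M -> 'cV[R]_m)
    (U : R -> (idx M -> 'cV[R]_m) -> idx M -> 'cV[R]_m) x y t :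
  covariant_derivative tau gamma D ->
  metric_compatible gamma (metric L gamma) D ->
  symmetric_operator tau gamma (metric L gamma) U ->
  variational_solution gamma D U x -> variational_solution gamma D U y ->
  metric L gamma t (D x t) (y t) - metric L gamma t (x t) (D y t) =
  metric L gamma 0 (D x 0) (y 0) - metric L gamma 0 (x 0) (D y 0).
Proof.
move=> Dcov Dmet Usym [fx dx dDx DDx] [fy dy dDy DDy].
have fDx : field_along gamma (D x) by move=> s; exact (D_tangent Dcov fx (dx s)).
have fDy : field_along gamma (D y) by move=> s; exact (D_tangent Dcov fy (dy s)).
pose f s := metric L gamma s (D x s) (y s) + -1 * metric L gamma s (x s) (D y s).
have H (u p q r : R) : u = r -> u + p + (0 * q + -1 * (p + r)) = 0.
  by move=> ->; clear; ring.
have Df s : is_derive s (1 : R) f 0.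
  have H1 := Dmet _ _ s fDx fy (dDx s) (dy s); have H2 := Dmet _ _ s fx fDy (dx s) (dDy s).
  have H3 := is_deriveM_fun (is_derive_cst (-1 : R) s (1 : R)) H2.
  have H4 := is_deriveD_fun H1 H3; rewrite (H _ _ _ _ _) in H4; first exact H4.
  rewrite DDx DDy; exact (U_sym Usym (fx s) (fy s)).
have := is_derive_0_is_cst t 0 Df; rewrite /f.
have G (a b : R) : a - b = a + -1 * b by rewrite mulN1r.
by move=> E; exact (etrans (G _ _) (etrans E (esym (G _ _)))).
Qed.

Lemma pair_sum (R : realType) (E F : lmodType R) (I : Type) (r : seq I) (u : I -> E * F) :
  \sum_(i <- r) u i = (\sum_(i <- r) (u i).1, \sum_(i <- r) (u i).2).
Proof.
elim: r => [|i r IH]; first by rewrite !big_nil.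
by rewrite !big_cons IH; case: (u i).
Qed.

Theorem theorem6p3 (R : realType) (m : nat) (M : manifold R m) (tau : R)
  (tau_gt0 : 0 < tau)
  (L : M -> (idx M -> 'cV[R]_m) -> R -> R)
  (L_lagrangian : lagrangian_function tau L)
  (gamma : R -> M)
  (gamma_trajectory : periodic_trajectory tau L gamma)
  (D : (R -> idx M -> 'cV[R]_m) -> R -> idx M -> 'cV[R]_m)
  (U : R -> (idx M -> 'cV[R]_m) -> idx M -> 'cV[R]_m)
  (D_covariant : covariant_derivative tau gamma D)
  (D_metric : metric_compatible gamma (metric L gamma) D)
  (U_symmetric : symmetric_operator tau gamma (metric L gamma) U)
  (h_second_variation :
    second_variation tau L gamma (hform tau (metric L gamma) D U))
  (P : (idx M -> 'cV[R]_m) * (idx M -> 'cV[R]_m) ->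
       (idx M -> 'cV[R]_m) * (idx M -> 'cV[R]_m))
  (P_poincare : poincare_map tau gamma D U P)
  (N_symplectic : symplectic_on (omega (metric L gamma)) (Nspace gamma P))
  (V_lagrangian : lagrangian_subspace (omega (metric L gamma))
    (Nspace gamma P) (Vspace gamma P))
  (k : nat)
  (w : 'I_k -> (idx M -> 'cV[R]_m) * (idx M -> 'cV[R]_m))
  (w_basis : is_basis w (Vspace gamma P))
  (zeta : 'I_k -> R -> idx M -> 'cV[R]_m)
  (zeta_solution : forall a, variational_solution gamma D U (zeta a))
  (zeta_periodic : forall a t, zeta a (t + tau) = zeta a t)
  (zeta_w : forall a, (zeta a 0, D (zeta a) 0) = w a)
  (Q : set ((idx M -> 'cV[R]_m) * (idx M -> 'cV[R]_m)))
  (Q_lagrangian : lagrangian_subspace (omega (metric L gamma))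
    (Nspace gamma P) Q)
  (Q_complement : complement_in (Nspace gamma P) (Vspace gamma P) Q)
  (q : 'I_k -> (idx M -> 'cV[R]_m) * (idx M -> 'cV[R]_m))
  (q_basis : is_basis q Q)
  (omega_wq : forall a b, omega (metric L gamma) (w a) (q b) = (a == b)%:R)
  (omega_qq : forall a b, omega (metric L gamma) (q a) (q b) = 0)
  (s : 'M[R]_k)
  (P_q : forall a, P (q a) = q a + \sum_b s a b *: w b)
  (F_dim : forall t, has_dim (Fspace zeta t) k)
  (Aperp_nondegenerate :
    \det (Aperp s (gbar tau (metric L gamma) zeta)) != 0) :
  (ind (Xspace tau gamma) (hform tau (metric L gamma) D U)
   - ind (Xperp tau gamma (metric L gamma) zeta)
         (hperp tau gamma (metric L gamma) D U zeta)
   = ind_mx (Amx s (gbar tau (metric L gamma) zeta))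
     - ind_mx (Aperp s (gbar tau (metric L gamma) zeta)))%E.

Proof.
set g := metric L gamma.
have LL := L_lagrangian; have gP := gamma_trajectory.
have [VN Viso _] := V_lagrangian; have [w_free wV] := w_basis; have [q_free qQ] := q_basis.
have [QN _ _] := Q_lagrangian; have [_ VQ0 _] := Q_complement.
have mem_span n (u : 'I_n -> (idx M -> 'cV[R]_m) * (idx M -> 'cV[R]_m)) i : lin_span u (u i).
  exists (fun j => (j == i)%:R); rewrite (bigD1 i)//= eqxx scale1r big1 ?addr0//.
  by move=> j /negbTE ->; rewrite scale0r.
have zfree t : lin_indep (fun a => zeta a t) := lin_span_free (F_dim t).
(* V is isotropic, so the Wronskian of two periodic solutions vanishes at time 0, and it is constant
   in time. *)
have ziso a b t : g t (D (zeta a) t) (zeta b t) = g t (zeta a t) (D (zeta b) t).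
  apply/eqP; rewrite -subr_eq0; apply/eqP.
  have WC := wronskian_constant t D_covariant D_metric U_symmetric (zeta_solution a) (zeta_solution b).
  have wab : omega g (w a) (w b) = 0.
    by apply: Viso; rewrite -wV; exact: mem_span.
  have gb0 := metric_symbilinear LL gP 0.
  have tz c := z_tangent zeta_solution c 0.
  have tDz c := Dz_tangent D_covariant zeta_solution c 0.
  move: wab; rewrite /omega -!zeta_w /= => wab.
  have H (c d e u v : R) : c = d - e -> u - v = 0 -> u = e -> v = d -> c = 0.
    move=> -> uv <- <-; apply/eqP; rewrite subr_eq0 eq_sym -subr_eq0 uv; by [].
  exact (H _ _ _ _ _ WC wab erefl (symbilC gb0 (tz b) (tDz a))).
have Wq a : Wspace gamma (q a).
  have [] : Nspace gamma P (q a) by apply: QN; rewrite -qQ; exact: mem_span.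
  by [].
(* The Poincare map is known by its graph, so the pair of [q a] and [P (q a)] comes with a solution
   joining them. *)
have [x xP] : exists x : 'I_k -> R -> idx M -> 'cV[R]_m, forall a,
    [/\ variational_solution gamma D U (x a), (x a 0, D (x a) 0) = q a &
        (x a tau, D (x a) tau) = P (q a)].
  exists (fun a => projT1 (cid ((@P_poincare (q a) (P (q a)) (Wq a)).1 erefl))) => a.
  exact (projT2 (cid ((@P_poincare (q a) (P (q a)) (Wq a)).1 erefl))).
have xS a : variational_solution gamma D U (x a) by case: (xP a).
have x0 a : (x a 0, D (x a) 0) = q a by case: (xP a).
have xtau a : x a tau = x a 0 + \sum_b s a b *: zeta b 0 /\
    D (x a) tau = D (x a) 0 + \sum_b s a b *: D (zeta b) 0.
  have [_ _] := xP a; rewrite P_q -(x0 a) pair_sum => -[-> ->] /=; split; congr (_ + _);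
    by apply: eq_bigr => b _; rewrite -zeta_w.
(* [P_q] gives the jump only at t = 0. The shifted solution and x_a + sum s_ab zeta^b have equal
   data there, so uniqueness extends the relation to all t. *)
have xjump a : jump tau zeta (x a) (s a).
  have [Sc Dc] := solution_comb D_covariant U_symmetric (s a) zeta_solution.
  have E : (fun t => x a (t + tau)) = 1 *: (\sum_b s a b *: zeta b) + x a.
    apply: (solution_unique LL gP D_covariant D_metric U_symmetric).
    - exact (solution_shift gP D_covariant U_symmetric (xS a)).
    - exact (solution_lin D_covariant U_symmetric 1 Sc (xS a)).
    - rewrite add0r (xtau a).1 scale1r addrC.
      exact (f_equal (fun v => v + x a 0) (esym (comb_cst (s a) zeta 0))).
    - rewrite (D_shift gP D_covariant) add0r (xtau a).2.
      rewrite (D_solution_lin D_covariant 1 0 Sc (xS a)) scale1r Dc.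
      exact (addrC _ _).
  move=> t; rewrite (f_equal (fun y => y t) E) scale1r.
  exact (etrans (f_equal (fun v => v + x a t) (comb_cst (s a) zeta t)) (addrC _ _)).
have zx a b : g 0 (zeta b 0) (D (x a) 0) - g 0 (x a 0) (D (zeta b) 0) = (b == a)%:R.
  by have := omega_wq b a; rewrite -zeta_w -x0.
(* A left kernel vector v of [s] makes [d], the combination of the [q a] with coefficients v, a
   fixed vector of P. Then d lies in both V and Q, so d = 0, and v = 0 since the [q a] are free. *)
have sU : s \in unitmx.
  rewrite unitmxE unitfE; apply/negP => /det0P[v v0 vs].
  pose y := \sum_a v 0 a *: x a.
  have [Sy Dy] := solution_comb D_covariant U_symmetric (v 0) xS.
  have yE t : y t = \sum_a v 0 a *: x a t := comb_cst (v 0) x t.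
  have DyE t : D y t = \sum_a v 0 a *: D (x a) t := Dy t.
  pose d := \sum_a v 0 a *: q a.
  have dE : (y 0, D y 0) = d.
    rewrite /d pair_sum yE DyE.
    by congr pair; apply: eq_bigr => a _; rewrite -x0.
  have vs0 b : \sum_a v 0 a * s a b = 0.
    by have := congr1 (fun A : 'rV[R]_k => A 0 b) vs; rewrite !mxE.
  have comb0 (u : 'I_k -> idx M -> 'cV[R]_m) : \sum_a v 0 a *: (\sum_b s a b *: u b) = 0.
    under eq_bigr do rewrite scaler_sumr.
    rewrite exchange_big big1// => b _ /=.
    by under eq_bigr do rewrite scalerA; rewrite -scaler_suml vs0 scale0r.
  have Wd : Wspace gamma d.
    rewrite -dE; split; first by have [fy _ _ _] := Sy; exact: fy.
    exact (solution_tangent D_covariant 0 Sy).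
  have Pd : P d = d.
    apply/(@P_poincare d d Wd); exists y; split=> //.
    rewrite -dE !yE !DyE.
    by congr pair; [under eq_bigr do rewrite (xtau _).1|under eq_bigr do rewrite (xtau _).2];
      under eq_bigr do rewrite scalerDr; rewrite big_split comb0 /= addr0.
  have d0 : d = 0.
    apply: VQ0; split; last by rewrite -qQ; exists (v 0).
    by split=> //; rewrite Pd subrr.
  move/eqP: v0; apply; apply/matrixP => r a; rewrite (ord1 r) [RHS]mxE.
  exact: (q_free _ d0).
have sT := jump_sym LL gP D_covariant D_metric U_symmetric tau_gt0 zeta_solution zeta_periodic
  ziso zfree xS xjump zx.
have [n [a [mx -> ->]]] := ind_mx_Aperp sT sU
  (gbar_sym LL gP zeta_solution)
  (gbar_posdef LL gP D_covariant D_metric tau_gt0 zeta_solution zfree).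
have [n1 [-> ->]] := index_difference LL gP D_covariant D_metric U_symmetric tau_gt0
  zeta_solution zeta_periodic ziso zfree xS xjump zx sU mx.
(* All four indices are now finite, and both sides are - n, as n1 - (n1 + n) and a - (n + a). *)
rewrite -!EFinB !natrD; congr EFin.
by rewrite opprD addrA subrr add0r opprD addrCA subrr addr0.
Qed.
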